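(* Consider the two-sample setting and the Benjamini–Hochberg (B-H) procedure based on two-sample Student $t$ statistics described in the context, with fixed $\alpha\in(0,1)$, and let $m\to\infty$. Assume: (C2) There exist constants $K_1>0$, $t_0>0$, $c_1,c_2>0$, $c>0$ and $\zeta>5$ such that $E\exp(t_0|X_{i,j}-\mu_{i,j}|/\sigma_{i,j})\le K_1$ for all $1\le i\le m$, $j=1,2$; $c_1\le n_1/n_2\le c_2$; $c_1\le\sigma^2_{i,1}/\sigma^2_{i,2}\le c_2$ for all $i$; and $\min(n_1,n_2)\ge c(\log m)^\zeta$; (C3) There exists a constant $K>0$ such that for every $i\in\mathcal{H}_0$ there is $\mathcal{M}_i\subset\mathcal{H}_0$ with $|\mathcal{M}_i|\ge m_0-K$ such that $\{(X_{j,1},X_{j,2}):j\in\mathcal{M}_i\}$ is independent of $(X_{i,1},X_{i,2})$. Assume further that for some fixed $\theta>0$, $$\frac{|\mu_{i,1}-\mu_{i,2}|}{\sqrt{\sigma^2_{i,1}/n_1+\sigma^2_{i,2}/n_2}}=\theta\sqrt{\log m}\quad\text{for all } i\in\mathcal{H}_1,$$ and $|\mathcal{H}_1|=m^\beta$ for some fixed $0<\beta<1$. If $0<\theta<\sqrt{2(1-\beta)}$, then $\mathrm{power}_{BH}\to0$ in probability as $m\to\infty$. If $\theta>\sqrt{2(1-\beta)}$, then $\mathrm{power}_{BH}\to1$ in probability as $m\to\infty$.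
   Context: Data: for each $m$, $\boldsymbol{X}_1=(X_{1,1},\dots,X_{m,1})$, $\boldsymbol{X}_2=(X_{1,2},\dots,X_{m,2})$ random vectors with means $\mu_{i,j}$ and variances $\sigma^2_{i,j}$; $\boldsymbol{X}_{k,1}=(X_{k,1,1},\dots,X_{k,m,1})$, $1\le k\le n_1$, i.i.d. copies of $\boldsymbol{X}_1$; $\boldsymbol{X}_{k,2}$, $1\le k\le n_2$, i.i.d. copies of $\boldsymbol{X}_2$; samples independent. Hypotheses $H_{i0}:\mu_{i,1}=\mu_{i,2}$; $\mathcal{H}_0=\{i:\mu_{i,1}=\mu_{i,2}\}$, $m_0=|\mathcal{H}_0|$, $\mathcal{H}_1=\{i:\mu_{i,1}\neq\mu_{i,2}\}$, $m_1=|\mathcal{H}_1|$. All quantities may depend on $m$; $\log$ is natural log. Test statistics: $\bar X_{i,j}=n_j^{-1}\sum_kX_{k,i,j}$, $\hat\sigma^2_{i,j}=(n_j-1)^{-1}\sum_k(X_{k,i,j}-\bar X_{i,j})^2$, and either $T_i=(\bar X_{i,1}-\bar X_{i,2})/\sqrt{\hat\sigma^2_{i,1}/n_1+\hat\sigma^2_{i,2}/n_2}$ (general variances) or, in the equal-variance case, the pooled version $T_i=\sqrt{n_1n_2/((n_1+n_2)\hat\sigma^2_{i,pool})}(\bar X_{i,1}-\bar X_{i,2})$ with $\hat\sigma^2_{i,pool}=(n_1+n_2-2)^{-1}\sum_j\sum_k(X_{k,i,j}-\bar X_{i,j})^2$. $\Psi$ = cdf of Student's $t$ with $n_1+n_2-2$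 degrees of freedom, $G(t)=2-2\Psi(t)$, $p_i=G(|T_i|)$. B-H procedure: with ordered $p_{(1)}\le\dots\le p_{(m)}$ and $p_{(0)}=0$, $\hat k=\max\{0\le k\le m:p_{(k)}\le\alpha k/m\}$; reject $H_{i0}$ iff $p_i\le p_{(\hat k)}$ (nothing if $\hat k=0$). $\mathrm{power}_{BH}=\sum_{i\in\mathcal{H}_1}I\{H_{i0}\text{ rejected}\}/m_1$. *)

(* Defs.v *)
From HB Require Import structures.
From mathcomp Require Import all_boot all_order all_algebra.
From mathcomp Require Import all_classical all_reals all_analysis.
Set Implicit Arguments. Unset Strict Implicit. Unset Printing Implicit Defensive.
Import Order.TTheory GRing.Theory Num.Theory.
Import numFieldNormedType.Exports.
Local Open Scope classical_set_scope.
Local Open Scope ring_scope.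

Section Defs.
Variable R : realType.

Section Prob.
Context d (T : measurableType d) (P : probability T R).

Definition gen_sigma (Fs : set (T -> R)) : set (set T) :=
  <<s [set A | exists f, Fs f /\ exists C : set R, measurable C /\ A = f @^-1` C] >>.

Definition indep_family (A : eqType) (D : pred A) (F : A -> set (set T)) :=
  forall (J : seq A) (E : A -> set T), uniq J ->
    (forall a, a \in J -> D a /\ F a (E a)) ->
    P (\big[setI/setT]_(a <- J) E a) = (\big[*%E/1%E]_(a <- J) P (E a))%E.

Definition indep2 (F G : set (set T)) :=
  forall A B, F A -> G B -> P (A `&` B) = (P A * P B)%E.

(* the random vectors (Y 0, ..., Y (m-1)) and (Z 0, ..., Z (m-1)) have the same
   joint law (tested on the generating pi-system of measurable rectangles) *)
Definition same_law (m : nat) (Y Z : nat -> T -> R) :=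
  forall C : nat -> set R, (forall i, measurable (C i)) ->
    P (\big[setI/setT]_(i < m) (Y i @^-1` C i)) =
    P (\big[setI/setT]_(i < m) (Z i @^-1` C i)).

Definition has_mean (Y : T -> R) (mu : R) :=
  P.-integrable setT (EFin \o Y) /\ (\int[P]_x (Y x)%:E = mu%:E)%E.
Definition has_variance (Y : T -> R) (mu s2 : R) :=
  (\int[P]_x ((Y x - mu) ^+ 2)%:E = s2%:E)%E.
End Prob.

Definition student_dens (nu x : R) : R :=
  (1 + x ^+ 2 / nu) `^ (- ((nu + 1) / 2)).
Definition student_cdf (nu t : R) : R :=
  fine (\int[@lebesgue_measure R]_(x in [set x : R | (x <= t)%R]) (student_dens nu x)%:E)%E
  / fine (\int[@lebesgue_measure R]_x (student_dens nu x)%:E)%E.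

(* ---------- Two-sample t statistics (on a realization x j k i = X_{k,i,j}) ---------- *)
Definition smean (nj : nat) (y : nat -> R) : R := (\sum_(k < nj) y k) / nj%:R.
Definition svar (nj : nat) (y : nat -> R) : R :=
  (\sum_(k < nj) (y k - smean nj y) ^+ 2) / (nj%:R - 1).

Definition tstat (pooled : bool) (n1 n2 : nat) (x : nat -> nat -> nat -> R) (i : nat) : R :=
  let y1 := fun k => x 1%N k i in
  let y2 := fun k => x 2%N k i in
  let diff := smean n1 y1 - smean n2 y2 in
  if pooled then
    let sp := (\sum_(k < n1) (y1 k - smean n1 y1) ^+ 2
               + \sum_(k < n2) (y2 k - smean n2 y2) ^+ 2) / (n1%:R + n2%:R - 2) in
    Num.sqrt (n1%:R * n2%:R / ((n1%:R + n2%:R) * sp)) * diff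
  else diff / Num.sqrt (svar n1 y1 / n1%:R + svar n2 y2 / n2%:R).

Definition pvalue (pooled : bool) (n1 n2 : nat) (x : nat -> nat -> nat -> R) (i : nat) : R :=
  2 - 2 * student_cdf (n1%:R + n2%:R - 2) `|tstat pooled n1 n2 x i|.

Definition pord (m : nat) (p : nat -> R) (k : nat) : R :=
  if k == 0%N then 0 else nth 0 (sort <=%R [seq p i | i <- iota 0 m]) k.-1.
Definition khat (alpha : R) (m : nat) (p : nat -> R) : nat :=
  \max_(k < m.+1 | pord m p k <= alpha * k%:R / m%:R) k.
Definition BH_rejects (alpha : R) (m : nat) (p : nat -> R) (i : nat) : bool :=
  (0 < khat alpha m p)%N && (p i <= pord m p (khat alpha m p)).
Definition power_BH (alpha : R) (m : nat) (H1 : pred nat) (p : nat -> R) : R :=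
  (\sum_(i < m | H1 i && BH_rejects alpha m p i) 1%N)%:R / (\sum_(i < m | H1 i) 1%N)%:R.

End Defs.

(* Main.v *)
(** With l = log m, compare the p-values with the level t = m^-a. A test with signal
  theta sqrt(l) has a p-value below m^-a with probability 1 - O(1/l) if a < theta^2/2, and
  above it if a > theta^2/2, by Chebyshev's inequality for the numerator of the statistic and
  concentration of the sample variances.

  If theta^2/2 > 1 - beta, take a between the two: most of the m^beta alternatives have
  p-values below m^-a, which is less than the B-H threshold alpha m^beta / (2 m), so they
  are all rejected.

  If theta^2/2 < 1 - beta, take a between the two: a null p-value is at most u with
  probability at most lam u, uniformly in m^-a <= u <= 1 and with lam close to 1, so by
  Chebyshev's inequality (using (C3) for the covariances) and a union bound over a geometric
  grid of levels, the number of p-values below alpha k / m > m^-a stays below k. Hence only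
  tests with p-value at most m^-a are rejected, and these contain few alternatives.

  The estimate for the null p-values is a Cramer-type bound P(S >= Y) <= lam Q(Y) for
  normalized sums S, uniform for (1 + Y)^4 rho small (rho the largest weight). It is proved by
  Lindeberg replacement along a supersolution of the backward heat equation that lies above
  the indicator of [Y, oo) at the final time. *)

Require Import Defs.
From HB Require Import structures.
From mathcomp Require Import all_boot all_order all_algebra.
From mathcomp Require Import all_classical all_reals all_analysis.
From mathcomp Require Import measurable_realfun ring lra zify.
Import Order.TTheory GRing.Theory Num.Theory.
Import numFieldNormedType.Exports.
Local Open Scope classical_set_scope.
Local Open Scope ring_scope.

Set Implicit Arguments. Unset Strict Implicit. Unset Printing Implicit Defensive.

(** * The Benjamini-Hochberg rule in terms of counts of p-values *)

Section BH.
Context {R : realType}.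
Implicit Types (p : nat -> R) (alpha t : R) (m i k : nat).

(** Null tails as small as m^-a must be known up to a factor close to 1, so a normal approximation
    with additive error is useless: the replacement errors must be small relative to [Q Y]. They are
    measured against an exponential tilt of slope [Y], which dominates the derivatives of the
    smoothed tail up to powers of a scale q of order 1 + Y, is almost reproduced by each
    replacement, and starts at order (1 + Y) [Q Y]. Third order remainders cost rho q^3, which with
    that last factor gives rho (1 + Y)^4. For Y of order sqrt(l) and rho of order n^(-1/2) this
    tends to 0 because n >= c l^5. Sample variances are treated asymmetrically. One that is too
    small inflates a null statistic, so this must be negligible against m^-a; it is exponentially
    unlikely because -U^2 is bounded above. One that is too large only harms detection, where a
    bound O(1/l) from Chebyshev's inequality is enough. In the lower regime, the gap between 1/alpha
    and 1 pays for the factor lam, the grid ratio and the alternatives. Estimates are stated for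
    real l near infinity, uniformly over all models. *)

Definition num_le m p t := count (fun j => p j <= t) (iota 0 m).

Lemma num_le_size m p t : (num_le m p t <= m)%N.
Proof. by rewrite /num_le (leq_trans (count_size _ _))// size_iota. Qed.

Lemma num_leE m p t : num_le m p t = (\sum_(j < m) (p j <= t)%R)%N.
Proof.
rewrite /num_le -sum1_count big_mkcond -[X in iota 0 X]subn0 -/(index_iota 0 m).
by rewrite big_mkord; apply: eq_bigr => j _; case: (p j <= t).
Qed.

(** The order statistics and the counting function are Galois adjoint; through this equivalence
    everything later is phrased with counts instead of the sorted sample. *)
Lemma pord_le m p t k : (0 < k <= m)%N -> (pord m p k <= t) = (k <= num_le m p t)%N.
Proof.
case: k => // k /= km; rewrite /pord /=.
have ss : sorted <=%O (sort <=%R [seq p i | i <- iota 0 m]).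
  by apply: sort_sorted => x y; exact: le_total.
have sz : size (sort <=%R [seq p i | i <- iota 0 m]) = m.
  by rewrite size_sort size_map size_iota.
have cE : count (<= t) (sort <=%R [seq p i | i <- iota 0 m]) = num_le m p t.
  by rewrite count_sort count_map /num_le; apply: eq_count => j /=.
have [h|h] := ltnP k (num_le m p t).
  by rewrite nth_count_le// cE.
by apply/negbTE; rewrite -ltNge nth_count_gt// cE h sz.
Qed.

Lemma khat_le alpha m p : (khat alpha m p <= m)%N.
Proof. by apply/bigmax_leqP => i _; rewrite -ltnS. Qed.

Lemma leq_khat alpha m p k : (k <= m)%N ->
  pord m p k <= alpha * k%:R / m%:R -> (k <= khat alpha m p)%N.
Proof.
by rewrite -ltnS => km pk; exact: (leq_bigmax_cond (F := @nat_of_ord m.+1) (Ordinal km)).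
Qed.

Lemma pord_khat alpha m p :
  pord m p (khat alpha m p) <= alpha * (khat alpha m p)%:R / m%:R.
Proof.
rewrite /khat.
have [|i Pi ->] := @eq_bigmax_cond _ (fun k : 'I_m.+1 => pord m p k <= alpha * k%:R / m%:R) (@nat_of_ord m.+1); last by [].
(* The maximum is attained because k = 0 is always admissible: there [pord] is 0 by convention and
   so is the threshold. *)
apply/card_gt0P; exists ord0; rewrite unfold_in /=.
by rewrite /pord/= mulr0 mul0r.
Qed.

(** Any self-consistent [k] may serve as witness, not only [khat]. This removes the maximum from the
    definition, so each regime can exhibit or exclude thresholds directly. *)
Lemma BH_rejectsP alpha m p i : 0 <= alpha -> (i < m)%N ->
  reflect (exists k, [/\ (0 < k <= m)%N, (k <= num_le m p (alpha * k%:R / m%:R))%N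
    & p i <= alpha * k%:R / m%:R])
  (BH_rejects alpha m p i).
Proof.
move=> a0 im; apply: (iffP andP) => [[k0 pk]|[k [/andP[k0 km] kn pik]]].
  have km := khat_le alpha m p.
  exists (khat alpha m p); split; rewrite ?k0 ?km//.
    by rewrite -pord_le ?pord_khat// k0 km.
  exact: le_trans (pord_khat _ _ _).
set t := alpha * k%:R / m%:R in kn pik.
set k' := num_le m p t.
have k'm : (k' <= m)%N := num_le_size _ _ _.
have k'0 : (0 < k')%N := leq_trans k0 kn.
have k'k : (k' <= khat alpha m p)%N.
  apply: leq_khat => //; apply: (@le_trans _ _ t).
    by rewrite pord_le ?k'0.
  by rewrite /t ler_wpM2r ?invr_ge0// ler_wpM2l// ler_nat.
have kh0 : (0 < khat alpha m p)%N := leq_trans k'0 k'k.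
(* If p_i exceeded the last accepted order statistic, fewer p-values would lie below that statistic
   than below [t], since i is counted only by [t]. But at least [khat] >= [k'] of them lie below
   it. *)
split=> //; rewrite leNgt; apply/negP => lt.
have : (khat alpha m p <= num_le m p (pord m p (khat alpha m p)))%N.
  by rewrite -pord_le // kh0 khat_le.
set u := pord _ _ _ in lt * => /(leq_trans k'k); apply/negP; rewrite -ltnNge.
rewrite /k' !num_leE (bigD1 (Ordinal im)) //= [X in (_ < X)%N](bigD1 (Ordinal im)) //=.
rewrite pik leNgt lt /= add0n add1n ltnS; apply: leq_sum => j _.
have [ju|//] := boolP (p j <= u).
by rewrite (le_trans ju (le_trans (ltW lt) pik)).
Qed.

Lemma measurable_BH_rejects d (T : measurableType d) alpha m (p : nat -> T -> R) i :
  0 <= alpha -> (i < m)%N -> (forall j, (j < m)%N -> measurable_fun setT (p j)) ->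
  measurable [set w | BH_rejects alpha m (p ^~ w) i].
Proof.
move=> a0 im mp.
have mle j t : (j < m)%N -> measurable [set w | p j w <= t].
  move=> jm; rewrite -[X in measurable X]setTI.
  exact: (measurable_fun_le measurableT (mp j jm) (@measurable_cst _ _ _ _ setT t)).
rewrite [X in measurable X](_ : _ = \bigcup_(k in [set k | (0 < k <= m)%N])
   ([set w | (k <= num_le m (p ^~ w) (alpha * k%:R / m%:R))%N] `&`
    [set w | p i w <= alpha * k%:R / m%:R])); last first.
  apply/seteqP; split => w /=.
    by move/(BH_rejectsP _ a0 im) => [k [km kn pk]]; exists k.
  by move=> [k km [kn pk]]; apply/(BH_rejectsP _ a0 im); exists k.
apply: bigcup_measurable => k _; apply: measurableI; last exact: mle.
set t := _ / _.
have mn : measurable_fun setT (fun w => (num_le m (p ^~ w) t)%:R : R).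
  under eq_fun do rewrite num_leE natr_sum.
  apply: measurable_sum => j; rewrite [X in measurable_fun _ X](_ : _ = \1_[set w | p j w <= t]).
    by apply: measurable_indic; exact: mle.
  by apply/funext => w; rewrite indicE mem_setE.
rewrite [X in measurable X](_ : _ = setT `&` [set w | k%:R <= ((num_le m (p ^~ w) t)%:R : R)]).
  exact: (measurable_fun_le measurableT (@measurable_cst _ _ _ _ setT (k%:R : R)) mn).
by rewrite setTI; apply/seteqP; split => w /=; rewrite ler_nat.
Qed.

End BH.

(** * Independence: pi-systems, partial sums, conditioning on the past *)

Section independence.
Context d (T : measurableType d) {R : realType} (P : probability T R).
Implicit Types (F G : set (set T)) (X Y : T -> R).

Lemma indep2C F G : indep2 P F G -> indep2 P G F.
Proof. by move=> FG A B GA FB; rewrite setIC muleC; exact: FG. Qed.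

(** For fixed [B] the sets [A] satisfying the product formula with [B] form a Dynkin class. It
    contains the pi-system [F], hence the sigma-algebra generated by it. *)
Lemma indep2_g_sigma_l F G : F `<=` measurable -> G `<=` measurable ->
  setI_closed F -> indep2 P F G -> indep2 P <<s F>> G.
Proof.
move=> mF mG FI FG A B sA GB.
have mB := mG _ GB.
pose D := [set A | measurable A /\ (P (A `&` B) = P A * P B)%E].
suff : D A by case.
have dD : dynkin D.
  split.
  - by split; [exact: measurableT|rewrite setTI probability_setT mul1e].
  - move=> E [mE eE]; split; first exact: measurableC.
    rewrite setIC -setDE measureD//; last by rewrite -ge0_fin_numE ?fin_num_measure.
    have eE' : P (B `&` E) = (P E * P B)%E by rewrite setIC.
    rewrite [X in (_ - X)%E]eE' probability_setC//.
    have gen (x y : \bar R) : x \is a fin_num -> y \is a fin_num ->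
        (y - x * y = (1%E - x) * y)%E.
      by case: x y => [x| |] [y| |]// _ _; rewrite -!(EFinM, EFinB) mulrBl mul1r.
    by apply: gen; exact: fin_num_measure.
  - move=> E tE DE.
    have mE k : measurable (E k) by have [] := DE k.
    split; first exact: bigcup_measurable.
    rewrite setI_bigcupl.
    rewrite measure_bigcup//; last 2 first.
      by move=> k _; exact: measurableI.
      exact: trivIset_setIr.
    rewrite measure_bigcup//.
    rewrite muleC -(fineK (fin_num_measure P _ mB)) -nneseriesZl//.
    apply: eq_eseriesr => k _; have [_ eB] := DE k.
    by rewrite muleC fineK ?fin_num_measure//; exact: eB.
have FD : F `<=` D.
  by move=> E FE; split; [exact: mF|exact: FG].
rewrite -(setI_closed_g_dynkin_g_sigma_algebra FI) in sA.
by apply: sA.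
Qed.

Lemma indep2_g_sigma F G : F `<=` measurable -> G `<=` measurable ->
  setI_closed F -> setI_closed G -> indep2 P F G -> indep2 P <<s F>> <<s G>>.
Proof.
move=> mF mG FI GI FG.
apply: indep2C; apply: indep2_g_sigma_l => //.
  by apply: smallest_sub => //; exact: sigma_algebra_measurable.
by apply: indep2C; exact: indep2_g_sigma_l.
Qed.

Definition indep_rv X Y := forall A B, measurable A -> measurable B ->
  (P (X @^-1` A `&` Y @^-1` B) = P (X @^-1` A) * P (Y @^-1` B))%E.

Section rects.
Context (I : choiceType).
Implicit Types (s : seq I) (Z : I -> T -> R).

(** A pi-system that generates the joint sigma-algebra of the coordinates listed in [s]; on its
    members independence reduces to the product formula of [indep_family]. *)
Definition rects s Z : set (set T) :=
  [set E | exists2 C : I -> set R, (forall a, measurable (C a)) &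
     E = \big[setI/setT]_(a <- s) (Z a @^-1` C a)].

Lemma rects_measurable s Z :
  (forall a, a \in s -> measurable_fun setT (Z a)) -> rects s Z `<=` measurable.
Proof.
move=> mZ _ [C mC ->]; rewrite big_seq; apply: bigsetI_measurable => a /mZ h.
by rewrite -[X in measurable X]setTI; exact: h.
Qed.

Lemma rects_setI s Z : setI_closed (rects s Z).
Proof.
move=> _ _ [C mC ->] [C' mC' ->]; exists (fun a => C a `&` C' a).
  by move=> a; exact: measurableI.
by rewrite -big_split.
Qed.

(** Here [T] carries the sigma-algebra generated by the rectangles. Measurable expressions in the
    coordinates are then measurable for it by the usual closure rules, which is how [indep_rects] is
    applied to sums and to t statistics. *)
Lemma measurable_rects s Z a : uniq s -> a \in s ->
  measurable_fun setT (Z a : g_sigma_algebraType (rects s Z) -> R).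
Proof.
move=> us sa _ B mB; rewrite setTI; apply: sub_sigma_algebra.
exists (fun b => if b == a then B else setT).
  by move=> b; case: eqP.
rewrite (bigD1_seq a)//= eqxx big1 ?setIT// => b /negbTE ->.
by rewrite preimage_setT.
Qed.

Lemma indep_rects s s' Z Z' X Y :
  (forall a, a \in s -> measurable_fun setT (Z a)) ->
  (forall a, a \in s' -> measurable_fun setT (Z' a)) ->
  indep2 P (rects s Z) (rects s' Z') ->
  measurable_fun setT (X : g_sigma_algebraType (rects s Z) -> R) ->
  measurable_fun setT (Y : g_sigma_algebraType (rects s' Z') -> R) ->
  indep_rv X Y.
Proof.
move=> mZ mZ' ind mX mY A B mA mB.
apply: (indep2_g_sigma (F := rects s Z) (G := rects s' Z') _ _ _ _ ind).
- exact: rects_measurable.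
- exact: rects_measurable.
- exact: rects_setI.
- exact: rects_setI.
- by have := mX measurableT A mA; rewrite setTI.
- by have := mY measurableT B mB; rewrite setTI.
Qed.

(** The product formulas for [a :: s] and for [s] together make rectangles over [s] independent of
    the events of [V a], and the partial sum is measurable with respect to these rectangles. *)
Lemma indep_family_sum (D : pred I) (F : I -> set (set T)) (V : I -> T -> R) a s :
  indep_family P D F -> (forall b, D b -> measurable_fun setT (V b)) ->
  (forall b C, D b -> measurable C -> F b (V b @^-1` C)) ->
  D a -> all D s -> uniq (a :: s) ->
  indep_rv (fun w => \sum_(b <- s) V b w) (V a).
Proof.
move=> ind mV FV Da /allP Ds /= /andP[nas us].
apply: (@indep_rects s [:: a] V V).
- by move=> b /Ds; exact: mV.
- by move=> b; rewrite inE => /eqP ->; exact: mV.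
- move=> _ _ [C mC ->] [C' mC' ->]; rewrite big_seq1.
  pose E b := if b == a then V a @^-1` C' a else V b @^-1` C b.
  have Es : \big[setI/setT]_(b <- s) (V b @^-1` C b) = \big[setI/setT]_(b <- s) E b.
    apply: eq_big_seq => b bs; rewrite /E ifN//.
    by apply: contraNneq nas => <-.
  have Ea : E a = V a @^-1` C' a by rewrite /E eqxx.
  have h := ind (a :: s) E.
  have h' := ind s E.
  rewrite Es h'//; last first.
    move=> b bs; split; first exact: Ds.
    by rewrite /E ifN; [apply: FV => //; exact: Ds|apply: contraNneq nas => <-].
  move: h; rewrite !big_cons Ea => h; rewrite setIC muleC; apply: h.
    by rewrite /= nas.
  move=> b; rewrite inE => /orP[/eqP ->|bs]; first by split => //; rewrite Ea; exact: FV.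
  split; first exact: Ds.
  by rewrite /E ifN; [apply: FV => //; exact: Ds|apply: contraNneq nas => <-].
- have -> : (fun w => \sum_(b <- s) V b w) = (fun w => \sum_(b <- s) (if b \in s then V b w else 0)).
    by apply/funext => w; rewrite big_seq [RHS]big_seq; apply: eq_bigr => b bs; rewrite bs.
  apply: measurable_sum => b; have [bs|bs] := boolP (b \in s); last exact: measurable_cst.
  exact: measurable_rects.
- by apply: measurable_rects => //; rewrite inE.
Qed.

End rects.

(** Tonelli on the product of the two laws, with [h u] bounding the expectation conditional on [X]
    being [u]; nonnegativity takes the place of integrability. *)
Lemma integral_indep_add X Y (f h : R -> R) :
  measurable_fun setT X -> measurable_fun setT Y -> indep_rv X Y ->
  measurable_fun setT f -> measurable_fun setT h ->
  (forall u, 0 <= f u) -> (forall u, 0 <= h u) ->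
  (forall u, (\int[P]_w (f (u + Y w))%:E <= (h u)%:E)%E) ->
  (\int[P]_w (f (X w + Y w))%:E <= \int[P]_w (h (X w))%:E)%E.
Proof.
move=> mX mY XY mf mh f0 h0 fh.
have mXY : measurable_fun setT (fun w => (X w, Y w)) by exact: measurable_fun_pair.
pose pX : {RV P >-> R} := HB.pack X (isMeasurableFun.Build _ _ _ _ _ mX).
pose pY : {RV P >-> R} := HB.pack Y (isMeasurableFun.Build _ _ _ _ _ mY).
pose pXY : {RV P >-> (R * R)%type} := HB.pack (fun w => (X w, Y w)) (isMeasurableFun.Build _ _ _ _ _ mXY).
pose g := fun z : R * R => (f (z.1 + z.2))%:E.
have mg : measurable_fun setT g.
  apply/measurable_EFinP; apply: measurableT_comp => //.
  by apply: measurable_funD; [exact: measurable_fst|exact: measurable_snd].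
have -> : (\int[P]_w (f (X w + Y w))%:E = \int[distribution P pXY]_z g z)%E.
  by rewrite ge0_integral_distribution//= => z; rewrite lee_fin.
rewrite (eq_measure_integral (distribution P pX \x distribution P pY)%E); last first.
  move=> A mA _; apply/esym; apply: product_measure_unique mA => B C mB mC.
  exact: (XY _ _ mB mC).
rewrite fubini_tonelli1//; last by move=> z; rewrite lee_fin.
rewrite -[leRHS](@ge0_integral_distribution _ _ _ _ _ _ pX (EFin \o h))//; last first.
  exact/measurable_EFinP.
apply: ge0_le_integral => //.
- move=> u _; apply: integral_ge0 => v _; by rewrite lee_fin.
- by apply: measurable_fun_fubini_tonelli_F => // z; rewrite lee_fin.
- exact/measurable_EFinP.
move=> u _; rewrite /fubini_F /g /=.
rewrite (@ge0_integral_distribution _ _ _ _ _ _ pY (fun y => (f (u + y))%:E))//.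
- exact: fh.
- apply/measurable_EFinP; apply: measurableT_comp => //.
  by apply: measurable_funD => //; exact: measurable_cst.
- by move=> v; rewrite lee_fin.
Qed.

(* Iterated conditioning: [phi s] is a supermartingale-type potential for the partial sums. *)
Lemma sum_chain (I : choiceType) (D : pred I) (F : I -> set (set T)) (V : I -> T -> R)
    (phi : seq I -> R -> R) s :
  indep_family P D F -> (forall b, D b -> measurable_fun setT (V b)) ->
  (forall b C, D b -> measurable C -> F b (V b @^-1` C)) ->
  all D s -> uniq s ->
  (forall s', suffix s' s -> measurable_fun setT (phi s')) ->
  (forall s' u, suffix s' s -> 0 <= phi s' u) ->
  (forall a s' u, suffix (a :: s') s ->
    (\int[P]_w (phi (a :: s') (u + V a w))%:E <= (phi s' u)%:E)%E) ->
  (\int[P]_w (phi s (\sum_(a <- s) V a w))%:E <= (phi [::] 0)%:E)%E.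
Proof.
move=> ind mV FV; elim: s => [_ _ _ _ _|a s ih].
  under eq_integral do rewrite big_nil.
  by rewrite integral_cst//= probability_setT mule1.
move=> /= /andP[Da Ds] /andP[nas us] mphi phi0 step.
have sfx s' : suffix s' s -> suffix s' (a :: s).
  by move=> h; rewrite -cat1s (suffix_trans h)// suffix_suffix.
apply: le_trans (ih Ds us _ _ _); last 3 first.
- by move=> s' /sfx; exact: mphi.
- by move=> s' u /sfx; exact: phi0.
- by move=> b s' u /sfx; exact: step.
under eq_integral do rewrite big_cons addrC.
apply: integral_indep_add.
- have -> : (fun w => \sum_(b <- s) V b w) = (fun w => \sum_(b <- s) (if D b then V b w else 0)).
    by apply/funext => w; rewrite big_seq [RHS]big_seq; apply: eq_bigr => b bs; rewrite (allP Ds).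
  apply: measurable_sum => b; have [bs|bs] := boolP (D b); last exact: measurable_cst.
  exact: mV.
- exact: mV.
- by apply: (indep_family_sum ind) => //=; rewrite nas.
- by apply: mphi; exact: suffix_refl.
- by apply: mphi; apply: sfx; exact: suffix_refl.
- by move=> u; apply: phi0; exact: suffix_refl.
- by move=> u; apply: phi0; apply: sfx; exact: suffix_refl.
- by move=> u; apply: step; exact: suffix_refl.
Qed.

End independence.

(** * Standardized variables and their moments *)

Section moments.
Context d (T : measurableType d) {R : realType} (P : probability T R).
Implicit Types (X U : T -> R) (f : R -> R).

(** Standardization with the exponential moment of (C2). The estimates depend on the law only
    through [t0] and [K1], which makes them uniform over the tests and over m. *)
Definition std_rv (t0 K1 : R) U :=
  [/\ measurable_fun setT U,
      P.-integrable setT (EFin \o U) /\ (\int[P]_w (U w)%:E = 0)%E,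
      (\int[P]_w (U w ^+ 2)%:E = 1)%E &
      (\int[P]_w (expR (t0 * `|U w|))%:E <= K1%:E)%E].

Lemma probability_integral_cst (a : R) : (\int[P]_w a%:E = a%:E)%E.
Proof. by rewrite integral_cst//= probability_setT mule1. Qed.

Lemma measurable_exp_abs t0 : measurable_fun setT (fun x : R => expR (t0 * `|x|)).
Proof.
apply: measurableT_comp => //; apply: measurable_funM => //.
Qed.

(** The way moments enter all later estimates: a pointwise majorant made of a quadratic polynomial
    and the exponential is integrated term by term, and the linear term drops out because the mean
    is 0. Cubic and quartic terms are first absorbed into the exponential. *)
Lemma integral_std_le t0 K1 U f (a b c e : R) : std_rv t0 K1 U ->
  0 <= e -> measurable_fun setT f -> (forall x, 0 <= f x) ->
  (forall x, f x <= a + b * x + c * x ^+ 2 + e * expR (t0 * `|x|)) ->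
  (\int[P]_w (f (U w))%:E <= (a + c + e * K1)%:E)%E.
Proof.
move=> [mU [iU U0] U2 UE] e0 mf f0 fle.
have mU2 : measurable_fun setT (fun w => U w ^+ 2) by exact: measurable_funX.
have mUE : measurable_fun setT (fun w => expR (t0 * `|U w|)).
  by apply: (measurableT_comp (measurable_exp_abs t0)).
have iE : P.-integrable setT (fun w => (expR (t0 * `|U w|))%:E).
  apply/integrableP; split; first exact/measurable_EFinP.
  under eq_integral do rewrite gee0_abs ?lee_fin ?expR_ge0//.
  exact: le_lt_trans UE (ltry _).
have iU2 : P.-integrable setT (fun w => (U w ^+ 2)%:E).
  apply/integrableP; split; first exact/measurable_EFinP.
  under eq_integral do rewrite gee0_abs ?lee_fin ?sqr_ge0//.
  by rewrite U2 ltry.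
have ia : P.-integrable setT (fun w => a%:E).
  by have := finite_measure_integrable_cst P a measurableT.
have ib : P.-integrable setT (fun w => (b%:E * (U w)%:E)%E) by exact: integrableZl.
have ic : P.-integrable setT (fun w => (c%:E * (U w ^+ 2)%:E)%E) by exact: integrableZl.
have ie : P.-integrable setT (fun w => (e%:E * (expR (t0 * `|U w|))%:E)%E) by exact: integrableZl.
have iab := integrableD measurableT ia ib.
have iabc := integrableD measurableT iab ic.
have iabce := integrableD measurableT iabc ie.
apply: (@le_trans _ _ (\int[P]_w (a%:E + b%:E * (U w)%:E + c%:E * (U w ^+ 2)%:E
   + e%:E * (expR (t0 * `|U w|))%:E))%E).
  apply: ge0_le_integral => //.
  - by move=> w _; rewrite lee_fin.
  - by apply/measurable_EFinP; exact: measurableT_comp.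
  - by case/integrableP: iabce.
  - by move=> w _; rewrite -!EFinM -!EFinD lee_fin.
rewrite integralD// integralD// integralD//.
rewrite !integralZl// U0 U2 mule0 adde0 mule1.
rewrite probability_integral_cst !EFinD EFinM.
by rewrite leeD2l// lee_wpmul2l// lee_fin.
Qed.

Lemma eq_law_integral X X' (f : R -> R) :
  measurable_fun setT X -> measurable_fun setT X' ->
  (forall C, measurable C -> P (X @^-1` C) = P (X' @^-1` C)) ->
  measurable_fun setT f -> (forall x, 0 <= f x) ->
  (\int[P]_w (f (X w))%:E = \int[P]_w (f (X' w))%:E)%E.
Proof.
move=> mX mX' XX' mf f0.
pose pX : {RV P >-> R} := HB.pack X (isMeasurableFun.Build _ _ _ _ _ mX).
pose pX' : {RV P >-> R} := HB.pack X' (isMeasurableFun.Build _ _ _ _ _ mX').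
have mEf : measurable_fun setT (EFin \o f) by exact/measurable_EFinP.
rewrite -(@ge0_integral_distribution _ _ _ _ _ _ pX (EFin \o f))//.
rewrite -(@ge0_integral_distribution _ _ _ _ _ _ pX' (EFin \o f))//.
by apply: eq_measure_integral => A mA _; exact: XX'.
Qed.

(** Transfers to the observations the moment conditions, which are assumed for the generic
    vectors. *)
Lemma eq_law_std_rv t0 K1 U U' :
  measurable_fun setT U' ->
  (forall C, measurable C -> P (U' @^-1` C) = P (U @^-1` C)) ->
  std_rv t0 K1 U -> std_rv t0 K1 U'.
Proof.
move=> mU' UU' [mU [iU U0] U2 UE].
have iU' : P.-integrable setT (EFin \o U').
  apply/integrableP; split; first exact/measurable_EFinP.
  have := @eq_law_integral U' U (fun x => `|x|) mU' mU UU' _ (fun _ => normr_ge0 _).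
  move=> -> //; first by case/integrableP : iU.
split => //.
- split=> //; rewrite -{}U0.
  pose pX : {RV P >-> R} := HB.pack U (isMeasurableFun.Build _ _ _ _ _ mU).
  pose pX' : {RV P >-> R} := HB.pack U' (isMeasurableFun.Build _ _ _ _ _ mU').
  have mEf : measurable_fun setT (EFin : R -> \bar R) by [].
  rewrite -(@integral_distribution _ _ _ _ _ _ pX EFin)//.
  rewrite -(@integral_distribution _ _ _ _ _ _ pX' EFin)//.
  by apply: eq_measure_integral => A mA _; exact: UU'.
- rewrite -U2; apply: (eq_law_integral (f := fun x => x ^+ 2)) => // x; exact: sqr_ge0.
- rewrite (eq_law_integral (f := fun x => expR (t0 * `|x|)) mU' mU UU') //.
  exact: measurable_exp_abs.
Qed.

Lemma std_rvN t0 K1 U : std_rv t0 K1 U -> std_rv t0 K1 (fun w => - U w).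
Proof.
move=> [mU [iU U0] U2 UE]; split.
- exact: measurable_funN.
- have iN : P.-integrable setT (fun w => (- 1)%:E * (U w)%:E)%E by exact: integrableZl.
  have eN : (fun w => (- U w)%:E) = (fun w => (- 1)%:E * (U w)%:E)%E.
    by apply/funext => w; rewrite -EFinM mulN1r.
  rewrite /comp eN; split=> //.
  by rewrite integralZl// U0 mule0.
- by rewrite -U2; under eq_integral do rewrite sqrrN.
- by under eq_integral do rewrite normrN.
Qed.

Lemma has_mean_std_rv t0 K1 X (mu sig : R) : measurable_fun setT X -> 0 < sig ->
  has_mean P X mu -> has_variance P X mu (sig ^+ 2) ->
  (\int[P]_w (expR (t0 * `|X w - mu| / sig))%:E <= K1%:E)%E ->
  std_rv t0 K1 (fun w => (X w - mu) / sig).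
Proof.
move=> mX s0 [iX EX] VX XE.
have mU : measurable_fun setT (fun w => (X w - mu) / sig).
  by apply: measurable_funM => //; apply: measurable_funB.
split => //.
- have imu := finite_measure_integrable_cst P mu measurableT.
  have iB := integrableB measurableT iX imu.
  have iZ := integrableZl measurableT sig^-1 iB.
  have eZ : (fun w => ((X w - mu) / sig)%:E) =
     (fun w => (sig^-1)%:E * ((EFin \o X) \- (EFin \o cst mu)) w)%E.
    by apply/funext => w /=; rewrite -EFinB -EFinM mulrC.
  rewrite /comp eZ; split => //.
  rewrite integralZl// integralB// EX.
  by rewrite probability_integral_cst subee ?mule0.
- transitivity (((sig ^- 2)%:E * \int[P]_w ((X w - mu) ^+ 2)%:E)%E).
    rewrite -ge0_integralZl//=.
    + by apply: eq_integral => w _; rewrite -EFinM exprMn mulrC exprVn.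
    + by apply/measurable_EFinP; apply: measurable_funX; exact: measurable_funB.
    + by move=> w _; rewrite lee_fin sqr_ge0.
    + by rewrite lee_fin invr_ge0 sqr_ge0.
  by rewrite VX -EFinM mulVf// expf_neq0// gt_eqF.
- rewrite (le_trans _ XE)// le_eqVlt; apply/orP; left; apply/eqP.
  apply: eq_integral => w _; congr (expR _)%:E.
  by rewrite normrM (@gtr0_norm _ sig^-1) ?invr_gt0// mulrA.
Qed.

Lemma markov_le X (f : R -> R) (a b : R) (A : set T) :
  measurable A -> measurable_fun setT X -> measurable_fun setT f ->
  (forall x, 0 <= f x) -> 0 < a ->
  (forall w, A w -> a <= f (X w)) ->
  (\int[P]_w (f (X w))%:E <= b%:E)%E -> (P A <= (b / a)%:E)%E.
Proof.
move=> mA mX mf f0 a0 Af fb.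
rewrite -(@lee_pmul2l _ a%:E)// ?lte_fin//.
rewrite -EFinM mulrC divfK ?gt_eqF//.
apply: le_trans fb.
have -> : (a%:E * P A = \int[P]_w (a * \1_A w)%:E)%E.
  under eq_integral do rewrite EFinM.
  rewrite ge0_integralZl//.
  - by rewrite integral_indic// setIT.
  - by apply/measurable_EFinP; exact: measurable_indic.
  - by rewrite lee_fin ltW.
apply: ge0_le_integral => //.
- by move=> w _; rewrite lee_fin mulr_ge0// ltW.
- apply/measurable_EFinP; apply: measurable_funM => //.
- by apply/measurable_EFinP; exact: measurableT_comp.
move=> w _; rewrite lee_fin indicE; case: (boolP (w \in A)) => wA.
  by rewrite mulr1; apply: Af; rewrite inE in wA.
by rewrite mulr0.
Qed.

End moments.

(** * Derivative rules, mean value bounds, Taylor expansion *)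

Section derivative_rules.
Context {R : realType}.
Implicit Types (f g : R -> R) (x a b c : R).

(** The rules are stated for functions written pointwise, so that a derivative is assembled as a
    term following the shape of the expression and then identified with the expected value by [ring]
    or [field]. *)
Lemma dv_add f g x a b : is_derive x 1 f a -> is_derive x 1 g b ->
  is_derive x 1 (fun y => f y + g y) (a + b).
Proof. by move=> ? ?; exact: is_deriveD. Qed.

Lemma dv_sub f g x a b : is_derive x 1 f a -> is_derive x 1 g b ->
  is_derive x 1 (fun y => f y - g y) (a - b).
Proof. by move=> ? ?; exact: is_deriveB. Qed.

Lemma dv_opp f x a : is_derive x 1 f a -> is_derive x 1 (fun y => - f y) (- a).
Proof. by move=> ?; exact: is_deriveN. Qed.

Lemma dv_mul f g x a b : is_derive x 1 f a -> is_derive x 1 g b ->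
  is_derive x 1 (fun y => f y * g y) (a * g x + f x * b).
Proof.
move=> ? ?; apply: (is_derive_eq (is_deriveM _ _)).
by rewrite addrC; congr (_ + _); exact: mulrC.
Qed.

Lemma dv_cst x c : is_derive x 1 (fun=> c) 0.
Proof. exact: is_derive_cst. Qed.

Lemma dv_id x : is_derive x 1 (fun y : R => y) 1.
Proof. exact: is_derive_id. Qed.

Lemma dv_comp f g x a b : is_derive x 1 g a -> is_derive (g x) 1 f b ->
  is_derive x 1 (fun y => f (g y)) (b * a).
Proof. by move=> ? ?; exact: is_derive1_comp. Qed.

Lemma dv_exp f x a : is_derive x 1 f a ->
  is_derive x 1 (fun y => expR (f y)) (expR (f x) * a).
Proof. by move=> ?; exact: dv_comp. Qed.

Lemma dv_ln f x a : 0 < f x -> is_derive x 1 f a ->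
  is_derive x 1 (fun y => ln (f y)) ((f x)^-1 * a).
Proof. by move=> ? ?; apply: dv_comp => //; exact: is_derive1_ln. Qed.

Lemma dv_sqr f x a : is_derive x 1 f a ->
  is_derive x 1 (fun y => f y ^+ 2) (2 * f x * a).
Proof.
move=> df; rewrite (_ : (fun y => f y ^+ 2) = (fun y => f y * f y)) //.
by apply: (is_derive_eq (dv_mul df df)); ring.
Qed.

Lemma dv_continuous f x a : is_derive x 1 f a -> {for x, continuous f}.
Proof. by move=> df; apply: differentiable_continuous; exact/derivable1_diffP. Qed.

Lemma dv_within_continuous f (f' : R -> R) (a b : R) :
  (forall x, a <= x <= b -> is_derive x 1 f (f' x)) ->
  {within `[a, b], continuous f}.
Proof.
move=> df; apply: derivable_within_continuous => x; rewrite in_itv/= => xab.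
by have [] := df x xab.
Qed.

Lemma MVT_le f (f' : R -> R) (a b M : R) : a <= b ->
  (forall x, a <= x <= b -> is_derive x 1 f (f' x)) ->
  (forall x, a <= x <= b -> f' x <= M) -> f b - f a <= M * (b - a).
Proof.
move=> ab df fM.
have [||c] := @MVT_segment R f f' a b ab.
- by move=> c; rewrite in_itv/= => /andP[ac cb]; apply: df; rewrite !ltW.
- exact: dv_within_continuous df.
by rewrite in_itv/= => cab ->; rewrite ler_wpM2r ?subr_ge0// fM.
Qed.

Lemma MVT_abs_le f (f' : R -> R) (a b M : R) : a <= b ->
  (forall x, a <= x <= b -> is_derive x 1 f (f' x)) ->
  (forall x, a <= x <= b -> `|f' x| <= M) -> `|f b - f a| <= M * (b - a).
Proof.
move=> ab df fM; rewrite ler_norml; apply/andP; split; last first.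
  by apply: (MVT_le ab df) => x /fM; exact: le_trans (ler_norm _).
rewrite lerNl opprB.
have := @MVT_le (fun x => - f x) (fun x => - f' x) a b M ab.
rewrite opprK addrC; apply => x xab; first by apply: dv_opp; exact: df.
by rewrite (le_trans (ler_norm _))// normrN fM.
Qed.

Lemma MVT_abs_le_sym f (f' : R -> R) (u h M : R) :
  (forall x, is_derive x 1 f (f' x)) ->
  (forall x, `|x - u| <= `|h| -> `|f' x| <= M) -> `|f (u + h) - f u| <= M * `|h|.
Proof.
move=> df fM; have [h0|h0] := leP 0 h.
  rewrite (ger0_norm h0) in fM *.
  have := @MVT_abs_le f f' u (u + h) M; rewrite lerDl (addrC u) addrK; apply => //.
  move=> x /andP[ux xu]; apply: fM; rewrite ger0_norm ?subr_ge0//.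
  by rewrite lerBlDr.
rewrite distrC; rewrite (ltr0_norm h0) in fM *.
have := @MVT_abs_le f f' (u + h) u M.
rewrite gerDl (ltW h0) opprD addNKr; apply => //.
move=> x /andP[ux xu]; apply: fM; rewrite ler0_norm ?subr_le0//.
by lra.
Qed.

(* The cubic remainder is bounded with constant 1 (rather than 1/6) by three applications of the mean value theorem. *)
Lemma taylor3 f (f1 f2 f3 : R -> R) (u h M : R) :
  (forall x, is_derive x 1 f (f1 x)) -> (forall x, is_derive x 1 f1 (f2 x)) ->
  (forall x, is_derive x 1 f2 (f3 x)) ->
  (forall x, `|x - u| <= `|h| -> `|f3 x| <= M) ->
  `|f (u + h) - (f u + h * f1 u + h ^+ 2 / 2 * f2 u)| <= M * `|h| ^+ 3.
Proof.
move=> d0 d1 d2 f3M.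
have h2 k : `|k| <= `|h| -> `|f2 (u + k) - f2 u| <= M * `|h|.
  move=> kh; apply: le_trans (_ : M * `|k| <= _).
    by apply: (MVT_abs_le_sym d2) => x xk; apply: f3M; exact: le_trans kh.
  apply: ler_wpM2l => //; apply: le_trans (f3M u _) => //.
  by rewrite subrr normr0.
have h1 k : `|k| <= `|h| -> `|f1 (u + k) - f1 u - k * f2 u| <= M * `|h| * `|h|.
  move=> kh; apply: le_trans (_ : M * `|h| * `|k| <= _).
    have := @MVT_abs_le_sym (fun x => f1 x - (x - u) * f2 u) (fun x => f2 x - f2 u) u k (M * `|h|).
    rewrite subrr mul0r subr0 (addrC u k) addrK.
    rewrite (_ : f1 (k + u) - k * f2 u - f1 u = f1 (k + u) - f1 u - k * f2 u); last by ring.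
    apply => x.
      have := dv_sub (d1 x) (dv_mul (dv_sub (dv_id x) (dv_cst x u)) (dv_cst x (f2 u))).
      by move/is_derive_eq; apply; ring.
    by move=> xk; have := h2 (x - u); rewrite (_ : u + (x - u) = x); last (by ring); apply; exact: le_trans kh.
  apply: ler_wpM2l => //; rewrite mulr_ge0//; apply: le_trans (f3M u _) => //.
  by rewrite subrr normr0.
have := @MVT_abs_le_sym (fun x => f x - (x - u) * f1 u - (x - u) ^+ 2 / 2 * f2 u)
   (fun x => f1 x - f1 u - (x - u) * f2 u) u h (M * `|h| * `|h|).
rewrite subrr expr0n /= !mul0r !subr0 (addrC u h) addrK.
rewrite (_ : _ - _ - _ - _ = f (h + u) - (f u + h * f1 u + h ^+ 2 / 2 * f2 u)); last by ring.
rewrite (_ : M * `|h| ^+ 3 = M * `|h| * `|h| * `|h|); last by ring.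
apply => x.
  have hid := dv_sub (dv_id x) (dv_cst x u).
  have := dv_sub (dv_sub (d0 x) (dv_mul hid (dv_cst x (f1 u))))
     (dv_mul (dv_mul (dv_sqr hid) (dv_cst x 2^-1)) (dv_cst x (f2 u))).
  by move/is_derive_eq; apply; field.
by move=> xk; have := h1 (x - u); rewrite (_ : u + (x - u) = x); last (by ring); exact.
Qed.

End derivative_rules.

(** * Tail integrals of even densities *)

Section density_tail.
Context {R : realType}.
Implicit Types (f g : R -> R) (t x : R).
Let mu := @lebesgue_measure R.

Definition dmass f : R := fine (\int[mu]_x (f x)%:E)%E.
Definition lowmass f t : R := fine (\int[mu]_(x in [set x : R | (x <= t)%R]) (f x)%:E)%E.
(** A difference of masses rather than an integral over a right half-line, to match [student_cdf],
    which integrates over the left half-line; [tailmassE] recovers the integral. *)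
Definition tailmass f t : R := dmass f - lowmass f t.

Definition even_density f :=
  [/\ continuous f, (forall x, 0 < f x), (forall x, f (- x) = f x) &
      (\int[mu]_(x in `[0%R, +oo[) (f x)%:E < +oo)%E].

Section even_density.
Variable f : R -> R.
Hypothesis ef : even_density f.

Let cf : continuous f. Proof. by case: ef. Qed.
Let f0 x : 0 < f x. Proof. by case: ef. Qed.
Let fN x : f (- x) = f x. Proof. by case: ef. Qed.

Lemma measurable_even_density : measurable_fun setT f.
Proof. exact: continuous_measurable_fun. Qed.

Let mEf D : measurable_fun D (EFin \o f).
Proof. apply/measurable_EFinP; apply: measurable_funTS; exact: measurable_even_density. Qed.

Lemma dmass_half : (\int[mu]_x (f x)%:E = 2%:E * \int[mu]_(x in `[0%R, +oo[) (f x)%:E)%E.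
Proof.
rewrite (ge0_symfun_integralT (fun x => ltW (f0 x)) cf); last by move=> x /=; rewrite fN.
by rewrite set_itvcy.
Qed.

Lemma integrable_even_density : mu.-integrable setT (EFin \o f).
Proof.
apply/integrableP; split; first exact: mEf.
under eq_integral do rewrite /= gtr0_norm//.
rewrite dmass_half; have : (0 <= \int[mu]_(x in `[0%R, +oo[) (f x)%:E)%E.
  by apply: integral_ge0 => x _; rewrite lee_fin ltW.
case: ef => _ _ _; case: (integral _ _ _) => // r _ _.
by rewrite -EFinM ltry.
Qed.

Lemma integrable_even_density_on D : measurable D -> mu.-integrable D (EFin \o f).
Proof.
by move=> mD; apply: integrableS integrable_even_density.
Qed.

Lemma is_derive_lowmass t : is_derive t 1 (lowmass f) (f t).
Proof.
have t1 : t < t + 1 by rewrite ltrDl.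
have i1 : mu.-integrable `]-oo, (t + 1)] (EFin \o f) by exact: integrable_even_density_on.
have := @continuous_FTC1 R f -oo%O t (t + 1) t1 i1; move=> /(_ _ (@cf t)) /=; rewrite ltNyr => /(_ isT).
move=> [dF FE]; have e : lowmass f = (fun x => \int[mu]_(t in [set` `]-oo, x]]) f t).
  by apply/funext => x; rewrite /lowmass /Rintegral set_itvNyc.
by rewrite e; split; [exact: dF|rewrite -FE derive1E].
Qed.

Lemma is_derive_tailmass t : is_derive t 1 (tailmass f) (- f t).
Proof.
have := dv_sub (dv_cst t (dmass f)) (is_derive_lowmass t).
by move/is_derive_eq; apply; rewrite sub0r.
Qed.

Lemma tailmassE t : (\int[mu]_(x in `[t, +oo[) (f x)%:E)%E = (tailmass f t)%:E.
Proof.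
have e : (\int[mu]_x (f x)%:E = \int[mu]_(x in `]-oo, t]) (f x)%:E + \int[mu]_(x in `]t, +oo[) (f x)%:E)%E.
  rewrite -ge0_integral_setU//=.
  - by rewrite -(setUv `]-oo, t]%classic) setCitvl.
  - exact: mEf.
  - by move=> x _; rewrite lee_fin ltW.
  - by apply/disj_setPS => x /=; rewrite !in_itv/= andbT => -[xt]; rewrite ltNge xt.
rewrite -integral_itv_obnd_cbnd; last exact: mEf.
have fi D : measurable D -> (\int[mu]_(x in D) (f x)%:E)%E \is a fin_num.
  by move=> mD; apply: integrable_fin_num => //; exact: integrable_even_density_on.
rewrite /tailmass /dmass /lowmass e -set_itvNyc fineD ?fi//.
by rewrite addrC addKr fineK// fi.
Qed.

Lemma tailmass_ge0 t : 0 <= tailmass f t.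
Proof.
by rewrite -lee_fin -tailmassE; apply: integral_ge0 => x _; rewrite lee_fin ltW.
Qed.

Lemma tailmass0 : tailmass f 0 = dmass f / 2.
Proof.
have := dmass_half; rewrite tailmassE -EFinM => /(congr1 fine)/= ; rewrite -/(dmass f) => ->.
by field.
Qed.

Lemma tailmass_decr t t' : t < t' -> tailmass f t' < tailmass f t.
Proof.
move=> tt'; have [||c] := @MVT R (tailmass f) (fun x => - f x) t t' tt'.
- by move=> x _; exact: is_derive_tailmass.
- by apply: dv_within_continuous => x _; exact: is_derive_tailmass.
move=> _ h; rewrite -subr_lt0 h mulNr oppr_lt0 mulr_gt0// subr_gt0//.
Qed.

Lemma tailmass_le t t' : t <= t' -> tailmass f t' <= tailmass f t.
Proof. by rewrite le_eqVlt => /predU1P[->//|/tailmass_decr/ltW]. Qed.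

Lemma tailmass_gt0 t : 0 < tailmass f t.
Proof. by rewrite (le_lt_trans (tailmass_ge0 (t + 1)))// tailmass_decr// ltrDl. Qed.

Lemma dmass_gt0 : 0 < dmass f.
Proof. by have := tailmass_gt0 0; rewrite tailmass0 pmulr_lgt0. Qed.

(** By evenness the derivative of [tailmass f (- x) + tailmass f x] vanishes, and at 0 this sum is
    the total mass. *)
Lemma tailmassN t : tailmass f (- t) = dmass f - tailmass f t.
Proof.
pose h x := tailmass f (- x) + tailmass f x.
have dh x : is_derive x 1 h 0.
  have := dv_add (dv_comp (dv_opp (dv_id x)) (is_derive_tailmass (- x))) (is_derive_tailmass x).
  by move/is_derive_eq; apply; rewrite fN; ring.
have : h t = h 0.
  apply/eqP; rewrite -subr_eq0 -normr_le0.
  have := @MVT_abs_le_sym R h (fun=> 0) 0 t 0 dh.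
  by rewrite mul0r add0r; apply => x _; rewrite normr0.
by rewrite /h oppr0 tailmass0 => e; lra.
Qed.

(** Domination by an integrand with an explicit antiderivative vanishing at infinity. The upper tail
    bounds for the Gaussian and the Student density both arise in this way, after inserting a factor
    x / t >= 1. *)
Lemma tailmass_le_antiderivative t (g G : R -> R) : (forall x, t <= x -> f x <= g x) ->
  continuous g -> (forall x, t <= x -> is_derive x 1 G (g x)) -> G x @[x --> +oo] --> 0 ->
  tailmass f t <= - G t.
Proof.
move=> fg cg dG G0; rewrite -lee_fin -tailmassE.
have g0 x : t <= x -> 0 <= g x by move=> tx; rewrite (le_trans (ltW (f0 x)))// fg.
have h : (\int[mu]_(x in `[t, +oo[) (g x)%:E = 0%:E - (G t)%:E)%E.
  apply: (@ge0_continuous_FTC2y R g G t 0) => //.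
  - exact: continuous_subspaceT.
  - by move=> x /ltW/dG [].
  - apply: cvg_at_right_filter; exact: (dv_continuous (dG _ (lexx t))).
  - move=> x; rewrite in_itv/= andbT => /ltW/dG [_ <-]; by rewrite derive1E.
rewrite -[- G t]sub0r EFinB -h; apply: ge0_le_integral => //.
- by move=> x _; rewrite lee_fin ltW.
- exact: mEf.
- apply/measurable_EFinP; apply: measurable_funTS; exact: continuous_measurable_fun.
- by move=> x /=; rewrite in_itv/= andbT lee_fin => /fg.
Qed.

Lemma tailmass_antiderivative t (G : R -> R) :
  (forall x, is_derive x 1 G (f x)) -> G x @[x --> +oo] --> 0 ->
  tailmass f t = - G t.
Proof.
move=> dG G0; apply: EFin_inj; rewrite -tailmassE.
rewrite (@ge0_continuous_FTC2y R f G t 0)//.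
- by rewrite -EFinB sub0r.
- by move=> x _; rewrite ltW.
- exact: continuous_subspaceT.
- apply: cvg_at_right_filter; exact: (dv_continuous (dG t)).
- by move=> x _; have [_ <-] := dG x; rewrite derive1E.
Qed.

End even_density.

Lemma tailmass_le_density f g t : even_density f -> even_density g ->
  (forall x, t <= x -> f x <= g x) -> tailmass f t <= tailmass g t.
Proof.
move=> ef eg fg; rewrite -lee_fin -!tailmassE//; apply: ge0_le_integral => //.
- by move=> x _; rewrite lee_fin ltW//; case: ef.
- apply/measurable_EFinP; apply: measurable_funTS; exact: measurable_even_density ef.
- apply/measurable_EFinP; apply: measurable_funTS; exact: measurable_even_density eg.
- by move=> x /=; rewrite in_itv/= andbT lee_fin => /fg.
Qed.

End density_tail.

(** * The Gaussian tail and its ratio to the density *)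

Section gaussian_tail.
Context {R : realType}.
Implicit Types (f g : R -> R) (t x s Y : R).

Lemma cvg_inv_bound (G : R -> R) (C : R) : (forall u, 1 <= u -> `|G u| <= C / u) ->
  G x @[x --> +oo] --> 0.
Proof.
move=> GC; apply/cvgrPdist_le => e e0.
have C0 : 0 <= C by have := GC 1 (lexx 1); rewrite divr1; apply: le_trans.
near=> u; rewrite sub0r normrN.
have u1 : 1 <= u by near: u; exact: nbhs_pinfty_ge.
apply: le_trans (GC _ u1) _; rewrite ler_pdivrMr ?(lt_le_trans ltr01 u1)//.
rewrite mulrC -ler_pdivrMr//; near: u; exact: nbhs_pinfty_ge.
Unshelve. all: by end_near. Qed.

(** The majorant is a Cauchy density up to scaling, integrable because a rescaled arctangent is its
    antiderivative. *)
Lemma even_density_le (b : R) f : 0 < b -> continuous f -> (forall x, 0 < f x) ->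
  (forall x, f (- x) = f x) -> (forall x, f x <= (1 + x ^+ 2 / b)^-1) -> even_density f.
Proof.
move=> b0 cf f0 fN fb; split => //.
have sb : 0 < Num.sqrt b by rewrite sqrtr_gt0.
have sb2 : Num.sqrt b ^+ 2 = b by rewrite sqr_sqrtr// ltW.
pose F x := Num.sqrt b * atan ((Num.sqrt b)^-1 * x).
pose g x := (1 + x ^+ 2 / b)^-1.
have den x : 0 < 1 + x ^+ 2 / b.
  by rewrite ltr_wpDr// divr_ge0 ?sqr_ge0// ltW.
have cg : continuous g.
  have -> : g = (fun x => expR (- ln (1 + x ^+ 2 / b))).
    by apply/funext => x; rewrite expRN lnK ?posrE.
  move=> x; have d1 := dv_add (dv_cst x 1) (dv_mul (dv_sqr (dv_id x)) (dv_cst x b^-1)).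
  have := dv_exp (dv_opp (dv_ln (f := fun x => 1 + x ^+ 2 / b) (den x) d1)).
  exact: dv_continuous.
have dF x : is_derive x 1 F (g x).
  have := dv_mul (dv_cst x (Num.sqrt b)) (dv_comp (f := atan)
    (dv_mul (dv_cst x (Num.sqrt b)^-1) (dv_id x)) (is_derive1_atan _)).
  move/is_derive_eq; apply.
  rewrite !mul0r !add0r mulr1 mulrCA divff ?gt_eqF// mulr1.
  by rewrite exprMn exprVn sb2 [X in 1 + X]mulrC.
have Fl : F x @[x --> +oo] --> Num.sqrt b * (pi / 2).
  apply: cvgM; first exact: cvg_cst.
  have : (Num.sqrt b)^-1 * x @[x --> +oo] --> +oo.
    by apply: gt0_cvgMry; rewrite ?invr_gt0//; exact: cvg_id.
  by move=> h; apply: (cvg_comp _ _ h); exact: cvgy_atan.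
have FE : (\int[lebesgue_measure]_(x in `[0%R, +oo[) (g x)%:E = (Num.sqrt b * (pi / 2))%:E - (F 0)%:E)%E.
  apply: (@ge0_continuous_FTC2y R g F 0) => //.
  - by move=> x _; rewrite invr_ge0 ltW.
  - exact: continuous_subspaceT.
  - by apply: cvg_at_right_filter; exact: (dv_continuous (dF 0)).
  - by move=> x _; have [_ <-] := dF x; rewrite derive1E.
apply: (@le_lt_trans _ _ (\int[lebesgue_measure]_(x in `[0%R, +oo[) (g x)%:E)%E).
  apply: ge0_le_integral => //.
  - by move=> x _; rewrite lee_fin ltW.
  - by apply/measurable_EFinP; apply: measurable_funTS; exact: continuous_measurable_fun.
  - by apply/measurable_EFinP; apply: measurable_funTS; exact: continuous_measurable_fun.
  - by move=> x _; rewrite lee_fin fb.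
by rewrite FE -EFinB ltry.
Qed.

Definition gau x := expR (- (x ^+ 2 / 2)).

Lemma is_derive_gau x : is_derive x 1 gau (- x * gau x).
Proof.
have := dv_exp (dv_opp (dv_mul (dv_sqr (dv_id x)) (dv_cst x 2^-1))).
by move/is_derive_eq; apply; rewrite /gau; field.
Qed.

Lemma gau_gt0 x : 0 < gau x. Proof. exact: expR_gt0. Qed.
Lemma gauN x : gau (- x) = gau x. Proof. by rewrite /gau sqrrN. Qed.

Lemma continuous_gau : continuous gau.
Proof. by move=> x; exact: dv_continuous (is_derive_gau x). Qed.

Lemma gau_le x : gau x <= (1 + x ^+ 2 / 2)^-1.
Proof.
rewrite /gau expRN lef_pV2 ?expR_ge1Dx// posrE ?expR_gt0//.
by rewrite ltr_wpDr// divr_ge0 ?sqr_ge0.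
Qed.

Lemma even_gau : even_density gau.
Proof.
apply: (@even_density_le 2) => //; [exact: continuous_gau|exact: gau_gt0|exact: gauN|exact: gau_le].
Qed.

(** The number sqrt(2 pi), kept as an abstract positive constant. *)
Definition gmass : R := dmass gau.

Lemma gmass_gt0 : 0 < gmass. Proof. exact: dmass_gt0 even_gau. Qed.

(** The standard normal survival function. *)
Definition Q t : R := tailmass gau t / gmass.

Lemma is_derive_Q t : is_derive t 1 Q (- (gau t / gmass)).
Proof.
have := dv_mul (is_derive_tailmass even_gau t) (dv_cst t gmass^-1).
by move/is_derive_eq; apply; rewrite mulr0 addr0 mulNr.
Qed.

Lemma Q_gt0 t : 0 < Q t.
Proof. by rewrite divr_gt0// ?gmass_gt0//; exact: tailmass_gt0 even_gau _. Qed.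

Lemma Q_le t t' : t <= t' -> Q t' <= Q t.
Proof. by move=> tt'; rewrite ler_pM2r ?invr_gt0 ?gmass_gt0// tailmass_le//; exact: even_gau. Qed.

Lemma QN t : Q (- t) = 1 - Q t.
Proof.
by rewrite /Q (tailmassN even_gau) mulrBl divff// gt_eqF// gmass_gt0.
Qed.

Lemma gau_cvg0 : gau x @[x --> +oo] --> 0.
Proof.
apply: (@cvg_inv_bound _ 2) => u u1; rewrite gtr0_norm ?gau_gt0//.
have u0 : 0 < u by lra.
apply: le_trans (gau_le u) _; rewrite -[leRHS]invrK invf_div lef_pV2 ?posrE ?divr_gt0//; first nra.
by nra.
Qed.

(** Upper half of the Mills ratio: beyond [t] the integrand grows when multiplied by x / t, and then
    it is an exact derivative. *)
Lemma Q_le_gau t : 0 < t -> Q t <= gau t / (t * gmass).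
Proof.
move=> t0; rewrite invfM mulrA ler_wpM2r ?invr_ge0 ?(ltW gmass_gt0)//.
have := @tailmass_le_antiderivative R gau even_gau t (fun x => x / t * gau x) (fun x => - (gau x / t)).
rewrite /= opprK; apply.
- by move=> x tx; rewrite ler_peMl ?(ltW (gau_gt0 _))// ler_pdivlMr// mul1r.
- move=> x; apply: (@dv_continuous _ _ _ (1 * t^-1 * gau x + x / t * (- x * gau x))).
  have := dv_mul (dv_mul (dv_id x) (dv_cst x t^-1)) (is_derive_gau x).
  by move/is_derive_eq; apply; rewrite mulr0 addr0.
- move=> x _; have := dv_opp (dv_mul (is_derive_gau x) (dv_cst x t^-1)).
  by move/is_derive_eq; apply; rewrite mulr0 addr0; ring.
- rewrite -(@oppr0 R) -(mul0r t^-1); apply: cvgN; apply: cvgM; [exact: gau_cvg0|exact: cvg_cst].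
Qed.

Lemma Q_cvg0 : Q x @[x --> +oo] --> 0.
Proof.
apply: (@cvg_inv_bound _ gmass^-1) => u u1; rewrite gtr0_norm ?Q_gt0//.
have u0 : 0 < u by lra.
apply: le_trans (Q_le_gau u0) _; rewrite -invfM (mulrC gmass) ler_piMl ?invr_ge0 ?mulr_ge0 ?(ltW u0) ?(ltW gmass_gt0)//.
  by rewrite /gau -expR0 ler_expR oppr_le0 divr_ge0 ?sqr_ge0.
Qed.

(** Lower half of the Mills ratio: integrate the density over [Y, Y + h] only, with h = 1 / (1 + Y).
    There the exponent changes by at most Y h + h^2 / 2 <= 3 / 2. *)
Lemma gau_le_Q Y : 0 <= Y -> gau Y <= expR (3 / 2) * gmass * (1 + Y) * Q Y.
Proof.
move=> Y0; pose h := (1 + Y)^-1.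
have Y1 : 0 < 1 + Y by lra.
have h0 : 0 < h by rewrite invr_gt0.
have hY : h * (1 + Y) = 1 by rewrite mulVf// gt_eqF.
have h1 : h <= 1 by rewrite invf_le1//; lra.
have Yh : Y <= Y + h by lra.
have := @MVT_le R Q (fun t => - (gau t / gmass)) Y (Y + h) (- (expR (- (3 / 2)) * gau Y / gmass)) Yh (fun x _ => is_derive_Q x).
have H x : Y <= x <= Y + h -> - (gau x / gmass) <= - (expR (- (3 / 2)) * gau Y / gmass).
  move=> /andP[Yx xY]; rewrite lerN2 ler_pM2r ?invr_gt0 ?gmass_gt0//.
  by rewrite /gau -expRD ler_expR; nra.
move=> /(_ H); rewrite addrAC subrr add0r => H1.
have H2 : expR (- (3 / 2)) * gau Y / gmass * h <= Q Y by have := Q_gt0 (Y + h); lra.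
have -> : gau Y = expR (3 / 2) * gmass * (1 + Y) * (expR (- (3 / 2)) * gau Y / gmass * h).
  rewrite expRN; have := expR_gt0 (3 / 2 : R); have := gmass_gt0 => g0 e0.
  transitivity (gau Y * (h * (1 + Y))); first by rewrite hY mulr1.
  by field; rewrite !gt_eqF.
by rewrite ler_wpM2l// !mulr_ge0 ?expR_ge0// ltW// gmass_gt0.
Qed.

(** The tail is stable on the scale 1 / (1 + Y): on [Y - s, Y] the density is at most e times its
    value at Y, and [gau_le_Q] turns that value into a multiple of [Q Y]. The two factors e and
    e^(3/2) give e^(5/2). *)
Lemma Q_shift Y s : 0 <= Y -> 0 <= s -> s * (1 + Y) <= 1 ->
  Q (Y - s) <= (1 + expR (5 / 2) * (s * (1 + Y))) * Q Y.
Proof.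
move=> Y0 s0 sY.
have Ys : Y - s <= Y by lra.
have := @MVT_le R (fun t => - Q t) (fun t => gau t / gmass) (Y - s) Y (expR 1 * gau Y / gmass) Ys.
have H x : Y - s <= x <= Y -> gau x / gmass <= expR 1 * gau Y / gmass.
  move=> /andP[Yx xY]; rewrite ler_pM2r ?invr_gt0 ?gmass_gt0//.
  by rewrite /gau -expRD ler_expR; nra.
have D x : Y - s <= x <= Y -> is_derive x 1 (fun t => - Q t) (gau x / gmass).
  by move=> _; have := dv_opp (is_derive_Q x); rewrite opprK.
move=> /(_ D H); rewrite opprK opprB addrCA subrr addr0 => H1.
have H2 := gau_le_Q Y0.
have H3 : expR 1 * gau Y / gmass * s <= expR (5 / 2) * (s * (1 + Y)) * Q Y.
  have -> : expR (5 / 2) * (s * (1 + Y)) * Q Y =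
      expR 1 * (expR (3 / 2) * gmass * (1 + Y) * Q Y) / gmass * s.
    rewrite (_ : 5 / 2 = 1 + 3 / 2 :> R); last by field.
    by rewrite expRD; field; rewrite gt_eqF// gmass_gt0.
  by rewrite ler_wpM2r// ler_wpM2r ?invr_ge0 ?(ltW gmass_gt0)// ler_wpM2l ?expR_ge0.
by lra.
Qed.

End gaussian_tail.

(** * Student tails compared with Gaussian ones *)

Section student_tail.
Context {R : realType}.
Implicit Types (nu t x lam : R).

Lemma ln1D_ge (z : R) : 0 <= z -> z - z ^+ 2 / 2 <= ln (1 + z).
Proof.
move=> z0.
have d (x : R) : 0 <= x <= z -> is_derive x 1 (fun x => x - x ^+ 2 / 2 - ln (1 + x)) (1 - x - (1 + x)^-1).
  move=> /andP[x0 _]; have x1 : 0 < 1 + x by lra.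
  have d1 := dv_add (dv_cst x 1) (dv_id x).
  have := dv_sub (dv_sub (dv_id x) (dv_mul (dv_sqr (dv_id x)) (dv_cst x 2^-1)))
    (dv_ln (f := fun x => 1 + x) x1 d1).
  by move/is_derive_eq; apply; field; rewrite gt_eqF.
have h (x : R) : 0 <= x <= z -> 1 - x - (1 + x)^-1 <= 0.
  move=> /andP[x0 _]; have x1 : 0 < 1 + x by lra.
  rewrite subr_le0 -[leRHS]mul1r ler_pdivlMr//; nra.
have := MVT_le z0 d h.
by rewrite mul0r addr0 ln1 expr0n /= mul0r !subr0 subr_le0; lra.
Qed.

Lemma student_densE nu x : 0 < nu ->
  student_dens nu x = expR (- ((nu + 1) / 2 * ln (1 + x ^+ 2 / nu))).
Proof.
move=> n0; rewrite /student_dens /powR gt_eqF ?mulNr//.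
by rewrite ltr_wpDr// divr_ge0 ?sqr_ge0// ltW.
Qed.

Let den nu x : 0 < nu -> 0 < 1 + x ^+ 2 / nu.
Proof. by move=> n0; rewrite ltr_wpDr// divr_ge0 ?sqr_ge0// ltW. Qed.

Let d_den nu x : is_derive x 1 (fun x => 1 + x ^+ 2 / nu) (2 * x / nu).
Proof.
have := dv_add (dv_cst x 1) (dv_mul (dv_sqr (dv_id x)) (dv_cst x nu^-1)).
by move/is_derive_eq; apply; ring.
Qed.

Let d_pow nu a x : 0 < nu -> is_derive x 1 (fun x => expR (- (a * ln (1 + x ^+ 2 / nu))))
  (- (a * ((1 + x ^+ 2 / nu)^-1 * (2 * x / nu))) * expR (- (a * ln (1 + x ^+ 2 / nu)))).
Proof.
move=> n0.
have := dv_exp (dv_opp (dv_mul (dv_cst x a) (dv_ln (f := fun x => 1 + x ^+ 2 / nu) (den x n0) (d_den nu x)))).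
by move/is_derive_eq; apply; ring.
Qed.

Lemma even_student nu : 1 <= nu -> even_density (student_dens nu).
Proof.
move=> nu1; have n0 : 0 < nu by lra.
apply: (@even_density_le _ nu) => //.
- rewrite (_ : student_dens nu = (fun x => expR (- ((nu + 1) / 2 * ln (1 + x ^+ 2 / nu))))).
    by move=> x; exact: dv_continuous (d_pow _ _ n0).
  by apply/funext => x; rewrite student_densE.
- by move=> x; rewrite student_densE ?expR_gt0.
- by move=> x; rewrite /student_dens sqrrN.
- move=> x; rewrite student_densE// -{2}(@lnK _ (1 + x ^+ 2 / nu)) ?posrE ?den//.
  rewrite -expRN ler_expR lerN2 ler_peMl ?ln_ge0//; last by lra.
  by rewrite lerDl divr_ge0 ?sqr_ge0// ltW.
Qed.

Definition student_pval nu t := 2 - 2 * student_cdf nu t.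

Lemma student_pvalE nu t : 1 <= nu ->
  student_pval nu t = 2 * tailmass (student_dens nu) t / dmass (student_dens nu).
Proof.
move=> n1; have h : 0 < dmass (student_dens nu) by apply: dmass_gt0; exact: even_student.
rewrite /student_pval (_ : student_cdf nu t = lowmass (student_dens nu) t / dmass (student_dens nu)) //.
by rewrite /tailmass; field; rewrite gt_eqF.
Qed.

Lemma student_pval_decr nu t t' : 1 <= nu -> t < t' -> student_pval nu t' < student_pval nu t.
Proof.
move=> n1 tt'; rewrite !student_pvalE//.
rewrite ltr_pM2r ?invr_gt0 ?dmass_gt0//; last exact: even_student.
by rewrite ltr_pM2l// tailmass_decr//; exact: even_student.
Qed.

Lemma student_pval0 nu : 1 <= nu -> student_pval nu 0 = 1.
Proof.
move=> n1; have h := dmass_gt0 (even_student n1).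
by rewrite student_pvalE// tailmass0; [field; rewrite gt_eqF|exact: even_student].
Qed.

Lemma continuous_student_pval nu : 1 <= nu -> continuous (student_pval nu).
Proof.
move=> n1; have -> : student_pval nu = (fun t => 2 * tailmass (student_dens nu) t / dmass (student_dens nu)).
  by apply/funext => t; rewrite student_pvalE.
move=> t; have := dv_mul (dv_mul (dv_cst t 2) (is_derive_tailmass (even_student n1) t)) (dv_cst t (dmass (student_dens nu))^-1).
exact: dv_continuous.
Qed.

(** Multiplied by u / x, the Student density is the derivative of a constant times a power of 1 +
    u^2 / nu with exponent -(nu - 1) / 2; the constant involves nu / (nu - 1), which is at most 3 /
    2 for nu >= 3. *)
Lemma tailmass_student_le nu x : 3 <= nu -> 0 < x ->
  tailmass (student_dens nu) x <=
  3 / 2 / x * expR (- ((nu - 1) / 2 * ln (1 + x ^+ 2 / nu))).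
Proof.
move=> nu3 x0; have n0 : 0 < nu by lra.
have n1 : 1 <= nu by lra.
pose E u := expR (- ((nu - 1) / 2 * ln (1 + u ^+ 2 / nu))).
have E0 u : 0 < E u by exact: expR_gt0.
have Ele u : 1 <= u -> E u <= nu / u.
  move=> u1; apply: (@le_trans _ _ (1 + u ^+ 2 / nu)^-1).
    rewrite /E -[leRHS](@lnK) ?posrE ?invr_gt0 ?den// lnV ?posrE ?den//.
    rewrite ler_expR lerN2 ler_peMl ?ln_ge0//; last by lra.
    by rewrite lerDl divr_ge0 ?sqr_ge0// ltW.
  have u0 : 0 < u by lra.
  rewrite -[leRHS]invrK invf_div lef_pV2 ?posrE ?den ?divr_gt0//.
  apply: (@le_trans _ _ (u ^+ 2 / nu)); last by lra.
  by rewrite ler_pM2r ?invr_gt0//; nra.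
have dE (u : R) : is_derive u 1 (fun u : R => - (nu / (nu - 1) / x * E u)) (u / x * student_dens nu u).
  have := dv_opp (dv_mul (dv_cst u (nu / (nu - 1) / x)) (d_pow ((nu - 1) / 2) u n0)).
  move/is_derive_eq; apply.
  have -> : student_dens nu u = E u / (1 + u ^+ 2 / nu).
    have eD : (1 + u ^+ 2 / nu)^-1 = expR (- ln (1 + u ^+ 2 / nu)) by rewrite expRN lnK ?posrE ?den.
    by rewrite student_densE// eD /E -expRD; congr expR; field.
  rewrite -/(E u); have := den u n0 => h.
  have h' : 0 < nu + u ^+ 2 by rewrite ltr_wpDr ?sqr_ge0.
  by field; rewrite !gt_eqF//; lra.
have := @tailmass_le_antiderivative R _ (even_student n1) x (fun u => u / x * student_dens nu u) (fun u => - (nu / (nu - 1) / x * E u)).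
rewrite opprK => H; apply: le_trans (H _ _ _ _) _.
- move=> u xu; rewrite ler_peMl//; last by rewrite ler_pdivlMr// mul1r.
  by rewrite student_densE// expR_ge0.
- move=> u; have := dv_mul (dv_mul (dv_id u) (dv_cst u x^-1)) (d_pow ((nu + 1) / 2) u n0).
  rewrite (_ : (fun u => u / x * student_dens nu u) = (fun y => y / x * expR (- ((nu + 1) / 2 * ln (1 + y ^+ 2 / nu))))).
    exact: dv_continuous.
  by apply/funext => y; rewrite student_densE.
- apply: (@cvg_inv_bound _ _ (nu / (nu - 1) / x * nu)) => u u1.
  have c0 : 0 <= nu / (nu - 1) / x by rewrite !divr_ge0 ?ltW//; lra.
  rewrite normrN ger0_norm; last by rewrite mulr_ge0 // ltW.
  by rewrite -[leRHS]mulrA ler_wpM2l// Ele.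
apply: ler_wpM2r; first exact: expR_ge0.
apply: ler_wpM2r; first by rewrite invr_ge0 ltW.
by rewrite ler_pdivrMr; lra.
Qed.

(** Gaussian density of variance 1 / s, used with s = 1 + 1 / nu, the value at which ln(1 + z) <= z
    places it below the Student density. *)
Let gaus s x := expR (- (s * (x ^+ 2 / 2))).

Let gausE (s x : R) : 0 <= s -> gaus s x = gau (Num.sqrt s * x).
Proof. by move=> s0; rewrite /gaus /gau exprMn sqr_sqrtr// mulrA. Qed.

Let even_gaus s : 1 <= s -> even_density (gaus s).
Proof.
move=> s1; apply: (@even_density_le _ 2) => //.
- move=> x; apply: (@dv_continuous _ _ _ _ (dv_exp (dv_opp (dv_mul (dv_cst x s) (dv_mul (dv_sqr (dv_id x)) (dv_cst x 2^-1)))))).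
- by move=> x; exact: expR_gt0.
- by move=> x; rewrite /gaus sqrrN.
- move=> x; apply: le_trans (gau_le x); rewrite /gaus /gau ler_expR lerN2.
  by rewrite ler_peMl// divr_ge0 ?sqr_ge0.
Qed.

Let tailmass_gaus s t : 1 <= s ->
  tailmass (gaus s) t = gmass * Q (Num.sqrt s * t) / Num.sqrt s.
Proof.
move=> s1; have s0 : 0 < Num.sqrt s by rewrite sqrtr_gt0; lra.
have Z0 : 0 < gmass :> R := gmass_gt0.
have := @tailmass_antiderivative R _ (even_gaus s1) t (fun t => - (gmass * Q (Num.sqrt s * t) / Num.sqrt s)).
rewrite opprK; apply.
- move=> x; have h := dv_mul (dv_cst x (Num.sqrt s)) (dv_id x).
  have := dv_opp (dv_mul (dv_mul (dv_cst x gmass) (dv_comp h (is_derive_Q (Num.sqrt s * x)))) (dv_cst x (Num.sqrt s)^-1)).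
  move/is_derive_eq; apply; rewrite gausE; last by lra.
  by field; rewrite !gt_eqF.
- apply: (@cvg_inv_bound _ _ (gmass / Num.sqrt s * (gmass^-1 / Num.sqrt s))) => u u1.
  have u0 : 0 < u by lra.
  have su : 0 < Num.sqrt s * u by rewrite mulr_gt0.
  rewrite normrN ger0_norm; last by rewrite divr_ge0 ?(ltW s0)// mulr_ge0 ?(ltW Z0)// (ltW (Q_gt0 _)).
  have := Q_le_gau su => h.
  have : Q (Num.sqrt s * u) <= gmass^-1 / Num.sqrt s / u.
    apply: le_trans h _.
    rewrite (_ : gmass^-1 / Num.sqrt s / u = 1 / (Num.sqrt s * u * gmass)); last by field; rewrite !gt_eqF.
    apply: ler_wpM2r; first by rewrite invr_ge0 ltW// mulr_gt0.
    by rewrite /gau -expR0 ler_expR oppr_le0 divr_ge0 ?sqr_ge0.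
  move=> h2; have -> : gmass / Num.sqrt s * (gmass^-1 / Num.sqrt s) / u = gmass * (gmass^-1 / Num.sqrt s / u) / Num.sqrt s by ring.
  by rewrite ler_wpM2r ?invr_ge0 ?(ltW s0)// ler_wpM2l// ltW.
Qed.

Lemma tailmass_student_ge nu t : 1 <= nu ->
  gmass * Q (Num.sqrt (1 + nu^-1) * t) / Num.sqrt (1 + nu^-1) <= tailmass (student_dens nu) t.
Proof.
move=> n1; have n0 : 0 < nu by lra.
have s1 : 1 <= 1 + nu^-1 by rewrite lerDl invr_ge0 ltW.
rewrite -tailmass_gaus//; apply: tailmass_le_density; [exact: even_gaus|exact: even_student|].
move=> x _; rewrite student_densE// /gaus ler_expR lerN2.
rewrite (_ : (1 + nu^-1) * (x ^+ 2 / 2) = (nu + 1) / 2 * (x ^+ 2 / nu)); last by field; rewrite gt_eqF.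
rewrite ler_wpM2l//; first by lra.
by apply: le_ln1Dx; rewrite (lt_le_trans (ltrN10 _))// divr_ge0 ?sqr_ge0// ltW.
Qed.

Lemma dmass_student_ge nu : 1 <= nu -> gmass / Num.sqrt (1 + nu^-1) <= dmass (student_dens nu).
Proof.
move=> n1; have := tailmass_student_ge 0 n1.
rewrite mulr0 (tailmass0 (even_student n1)) /Q (tailmass0 even_gau) -/gmass.
have Z0 : 0 < gmass :> R := gmass_gt0.
rewrite mulrC (_ : _^-1 * _ = gmass / Num.sqrt (1 + nu^-1) / 2); first by lra.
have s0 : 0 < Num.sqrt (1 + nu^-1) by rewrite sqrtr_gt0 ltr_wpDr// invr_ge0; lra.
by field; rewrite !gt_eqF.
Qed.

(** On [0, A] the quadratic lower bound on ln(1 + z) keeps the Student density below exp(A^4 / (4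
    nu)) times the Gaussian one; beyond A the tail is at most 3 / (2 A). Symmetry doubles both
    contributions. *)
Lemma dmass_student_le_split nu A : 3 <= nu -> 0 < A ->
  dmass (student_dens nu) <= expR (A ^+ 4 / (4 * nu)) * gmass + 3 / A.
Proof.
move=> n3 A0; have n1 : 1 <= nu by lra.
have n0 : 0 < nu by lra.
pose c := expR (A ^+ 4 / (4 * nu)).
have := @MVT_le R (fun x => c * tailmass gau x - tailmass (student_dens nu) x)
  (fun x => c * (- gau x) - - student_dens nu x) 0 A 0 (ltW A0).
have D x : 0 <= x <= A -> is_derive x 1 (fun x => c * tailmass gau x - tailmass (student_dens nu) x) (c * (- gau x) - - student_dens nu x).
  move=> _; have := dv_sub (dv_mul (dv_cst x c) (is_derive_tailmass even_gau x)) (is_derive_tailmass (even_student n1) x).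
  by move/is_derive_eq; apply; rewrite mul0r add0r.
have L x : 0 <= x <= A -> c * (- gau x) - - student_dens nu x <= 0.
  move=> /andP[x0 xA]; rewrite mulrN opprK addrC subr_le0 student_densE// /c /gau -expRD ler_expR.
  have z0 : 0 <= x ^+ 2 / nu by rewrite divr_ge0 ?sqr_ge0// ltW.
  have h1 := ln1D_ge z0.
  have h2 : 0 <= ln (1 + x ^+ 2 / nu) by rewrite ln_ge0// lerDl.
  have h3 : nu / 2 * (x ^+ 2 / nu - (x ^+ 2 / nu) ^+ 2 / 2) <= (nu + 1) / 2 * ln (1 + x ^+ 2 / nu).
    apply: (@le_trans _ _ (nu / 2 * ln (1 + x ^+ 2 / nu))).
      by rewrite ler_wpM2l//; lra.
    by rewrite ler_wpM2r//; lra.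
  have h4 : nu / 2 * (x ^+ 2 / nu - (x ^+ 2 / nu) ^+ 2 / 2) = x ^+ 2 / 2 - x ^+ 4 / (4 * nu).
    by field; rewrite gt_eqF.
  have h5 : x ^+ 4 / (4 * nu) <= A ^+ 4 / (4 * nu).
    by rewrite ler_wpM2r ?invr_ge0 ?mulr_ge0 ?(ltW n0)//; apply: lerXn2r; rewrite ?nnegrE// ltW.
  by lra.
move=> /(_ D L); rewrite mul0r subr_le0 lerBlDr (tailmass0 (even_student n1)) (tailmass0 even_gau) -/gmass => H.
have H2 := tailmass_student_le n3 A0.
have H3 : expR (- ((nu - 1) / 2 * ln (1 + A ^+ 2 / nu))) <= 1.
  rewrite -[leRHS]expR0 ler_expR oppr_le0 mulr_ge0//; first by lra.
  by rewrite ln_ge0// lerDl divr_ge0 ?sqr_ge0// ltW.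
have H4 : tailmass (student_dens nu) A <= 3 / 2 / A.
  by apply: le_trans H2 _; rewrite ler_piMr// !divr_ge0 ?ltW.
have H5 : 0 <= c * tailmass gau A.
  by rewrite mulr_ge0 ?expR_ge0// ltW//; exact: tailmass_gt0 even_gau _.
rewrite -/c; have -> : 3 / A = 2 * (3 / 2 / A) by field; rewrite gt_eqF.
lra.
Qed.

Lemma dmass_student_le lam : 1 < lam ->
  exists nu0 : R, forall nu, nu0 <= nu -> dmass (student_dens nu) <= lam * gmass.
Proof.
move=> l1; have Z0 : 0 < gmass :> R := gmass_gt0.
pose e := (lam - 1) / 2; have e0 : 0 < e by rewrite /e; lra.
(* Makes the tail contribution 3 / A equal to e times the Gaussian mass; nu is then taken large for
   this fixed A. *)
pose A := 3 / (e * gmass).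
have A0 : 0 < A by rewrite divr_gt0// mulr_gt0.
have l0 : 0 < ln (1 + e) by rewrite ln_gt0//; lra.
exists (Num.max 3 (A ^+ 4 / (4 * ln (1 + e)))) => nu; rewrite ge_max => /andP[n3 nA].
have n0 : 0 < nu by lra.
apply: le_trans (dmass_student_le_split n3 A0) _.
have h1 : 3 / A = e * gmass by rewrite /A; field; rewrite !gt_eqF.
have h2 : expR (A ^+ 4 / (4 * nu)) <= 1 + e.
  rewrite -[leRHS]lnK ?posrE; last by lra.
  rewrite ler_expR ler_pdivrMr ?mulr_gt0//; move: nA; rewrite ler_pdivrMr ?mulr_gt0//; lra.
have h3 : expR (A ^+ 4 / (4 * nu)) * gmass <= (1 + e) * gmass by rewrite ler_wpM2r// ltW.
by rewrite h1 /e in h3 *; lra.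
Qed.

(** Three losses of a factor 1 + e each: the argument r t is moved back to t by [Q_shift], the scale
    factor r is removed, and the Student mass is replaced by the Gaussian one. The shift is (r - 1)
    t with r - 1 <= 1 / nu, hence the range of t up to order sqrt(nu). *)
Lemma student_pval_ge lam : 1 < lam -> exists nu0 kap : R, 0 < kap /\
  forall nu t, nu0 <= nu -> 0 <= t -> (1 + t) ^+ 2 <= kap * nu ->
    2 * Q t <= lam * student_pval nu t.
Proof.
move=> l1; have Z0 : 0 < gmass :> R := gmass_gt0.
(* For e <= 1 one has (1 + e)^3 <= 1 + 7 e. *)
pose e := Num.min 1 ((lam - 1) / 7).
have e0 : 0 < e by rewrite lt_min; apply/andP; split; lra.
have e1 : e <= 1 by rewrite ge_min lexx.
have el : (1 + e) * ((1 + e) * (1 + e)) <= lam.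
  have : e <= (lam - 1) / 7 by rewrite ge_min lexx orbT.
  nra.
have [n1 H1] := @dmass_student_le (1 + e) ltac:(lra).
have E0 := expR_gt0 (5 / 2 : R).
(* The first entry makes the shift admissible for [Q_shift]; the second makes its relative cost at
   most e. *)
pose kap := Num.min (1 / 2) (e / expR (5 / 2) / 2).
have kap0 : 0 < kap by rewrite lt_min !divr_gt0.
have kE : expR (5 / 2) * (2 * kap) <= e.
  have : kap <= e / expR (5 / 2) / 2 by rewrite ge_min lexx orbT.
  by rewrite ler_pdivlMr// ler_pdivlMr//; lra.
have k2 : kap <= 1 / 2 by rewrite ge_min lexx.
exists (Num.max n1 (1 + e^-1)), kap; split => // nu t; rewrite ge_max => /andP[nn1 n2] t0 tk.
have ei0 : 0 < e^-1 by rewrite invr_gt0.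
have nu1 : 1 <= nu by lra.
have n0 : 0 < nu by lra.
have ni : nu^-1 <= e by rewrite -[leRHS]invrK lef_pV2 ?posrE//; lra.
have ni0 : 0 < nu^-1 by rewrite invr_gt0.
set r := Num.sqrt (1 + nu^-1).
have r2 : r ^+ 2 = 1 + nu^-1 by rewrite sqr_sqrtr//; lra.
have r0 : 0 <= r by exact: sqrtr_ge0.
have r1 : 1 <= r by nra.
have r3 : r <= 1 + nu^-1 by nra.
have r3' : r <= 1 + e by lra.
have := @tailmass_student_ge nu t nu1; rewrite -/r => H2.
have := H1 nu nn1 => H3.
have tn : t * (1 + t) * nu^-1 <= kap.
  rewrite ler_pdivrMr//; nra.
have hs : (r * t - t) * (1 + r * t) <= 2 * kap.
  have : (r * t - t) * (1 + r * t) <= 2 * (t * (1 + t) * nu^-1).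
    have -> : (r * t - t) * (1 + r * t) = (r - 1) * (t * (1 + r * t)) by ring.
    have a1 : t * (1 + r * t) <= 2 * (t * (1 + t)) by nra.
    have a2 : 0 <= t * (1 + r * t) by nra.
    nra.
  by lra.
have := @Q_shift R (r * t) (r * t - t) (mulr_ge0 r0 t0) ltac:(nra) ltac:(lra).
rewrite opprB addrC subrK => H4.
have D0 : 0 < dmass (student_dens nu) by apply: dmass_gt0; exact: even_student.
rewrite student_pvalE// mulrA ler_pdivlMr//.
have Q0 := Q_gt0 (r * t).
have H5 : Q t <= (1 + e) * Q (r * t).
  apply: le_trans H4 _; rewrite ler_wpM2r ?(ltW Q0)// lerD2l.
  by apply: le_trans kE; rewrite ler_wpM2l ?(ltW E0).
have H6 : gmass * Q (r * t) <= (1 + e) * tailmass (student_dens nu) t.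
  move: H2; rewrite ler_pdivrMr; last by lra.
  move=> h; apply: le_trans h _; rewrite mulrC ler_wpM2r//.
  by apply: tailmass_ge0; exact: even_student.
have T0 := tailmass_ge0 (even_student nu1) t.
have e10 : 0 <= 1 + e by lra.
have H7 : Q t * dmass (student_dens nu) <= (1 + e) * ((1 + e) * ((1 + e) * tailmass (student_dens nu) t)).
  apply: (@le_trans _ _ ((1 + e) * Q (r * t) * ((1 + e) * gmass))).
    by apply: ler_pM => //; [exact/ltW/Q_gt0|exact: ltW].
  rewrite (_ : _ * Q (r * t) * _ = (1 + e) * ((1 + e) * (gmass * Q (r * t)))); last by ring.
  by apply: ler_wpM2l => //; apply: ler_wpM2l.
have H8 : (1 + e) * ((1 + e) * ((1 + e) * tailmass (student_dens nu) t)) <= lam * tailmass (student_dens nu) t.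
  by rewrite (_ : (1 + e) * ((1 + e) * ((1 + e) * _)) = (1 + e) * ((1 + e) * (1 + e)) * tailmass (student_dens nu) t) ?ler_wpM2r//; ring.
lra.
Qed.

(** In the exponent ln(1 + z) is at least z - z^2 / 2 with z = x^2 / nu. The assumption x^4 <= nu
    keeps the correction x^4 / (4 nu) bounded, so the loss is a constant factor, here e. *)
Lemma student_pval_le nu x : 3 <= nu -> 1 <= x -> x ^+ 4 <= nu ->
  student_pval nu x <= 6 / gmass * expR 1 * expR (- (x ^+ 2 / 2)).
Proof.
move=> n3 x1 xn; have n1 : 1 <= nu by lra.
have n0 : 0 < nu by lra.
have x0 : 0 < x by lra.
have Z0 : 0 < gmass :> R := gmass_gt0.
have D0 : 0 < dmass (student_dens nu) by apply: dmass_gt0; exact: even_student.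
have := @dmass_student_ge nu n1.
set r := Num.sqrt (1 + nu^-1) => DZ.
have ni : nu^-1 <= 1 by rewrite invf_le1.
have ni0 : 0 < nu^-1 by rewrite invr_gt0.
have r2 : r ^+ 2 = 1 + nu^-1 by rewrite sqr_sqrtr//; lra.
have r0 : 0 <= r by exact: sqrtr_ge0.
have r1 : 1 <= r by nra.
have r3 : r <= 2 by nra.
have {}DZ : gmass <= 2 * dmass (student_dens nu).
  move: DZ; rewrite ler_pdivrMr; last by lra.
  by move=> h; apply: le_trans h _; rewrite mulrC ler_wpM2r ?(ltW D0).
have H2 := tailmass_student_le n3 x0.
have H3 : expR (- ((nu - 1) / 2 * ln (1 + x ^+ 2 / nu))) <= expR 1 * expR (- (x ^+ 2 / 2)).
  rewrite -expRD ler_expR.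
  have z0 : 0 <= x ^+ 2 / nu by rewrite divr_ge0 ?sqr_ge0// ltW.
  have h1 := ln1D_ge z0.
  have h3 : (nu - 1) / 2 * (x ^+ 2 / nu - (x ^+ 2 / nu) ^+ 2 / 2) <= (nu - 1) / 2 * ln (1 + x ^+ 2 / nu).
    by rewrite ler_wpM2l//; lra.
  have h4 : (nu - 1) / 2 * (x ^+ 2 / nu - (x ^+ 2 / nu) ^+ 2 / 2) = x ^+ 2 / 2 - x ^+ 4 / nu / 4 - (x ^+ 2 / nu / 2) + (x ^+ 2 / nu) ^+ 2 / 4.
    by field; rewrite gt_eqF.
  have h5 : x ^+ 4 / nu <= 1 by rewrite ler_pdivrMr// mul1r.
  have h6 : x ^+ 2 / nu <= 1.
    rewrite ler_pdivrMr// mul1r; apply: le_trans xn.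
    by rewrite (_ : x ^+ 4 = x ^+ 2 * x ^+ 2) ?ler_peMr ?sqr_ge0//; [nra|ring].
  have h7 := sqr_ge0 (x ^+ 2 / nu).
  by lra.
have H4 : tailmass (student_dens nu) x <= 3 / 2 * (expR 1 * expR (- (x ^+ 2 / 2))).
  apply: le_trans H2 _; apply: ler_pM => //; rewrite ?expR_ge0//.
    by rewrite !divr_ge0// ltW.
  by rewrite ler_pdivrMr// ler_peMr.
rewrite student_pvalE// ler_pdivrMr//.
set E := expR 1 * _ in H4.
have E0 : 0 <= E by rewrite mulr_ge0 ?expR_ge0.
rewrite -(mulrA _ (expR 1)) -/E.
have H5 : 3 * E <= 6 / gmass * E * dmass (student_dens nu).
  rewrite (_ : 6 / gmass * E * _ = 3 * E * (2 * dmass (student_dens nu) / gmass)); last by ring.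
  by rewrite ler_peMr ?mulr_ge0// ler_pdivlMr// mul1r.
lra.
Qed.

End student_tail.

(** * Smoothed Gaussian tails and their exponential majorant *)

Section heat.
Context {R : realType}.
Implicit Types (x u w tau v : R).

Lemma expR_cubic_le (a : R) : expR a <= 1 + a + a ^+ 2 / 2 + `|a| ^+ 3 * expR `|a|.
Proof.
have := @taylor3 R expR expR expR expR 0 a (expR `|a|) (@is_derive_expR R) (@is_derive_expR R) (@is_derive_expR R).
move=> /(_ _)/wrap[|H].
  by move=> x; rewrite subr0 => xa; rewrite gtr0_norm ?expR_gt0// ler_expR (le_trans (ler_norm _)).
rewrite add0r !expR0 !mulr1 in H.
have := le_trans (ler_norm _) H; rewrite lerBlDl mulrC; lra.
Qed.

(** Half of the exponential moment pays for exp(k |x|), the other half for the cube, through (t0 |x|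
    / 2)^3 / 6 <= exp(t0 |x| / 2); hence 48 = 8 * 6. *)
Lemma cube_expR_le (t0 k x : R) : 0 < t0 -> k <= t0 / 2 ->
  `|x| ^+ 3 * expR (k * `|x|) <= 48 / t0 ^+ 3 * expR (t0 * `|x|).
Proof.
move=> t00 kt; have x0 := normr_ge0 x; move: `|x| x0 => {}x x0.
have h : (t0 / 2 * x) ^+ 3 / 6 <= expR (t0 / 2 * x).
  have := @expR_ge1Dxn R (t0 / 2 * x) 2; rewrite (_ : 3`! = 6%N)// => H.
  by apply: le_trans (H _); [lra|rewrite mulr_ge0// divr_ge0// ltW].
have -> : expR (t0 * x) = expR (t0 / 2 * x) * expR (t0 / 2 * x).
  by rewrite -expRD; congr expR; field.
have -> : x ^+ 3 = 48 / t0 ^+ 3 * ((t0 / 2 * x) ^+ 3 / 6) by field; rewrite gt_eqF.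
rewrite -[leLHS]mulrA; apply: ler_wpM2l; first by rewrite divr_ge0// exprn_ge0// ltW.
apply: ler_pM => //; first by rewrite divr_ge0// exprn_ge0// mulr_ge0// divr_ge0// ltW.
by rewrite ler_expR ler_wpM2r.
Qed.

Lemma sqr_gau_le v : v ^+ 2 * gau v <= 2.
Proof.
have h := @expR_ge1Dx R (v ^+ 2 / 2).
rewrite /gau expRN ler_pdivrMr ?expR_gt0//; lra.
Qed.

Lemma quartic_gau_le v : v ^+ 4 * gau v <= 8.
Proof.
have := @expR_ge1Dxn R (v ^+ 2 / 2) 1; rewrite (_ : 2`! = 2%N)// => h.
rewrite /gau expRN ler_pdivrMr ?expR_gt0//.
have := h (divr_ge0 (sqr_ge0 _) (ler0n _ 2)); have : v ^+ 4 = 4 * (v ^+ 2 / 2) ^+ 2 by field.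
lra.
Qed.

(* [irt tau] is tau ^ (-1/2). *)
Definition irt tau := expR (- (ln tau / 2)).

Lemma irt_gt0 tau : 0 < irt tau. Proof. exact: expR_gt0. Qed.

Lemma irt_sqr tau : 0 < tau -> irt tau ^+ 2 * tau = 1.
Proof.
move=> t0; rewrite -{2}(lnK t0) /irt -expRM_natl -expRD -[RHS]expR0; congr expR.
by field.
Qed.

Lemma irt_le tau tau' : 0 < tau -> tau <= tau' -> irt tau' <= irt tau.
Proof.
move=> t0 tt; rewrite ler_expR lerN2 ler_pM2r ?invr_gt0// ler_ln ?posrE//.
exact: lt_le_trans tt.
Qed.

Lemma is_derive_irt tau : 0 < tau -> is_derive tau 1 irt (- (irt tau ^+ 3 / 2)).
Proof.
move=> t0; have := dv_exp (dv_opp (dv_mul (dv_ln (f := fun x => x) t0 (dv_id tau)) (dv_cst tau 2^-1))).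
move/is_derive_eq; apply; rewrite -/(irt tau).
have h := irt_sqr t0; have -> : tau^-1 = irt tau ^+ 2.
  by rewrite -[LHS]mul1r -h mulfK// gt_eqF.
by field.
Qed.

Variables (L y : R).

(** The expectation of exp(L (w + sqrt(tau) N - y)) for a standard normal N: like [heat], a positive
    solution of the heat equation in the remaining time tau, but with multiplicative behaviour in
    both variables. *)
Definition etilt tau w := expR (- (L * (y - w)) + L ^+ 2 * tau / 2).
(** The probability that w + sqrt(tau) N >= y for a standard normal N. The functions [heat1] to
    [heat4] are its successive derivatives in w, Hermite polynomials times the density. *)
Definition heat tau w := Q (irt tau * (y - w)).
Definition heat1 tau w := irt tau * (gau (irt tau * (y - w)) / gmass).
Definition heat2 tau w := irt tau ^+ 2 * (irt tau * (y - w)) * (gau (irt tau * (y - w)) / gmass).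
Definition heat3 tau w := irt tau ^+ 3 * ((irt tau * (y - w)) ^+ 2 - 1) * (gau (irt tau * (y - w)) / gmass).
Definition heat4 tau w := irt tau ^+ 4 * ((irt tau * (y - w)) ^+ 3 - 3 * (irt tau * (y - w))) * (gau (irt tau * (y - w)) / gmass).

Let d_arg tau w : is_derive w 1 (fun w => irt tau * (y - w)) (- irt tau).
Proof.
have := dv_mul (dv_cst w (irt tau)) (dv_sub (dv_cst w y) (dv_id w)).
by move/is_derive_eq; apply; ring.
Qed.

Let d_argt tau w : 0 < tau -> is_derive tau 1 (fun tau => irt tau * (y - w)) (- (irt tau ^+ 2 * (irt tau * (y - w)) / 2)).
Proof.
move=> t0; have := dv_mul (is_derive_irt t0) (dv_cst tau (y - w)).
by move/is_derive_eq; apply; field.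
Qed.

Lemma is_derive_heat tau w : is_derive w 1 (heat tau) (heat1 tau w).
Proof.
have := dv_comp (d_arg tau w) (is_derive_Q _).
by move/is_derive_eq; apply; rewrite /heat1; ring.
Qed.

Let d_gau tau w : is_derive w 1 (fun w => gau (irt tau * (y - w)) / gmass)
  (irt tau * (irt tau * (y - w)) * (gau (irt tau * (y - w)) / gmass)).
Proof.
have := dv_mul (dv_comp (d_arg tau w) (is_derive_gau _)) (dv_cst w gmass^-1).
by move/is_derive_eq; apply; ring.
Qed.

Lemma is_derive_heat1 tau w : is_derive w 1 (heat1 tau) (heat2 tau w).
Proof.
have := dv_mul (dv_cst w (irt tau)) (d_gau tau w).
by move/is_derive_eq; apply; rewrite /heat2; ring.
Qed.

Lemma is_derive_heat2 tau w : is_derive w 1 (heat2 tau) (heat3 tau w).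
Proof.
have := dv_mul (dv_mul (dv_cst w (irt tau ^+ 2)) (d_arg tau w)) (d_gau tau w).
by move/is_derive_eq; apply; rewrite /heat3; ring.
Qed.

Lemma is_derive_heat_time tau w : 0 < tau ->
  is_derive tau 1 (heat ^~ w) (heat2 tau w / 2).
Proof.
move=> t0; have := dv_comp (d_argt w t0) (is_derive_Q _).
by move/is_derive_eq; apply; rewrite /heat2; field; rewrite gt_eqF// gmass_gt0.
Qed.

Lemma is_derive_heat2_time tau w : 0 < tau ->
  is_derive tau 1 (heat2 ^~ w) (heat4 tau w / 2).
Proof.
move=> t0; have := dv_mul (dv_mul (dv_sqr (is_derive_irt t0)) (d_argt w t0))
  (dv_mul (dv_comp (d_argt w t0) (is_derive_gau _)) (dv_cst tau gmass^-1)).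
by move/is_derive_eq; apply; rewrite /heat4; field; rewrite gt_eqF// gmass_gt0.
Qed.

(** Completing the square. With the tilt factored out, a Gaussian centred at L / [irt tau] is left
    to absorb the polynomial factors of the derivatives uniformly in w. *)
Let gau_etilt tau w : 0 < tau ->
  gau (irt tau * (y - w)) = etilt tau w * gau (irt tau * (y - w) - L / irt tau).
Proof.
move=> t0; have p0 := irt_gt0 tau; have h := irt_sqr t0.
rewrite /gau /etilt -expRD; congr expR.
have tE : tau = irt tau ^- 2 by rewrite -[LHS]mul1r -[1](@mulVf _ (irt tau ^+ 2)) ?expf_neq0 ?gt_eqF// -mulrA h mulr1.
move: (irt tau) p0 tE {h} => p p0 ->.
by field; rewrite gt_eqF.
Qed.

(** With z = v + a and a = L / p, powers of v are absorbed by [gau v], while each a meets a factor p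
    and becomes L <= q. The constant is 7 = 5 + 2, from |z^2 - 1| <= 2 v^2 + 1 + 2 a^2 and v^2
    [gau v] <= 2. *)
Lemma heat3_le tau w q : 0 < tau -> irt tau <= q -> 0 <= L <= q ->
  `|heat3 tau w| <= 7 * q ^+ 3 / gmass * etilt tau w.
Proof.
move=> t0; rewrite /heat3 gau_etilt//.
set p := irt tau; set z := p * (y - w) => pq /andP[L0 Lq].
have p0 : 0 < p := irt_gt0 tau.
have E0 : 0 < etilt tau w := expR_gt0 _.
have Z0 : 0 < gmass :> R := gmass_gt0.
set v := z - L / p; have G0 := gau_gt0 v.
have zE : z = v + L / p by rewrite /v subrK.
have h1 := sqr_gau_le v.
have h2 : gau v <= 1 by rewrite /gau -[leRHS]expR0 ler_expR oppr_le0 divr_ge0 ?sqr_ge0.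
set a := L / p in zE; have a0 : 0 <= a by rewrite divr_ge0// ltW.
have pa : p * a = L by rewrite /a mulrC divfK// gt_eqF.
have hz : `|z ^+ 2 - 1| * gau v <= 5 + 2 * a ^+ 2.
  have hz1 : `|z ^+ 2 - 1| <= 2 * v ^+ 2 + (1 + 2 * a ^+ 2).
    rewrite ler_norml zE; have := sqr_ge0 (v - a); have := sqr_ge0 (v + a); nra.
  apply: le_trans (ler_wpM2r (ltW G0) hz1) _; have := sqr_ge0 a; nra.
have c0 : 0 <= p ^+ 3 * gau v * (etilt tau w / gmass).
  by rewrite !mulr_ge0 ?invr_ge0 ?exprn_ge0// ltW.
rewrite [X in `|X|](_ : _ = (z ^+ 2 - 1) * (p ^+ 3 * gau v * (etilt tau w / gmass))); last by ring.
rewrite normrM (ger0_norm c0).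
rewrite [leLHS](_ : _ = p ^+ 3 * (`|z ^+ 2 - 1| * gau v) * (etilt tau w / gmass)); last by ring.
rewrite [leRHS](_ : _ = 7 * q ^+ 3 * (etilt tau w / gmass)); last by ring.
rewrite ler_wpM2r ?divr_ge0 ?(ltW E0) ?(ltW Z0)//.
apply: le_trans (ler_wpM2l _ hz) _; first by rewrite exprn_ge0// ltW.
rewrite (_ : p ^+ 3 * _ = 5 * p ^+ 3 + 2 * (p * (p * a) ^+ 2)); last by ring.
rewrite pa; have h3 : p ^+ 3 <= q ^+ 3 by apply: lerXn2r; rewrite ?nnegrE//; lra.
have h4 : p * L ^+ 2 <= q * q ^+ 2.
  by apply: ler_pM; rewrite ?sqr_ge0 ?(ltW p0)//; apply: lerXn2r; rewrite ?nnegrE//; lra.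
by rewrite -exprS in h4; lra.
Qed.

(** Same mechanism as for [heat3]. The constant 292 = 4 + 32 * 8 + 32 comes from |z^3 - 3 z| <= 4 (1
    + z^4), z^4 <= 8 (v^4 + a^4) and v^4 [gau v] <= 8. *)
Lemma heat4_le tau w q : 0 < tau -> irt tau <= q -> 0 <= L <= q ->
  `|heat4 tau w| <= 292 * q ^+ 4 / gmass * etilt tau w.
Proof.
move=> t0; rewrite /heat4 gau_etilt//.
set p := irt tau; set z := p * (y - w) => pq /andP[L0 Lq].
have p0 : 0 < p := irt_gt0 tau.
have E0 : 0 < etilt tau w := expR_gt0 _.
have Z0 : 0 < gmass :> R := gmass_gt0.
set v := z - L / p; have G0 := gau_gt0 v.
have zE : z = v + L / p by rewrite /v subrK.
have h1 := quartic_gau_le v.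
have h2 : gau v <= 1 by rewrite /gau -[leRHS]expR0 ler_expR oppr_le0 divr_ge0 ?sqr_ge0.
set a := L / p in zE; have a0 : 0 <= a by rewrite divr_ge0// ltW.
have pa : p * a = L by rewrite /a mulrC divfK// gt_eqF.
have hz : `|z ^+ 3 - 3 * z| * gau v <= 260 + 32 * a ^+ 4.
  have hz1 : `|z ^+ 3 - 3 * z| <= 4 * (1 + z ^+ 4).
    rewrite ler_norml; apply/andP; split.
      by have := sqr_ge0 (z ^+ 2 + z / 2); have := sqr_ge0 (z ^+ 2); have := sqr_ge0 (z - 1);  have := sqr_ge0 (z + 1); have := sqr_ge0 z; nra.
    by have := sqr_ge0 (z ^+ 2 - z / 2); have := sqr_ge0 (z ^+ 2); have := sqr_ge0 (z - 1);  have := sqr_ge0 (z + 1); have := sqr_ge0 z; nra.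
  have hz2 : z ^+ 4 <= 8 * (v ^+ 4 + a ^+ 4).
    have b1 : z ^+ 2 <= 2 * (v ^+ 2 + a ^+ 2) by rewrite zE; have := sqr_ge0 (v - a); nra.
    have b2 : z ^+ 4 <= (2 * (v ^+ 2 + a ^+ 2)) ^+ 2.
      rewrite (_ : z ^+ 4 = (z ^+ 2) ^+ 2); last by ring.
      by apply: lerXn2r => //; rewrite nnegrE ?sqr_ge0// mulr_ge0// addr_ge0 ?sqr_ge0.
    have := sqr_ge0 (v ^+ 2 - a ^+ 2).
    by rewrite (_ : (2 * (v ^+ 2 + a ^+ 2)) ^+ 2 = 8 * (v ^+ 4 + a ^+ 4) - 4 * (v ^+ 2 - a ^+ 2) ^+ 2) in b2; [lra|ring].
  have a40 : 0 <= a ^+ 4 by exact: exprn_ge0.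
  apply: (@le_trans _ _ ((4 + 32 * a ^+ 4 + 32 * v ^+ 4) * gau v)).
    by rewrite ler_wpM2r ?(ltW G0)//; lra.
  by rewrite mulrDl -mulrA; have := ler_wpM2l (_ : 0 <= 4 + 32 * a ^+ 4) h2; rewrite mulr1; lra.
have c0 : 0 <= p ^+ 4 * gau v * (etilt tau w / gmass).
  by rewrite !mulr_ge0 ?invr_ge0 ?exprn_ge0// ltW.
rewrite [X in `|X|](_ : _ = (z ^+ 3 - 3 * z) * (p ^+ 4 * gau v * (etilt tau w / gmass))); last by ring.
rewrite normrM (ger0_norm c0).
rewrite [leLHS](_ : _ = p ^+ 4 * (`|z ^+ 3 - 3 * z| * gau v) * (etilt tau w / gmass)); last by ring.
rewrite [leRHS](_ : _ = 292 * q ^+ 4 * (etilt tau w / gmass)); last by ring.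
rewrite ler_wpM2r ?divr_ge0 ?(ltW E0) ?(ltW Z0)//.
apply: le_trans (ler_wpM2l _ hz) _; first by rewrite exprn_ge0// ltW.
rewrite (_ : p ^+ 4 * _ = 260 * p ^+ 4 + 32 * (p * a) ^+ 4); last by ring.
rewrite pa; have h3 : p ^+ 4 <= q ^+ 4 by apply: lerXn2r; rewrite ?nnegrE//; lra.
have h4 : L ^+ 4 <= q ^+ 4 by apply: lerXn2r; rewrite ?nnegrE//; lra.
by lra.
Qed.

Lemma etiltD tau w h : etilt tau (w + h) = etilt tau w * expR (L * h).
Proof. by rewrite /etilt -expRD; congr expR; ring. Qed.

Lemma etilt_time tau w s : etilt (tau + s) w = etilt tau w * expR (L ^+ 2 * s / 2).
Proof. by rewrite /etilt -expRD; congr expR; field. Qed.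

(** The factor exp(L |h|) is the cost of bringing the tilt from the intermediate point of Taylor's
    formula back to u. *)
Lemma heat_taylor tau u q h : 0 < tau -> irt tau <= q -> 0 <= L <= q ->
  heat tau (u + h) <= heat tau u + h * heat1 tau u + h ^+ 2 / 2 * heat2 tau u
    + 7 * q ^+ 3 / gmass * etilt tau u * (`|h| ^+ 3 * expR (L * `|h|)).
Proof.
move=> t0 pq Lq; have /andP[L0 _] := Lq.
have p0 := irt_gt0 tau.
have := @taylor3 R _ _ _ _ u h (7 * q ^+ 3 / gmass * etilt tau u * expR (L * `|h|))
  (is_derive_heat tau) (is_derive_heat1 tau) (is_derive_heat2 tau).
move=> /(_ _)/wrap[|H].
  move=> x xh; apply: le_trans (heat3_le _ t0 pq Lq) _.
  rewrite -(subrK u x) addrC etiltD mulrA ler_wpM2l//.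
    by rewrite mulr_ge0 ?expR_ge0// divr_ge0 ?(ltW gmass_gt0)// mulr_ge0// exprn_ge0//; lra.
  by rewrite ler_expR ler_wpM2l// (le_trans (ler_norm _)).
have := le_trans (ler_norm _) H; rewrite lerBlDl => H1; apply: le_trans H1 _.
by rewrite lerD2l le_eqVlt; apply/orP; left; apply/eqP; ring.
Qed.

(** A second order expansion in time. The heat equation supplies one factor 1 / 2 for the time
    derivative of [heat2] and another when this is integrated to [heat]; hence 73 = 292 / 4. The
    tilt increases with time, so its value at the later time serves as bound. *)
Lemma heat_time_le tau s u q : 0 < tau -> 0 <= s -> irt tau <= q -> 0 <= L <= q ->
  heat tau u + s * (heat2 tau u / 2) <= heat (tau + s) u + 73 * q ^+ 4 / gmass * etilt (tau + s) u * s ^+ 2.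
Proof.
move=> t0 s0 pq Lq; pose M := 146 * q ^+ 4 / gmass * etilt (tau + s) u.
have Z0 : 0 < gmass :> R := gmass_gt0.
have ts : tau <= tau + s by rewrite lerDl.
have h4 x : tau <= x <= tau + s -> `|heat4 x u / 2| <= M.
  move=> /andP[tx xs]; have x0 : 0 < x by lra.
  have := @heat4_le x u q x0 (le_trans (irt_le t0 tx) pq) Lq.
  have : etilt x u <= etilt (tau + s) u.
    by rewrite ler_expR lerD2l ler_wpM2r// ler_wpM2l ?sqr_ge0.
  have q4 : 0 <= 146 * q ^+ 4 / gmass.
    by rewrite divr_ge0 ?(ltW Z0)// mulr_ge0// (_ : q ^+ 4 = (q ^+ 2) ^+ 2) ?sqr_ge0//; ring.
  move=> /(ler_wpM2l q4) e1 e2.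
  rewrite normrM (@gtr0_norm _ 2^-1)// /M; lra.
have h2 x : tau <= x <= tau + s -> heat2 tau u - M * s <= heat2 x u.
  move=> /andP[tx xs].
  have M0 : 0 <= M by apply: le_trans (h4 tau _); rewrite ?lexx.
  have := @MVT_abs_le R (heat2 ^~ u) (fun x => heat4 x u / 2) tau x M tx.
  move=> /(_ _)/wrap[|/(_ _)/wrap[|]].
  - by move=> z /andP[tz zx]; apply: is_derive_heat2_time; lra.
  - by move=> z /andP[tz zx]; apply: h4; lra.
  rewrite ler_norml => /andP[+ _]; have : M * (x - tau) <= M * s by rewrite ler_wpM2l// lerBlDl.
  move: (heat2 x u) (heat2 tau u) (M * s) (M * (x - tau)) => *; lra.
have := @MVT_le R (fun x => - heat x u) (fun x => - (heat2 x u / 2)) tau (tau + s) (- (heat2 tau u / 2 - M * s / 2)) ts.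
move=> /(_ _)/wrap[|/(_ _)/wrap[|]].
- by move=> x /andP[tx xs]; apply: dv_opp; apply: is_derive_heat_time; lra.
- move=> x /h2; move: (heat2 x u) (heat2 tau u) (M * s) => *; lra.
rewrite (_ : tau + s - tau = s); last by ring.
have -> : 73 * q ^+ 4 / gmass * etilt (tau + s) u * s ^+ 2 = M / 2 * s ^+ 2.
  by rewrite /M; field; rewrite gt_eqF.
by clearbody M; move: (heat tau u) (heat (tau + s) u) (heat2 tau u) => *; lra.
Qed.

Lemma continuous_heat tau : continuous (heat tau).
Proof. by move=> w; exact: dv_continuous (is_derive_heat tau w). Qed.

Lemma continuous_etilt tau : continuous (etilt tau).
Proof.
move=> w; have := dv_exp (dv_add (dv_opp (dv_mul (dv_cst w L) (dv_sub (dv_cst w y) (dv_id w)))) (dv_cst w (L ^+ 2 * tau / 2))).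
exact: dv_continuous.
Qed.

End heat.

(** * A one-sided Cramer bound by Lindeberg replacement *)

Section cramer.
Context {R : realType}.

(** Adds up the coefficients of (q r)^3 produced by one replacement: the time remainder (73), the
    cubic remainder of [heat] (7), and the cubic remainder of the tilt (last term). *)
Definition cramer_const (t0 K1 : R) : R := (73 + 7 * (48 / t0 ^+ 3) * K1) / gmass + 48 / t0 ^+ 3 * K1.

(* A supersolution of the backward heat equation: the tail of the Gaussian plus an
   exponential error term that absorbs the Taylor remainders. *)
Definition barrier (L y c eta tau w : R) : R :=
  heat y tau w + (expR (c * (tau - eta)) - 1) * etilt L y tau w.

Lemma measurable_barrier L y c eta tau : measurable_fun setT (barrier L y c eta tau).
Proof.
apply: measurable_funD; first (apply: continuous_measurable_fun; exact: continuous_heat).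
apply: measurable_funM; first exact: measurable_cst.
apply: continuous_measurable_fun; exact: continuous_etilt.
Qed.

Lemma barrier_ge0 L y c eta tau w : 0 <= c -> eta <= tau -> 0 <= barrier L y c eta tau w.
Proof.
move=> c0 et; rewrite addr_ge0//; first exact/ltW/Q_gt0.
by rewrite mulr_ge0 ?expR_ge0// subr_ge0 -[leLHS]expR0 ler_expR mulr_ge0// subr_ge0.
Qed.

(** One replacement step. The second moment term r^2 is paid by the time increment r^2, as both
    parts of the barrier solve the heat equation. What remains is at most [cramer_const] (q r)^3 <=
    c r^2 times the tilt and is absorbed by the growth of exp(c tau). The condition rho q <= 1
    reduces fourth powers to third ones, and rho L <= t0 / 2 keeps the tilted moments finite. *)
Lemma heat_step d (T : measurableType d) (P : probability T R) (t0 K1 : R) (U : T -> R)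
    (L y eta tau q rho r u c : R) :
  0 < t0 -> 0 <= K1 -> std_rv P t0 K1 U ->
  0 < eta -> eta <= tau -> irt eta <= q -> 0 <= L <= q ->
  0 <= r <= rho -> rho * q <= 1 -> rho * L <= t0 / 2 ->
  c = cramer_const t0 K1 * rho * q ^+ 3 ->
  (\int[P]_w (barrier L y c eta tau (u + r * U w))%:E <= (barrier L y c eta (tau + r ^+ 2) u)%:E)%E.
Proof.
move=> t00 K10 sU e0 et pq Lq rr0 rq rL cE; have /andP[r0 rr] := rr0.
have /andP[L0 Lq'] := Lq.
have q0 : 0 < q by rewrite (lt_le_trans _ pq)// irt_gt0.
have tau0 : 0 < tau by lra.
have Z0 : 0 < gmass :> R := gmass_gt0.
have [C0 C0E] : exists C0, C0 = 48 / t0 ^+ 3 by eexists.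
have C00 : 0 <= C0 by rewrite C0E divr_ge0// exprn_ge0// ltW.
have rho0 : 0 <= rho by lra.
have A0 : 0 <= cramer_const t0 K1.
  rewrite /cramer_const -C0E; apply: addr_ge0; last by rewrite mulr_ge0.
  by apply: divr_ge0; [apply: addr_ge0 => //; rewrite !mulr_ge0|exact: ltW].
have q30 : 0 <= q ^+ 3 := exprn_ge0 3 (ltW q0).
have c0 : 0 <= c by rewrite cE; apply: mulr_ge0; [exact: mulr_ge0|].
have pqt : irt tau <= q by rewrite (le_trans _ pq)// irt_le.
set bc := expR (c * (tau - eta)) - 1.
have bc0 : 0 <= bc by rewrite subr_ge0 -[leLHS]expR0 ler_expR mulr_ge0// subr_ge0.
set E' := etilt L y tau u; have E'0 : 0 < E' := expR_gt0 _.
set E := etilt L y (tau + r ^+ 2) u; have E0 : 0 < E := expR_gt0 _.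
have EE' : E = E' * expR (L ^+ 2 * r ^+ 2 / 2) by rewrite /E etilt_time.
have E'E : E' <= E.
  by rewrite EE' ler_peMr ?(ltW E'0)// -[leLHS]expR0 ler_expR divr_ge0// mulr_ge0 ?sqr_ge0.
have Lr : L * r <= t0 / 2 by nra.
set B := 7 * q ^+ 3 / gmass * E'.
have B0 : 0 <= B by rewrite /B; apply: mulr_ge0; [apply: divr_ge0; [exact: mulr_ge0|exact: ltW]|exact: ltW].
set H1 := heat1 y tau u; set H2 := heat2 y tau u.
have cube x k : `|k * x| ^+ 3 = `|k| ^+ 3 * `|x| ^+ 3 by rewrite normrM exprMn.
(* A majorant of the shape required by [integral_std_le]: quadratic in x plus a multiple of the
   exponential. *)
have pw x : barrier L y c eta tau (u + r * x) <=
    (heat y tau u + bc * E') + (r * H1 + bc * E' * (L * r)) * x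
    + (r ^+ 2 / 2 * H2 + bc * E' * ((L * r) ^+ 2 / 2)) * x ^+ 2
    + (r ^+ 3 * B * C0 + bc * E' * ((L * r) ^+ 3 * C0)) * expR (t0 * `|x|).
  rewrite /barrier -/bc etiltD -/E'.
  have h1 := @heat_taylor R L y tau u q (r * x) tau0 pqt Lq.
  have h2 := expR_cubic_le (L * (r * x)).
  have h3 : `|r * x| ^+ 3 * expR (L * `|r * x|) <= r ^+ 3 * (C0 * expR (t0 * `|x|)).
    rewrite cube (ger0_norm r0) -mulrA ler_wpM2l ?exprn_ge0//.
    rewrite normrM (ger0_norm r0) mulrA; rewrite C0E; exact: cube_expR_le.
  have h4 : `|L * (r * x)| ^+ 3 * expR `|L * (r * x)| <= (L * r) ^+ 3 * (C0 * expR (t0 * `|x|)).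
    rewrite mulrA cube (ger0_norm (mulr_ge0 L0 r0)) -mulrA ler_wpM2l ?exprn_ge0 ?mulr_ge0//.
    rewrite normrM (ger0_norm (mulr_ge0 L0 r0)); rewrite C0E; exact: cube_expR_le.
  have h5 := ler_wpM2l B0 h3.
  have h6 := le_trans h2 (lerD (lexx _) h4).
  have h7 := ler_wpM2l (mulr_ge0 bc0 (ltW E'0)) h6.
  rewrite -/B -/H1 -/H2 in h1.
  rewrite mulrA; lra.
have r30 : 0 <= r ^+ 3 := exprn_ge0 3 r0.
have Lr0 : 0 <= L * r := mulr_ge0 L0 r0.
have Lr30 : 0 <= (L * r) ^+ 3 := exprn_ge0 3 Lr0.
have e0' : 0 <= r ^+ 3 * B * C0 + bc * E' * ((L * r) ^+ 3 * C0).
  apply: addr_ge0; first by apply: mulr_ge0 => //; exact: mulr_ge0.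
  by apply: mulr_ge0; apply: mulr_ge0 => //; exact: ltW.
have mb : measurable_fun setT (fun x => barrier L y c eta tau (u + r * x)).
  apply: (measurableT_comp (measurable_barrier L y c eta tau)).
  by apply: measurable_funD => //; apply: measurable_funM.
apply: le_trans (integral_std_le sU e0' mb (fun x => barrier_ge0 _ _ _ c0 et) pw) _.
rewrite lee_fin {pw mb}.
set kap := (L * r) ^+ 3 * C0 * K1.
have kap0 : 0 <= kap by rewrite /kap; apply: mulr_ge0 => //; exact: mulr_ge0.
(* The tilt [E] at the later time carries the factor exp((L r)^2 / 2), which pays for the second
   moment; only the cubic part [kap] is left over. *)
have g1 : E' * (1 + (L * r) ^+ 2 / 2 + kap) <= E * expR kap.
  rewrite EE' -mulrA ler_wpM2l ?(ltW E'0)// -expRD.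
  rewrite -addrA (_ : L ^+ 2 * r ^+ 2 / 2 = (L * r) ^+ 2 / 2); last by ring.
  exact: expR_ge1Dx.
have Lqr : (L * r) ^+ 3 <= (q * r) ^+ 3.
  apply: lerXn2r; rewrite ?nnegrE ?mulr_ge0 ?(ltW q0)//.
  by rewrite ler_wpM2r.
have qr0 : 0 <= q * r by rewrite mulr_ge0// ltW.
have qr1 : q * r <= 1 by apply: le_trans rq; rewrite mulrC ler_wpM2r// ltW.
have qr3 : (q * r) ^+ 4 <= (q * r) ^+ 3 by rewrite exprS ler_piMl// exprn_ge0.
have cr : cramer_const t0 K1 * (q * r) ^+ 3 <= c * r ^+ 2.
  rewrite cE (_ : _ * r ^+ 2 = cramer_const t0 K1 * (rho * q ^+ 3 * r ^+ 2)); last by ring.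
  rewrite ler_wpM2l// (_ : (q * r) ^+ 3 = r * (q ^+ 3 * r ^+ 2)); last by ring.
  by rewrite -mulrA ler_wpM2r// mulr_ge0 ?sqr_ge0// exprn_ge0// ltW.
have kapc : kap <= c * r ^+ 2.
  apply: le_trans cr; rewrite /kap /cramer_const -C0E mulrDl.
  have a1 : 0 <= (73 + 7 * C0 * K1) / gmass * (q * r) ^+ 3.
    by rewrite mulr_ge0 ?exprn_ge0// divr_ge0 ?(ltW Z0)// addr_ge0// !mulr_ge0.
  have a2 : (L * r) ^+ 3 * C0 * K1 <= (q * r) ^+ 3 * C0 * K1 by rewrite !ler_wpM2r.
  lra.
have g2 := @heat_time_le R L y tau (r ^+ 2) u q tau0 (sqr_ge0 _) pqt Lq.
rewrite -/H2 -/E in g2.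
have g3 : bc * (E' * (1 + (L * r) ^+ 2 / 2 + kap)) <= bc * (E * expR (c * r ^+ 2)).
  by rewrite ler_wpM2l// (le_trans g1)// ler_wpM2l ?(ltW E0)// ler_expR.
have g4 : r ^+ 3 * B * C0 * K1 + 73 * q ^+ 4 / gmass * E * (r ^+ 2) ^+ 2 <= E * (c * r ^+ 2).
  have b1 : r ^+ 3 * B * C0 * K1 <= 7 * C0 * K1 / gmass * (q * r) ^+ 3 * E.
    rewrite (_ : r ^+ 3 * B * C0 * K1 = 7 * C0 * K1 / gmass * (q * r) ^+ 3 * E'); last by rewrite /B; ring.
    by rewrite ler_wpM2l// mulr_ge0 ?exprn_ge0// divr_ge0 ?(ltW Z0)// !mulr_ge0.
  have b2 : 73 * q ^+ 4 / gmass * E * (r ^+ 2) ^+ 2 <= 73 / gmass * (q * r) ^+ 3 * E.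
    rewrite (_ : _ * (r ^+ 2) ^+ 2 = 73 / gmass * (q * r) ^+ 4 * E); last by ring.
    by rewrite ler_wpM2r ?(ltW E0)// ler_wpM2l// divr_ge0// ltW.
  have b3 : cramer_const t0 K1 * (q * r) ^+ 3 * E <= E * (c * r ^+ 2).
    by rewrite mulrC ler_wpM2l// ltW.
  have b4 : 7 * C0 * K1 / gmass * (q * r) ^+ 3 * E + 73 / gmass * (q * r) ^+ 3 * E <= cramer_const t0 K1 * (q * r) ^+ 3 * E.
    have b5 : 0 <= C0 * K1 * (q * r) ^+ 3 * E by rewrite !mulr_ge0// ?exprn_ge0// ltW.
    rewrite /cramer_const -C0E [leRHS](_ : _ = 7 * C0 * K1 / gmass * (q * r) ^+ 3 * E + 73 / gmass * (q * r) ^+ 3 * E + C0 * K1 * (q * r) ^+ 3 * E); last by ring.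
    by rewrite lerDl.
  by apply: le_trans b3; apply: le_trans b4; exact: lerD b1 b2.
(* The supersolution inequality; after cancelling the terms with exp(c (tau - eta)) it is c r^2 <=
   exp(c r^2) - 1. *)
have g5 : c * r ^+ 2 + bc * expR (c * r ^+ 2) <= expR (c * (tau + r ^+ 2 - eta)) - 1.
  rewrite (_ : c * (tau + r ^+ 2 - eta) = c * (tau - eta) + c * r ^+ 2); last by ring.
  rewrite expRD /bc; move: (expR_ge1Dx (c * r ^+ 2)).
  by move: (expR (c * r ^+ 2)) (expR (c * (tau - eta))) (c * r ^+ 2); clear => *; lra.
have g6 := ler_wpM2l (ltW E0) g5.
rewrite /barrier -/E [leLHS](_ : _ = (heat y tau u + r ^+ 2 * (H2 / 2))
  + bc * (E' * (1 + (L * r) ^+ 2 / 2 + kap)) + r ^+ 3 * B * C0 * K1); last by rewrite /kap; ring.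
apply: le_trans (lerD (lerD g2 g3) (lexx _)) _.
move: g4 g6; move: (r ^+ 3 * B * C0 * K1) (73 * q ^+ 4 / gmass * E * (r ^+ 2) ^+ 2).
move: (expR (c * r ^+ 2)) (expR (c * (tau + r ^+ 2 - eta))) (c * r ^+ 2).
by clear; move=> *; lra.
Qed.

Lemma expR_sub1_le (x : R) : 0 <= x <= 1 -> expR x - 1 <= expR 1 * x.
Proof.
move=> /andP[x0 x1]; have h := expR_ge1Dx (- x).
have e0 := expR_gt0 x.
have h1 : (1 - x) * expR x <= 1.
  by rewrite -[leRHS](mulVf (lt0r_neq0 e0)) -expRN ler_wpM2r// ltW.
have h2 : expR x <= expR 1 by rewrite ler_expR.
nra.
Qed.

Section barrier_start.
Variables (M h Y : R).
Hypotheses (M0 : 0 <= M) (h0 : 0 <= h) (Y0 : 0 <= Y) (Mh : (M + 1) * h * (1 + Y) <= 1).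

Let h0Y : 0 <= h * (1 + Y). Proof. by rewrite mulr_ge0// addr_ge0. Qed.

Let hY1 : h * (1 + Y) <= 1.
Proof.
apply: le_trans Mh; rewrite -mulrA ler_peMl//; by rewrite lerDr.
Qed.

Let hY : h * Y <= 1.
Proof. by apply: le_trans hY1; rewrite ler_wpM2l// lerDr. Qed.

(** Here h is the final smoothing width and M h the shift of the threshold. Starting at time 1 + h^2
    instead of 1 shrinks the argument by a factor at least 1 - h^2, which costs at most h^2 Y <= h;
    this is the extra 1 in M + 1. *)
Lemma heat_start_le : heat (Y - M * h) (1 + h ^+ 2) 0
  <= (1 + expR (5 / 2) * ((M + 1) * h * (1 + Y))) * Q Y.
Proof.
have sh0 : 0 <= (M + 1) * h by rewrite mulr_ge0// addr_ge0.
apply: le_trans (Q_shift Y0 sh0 Mh); apply: Q_le; rewrite subr0.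
set y := Y - M * h; set w := irt _.
have h20 : 0 <= h ^+ 2 := sqr_ge0 h.
have w0 : 0 <= w by apply/ltW/irt_gt0.
have w1 : w <= 1.
  by rewrite /w /irt -[leRHS]expR0 ler_expR oppr_le0 divr_ge0// ln_ge0// lerDl.
have ln2 : ln (1 + h ^+ 2) / 2 <= h ^+ 2.
  apply: (@le_trans _ _ (ln (1 + h ^+ 2))).
    by rewrite ler_pdivrMr// ler_peMr// ?ler1n// ln_ge0// lerDl.
  by apply: le_ln1Dx; apply: lt_le_trans h20; rewrite ltrN10.
have w2 : 1 - h ^+ 2 <= w.
  by apply: le_trans (expR_ge1Dx (- h ^+ 2)) _; rewrite ler_expR lerN2.
have hhY : h ^+ 2 * Y <= h.
  by rewrite expr2 -mulrA ler_piMr.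
have yY : y <= Y by rewrite /y lerBlDr lerDl mulr_ge0.
have yE : Y - (M + 1) * h = y - h by rewrite /y; ring.
rewrite yE; clearbody y w; have [y0|y0] := leP 0 y.
  apply: (@le_trans _ _ ((1 - h ^+ 2) * y)); last by rewrite ler_wpM2r.
  rewrite mulrBl mul1r lerB//; apply: le_trans hhY.
  by rewrite ler_wpM2l.
apply: (@le_trans _ _ y); first by rewrite gerBl.
by rewrite -[leLHS]mul1r ler_wnM2r// ltW.
Qed.

(** The slope L = Y minimizes the tilt at the origin, up to the smoothing: the exponent is -Y^2 / 2
    plus bounded terms. So the error part of the barrier is comparable to the density at Y, which
    exceeds [Q Y] by at most a factor of order 1 + Y. *)
Lemma etilt_start_le : etilt Y (Y - M * h) (1 + h ^+ 2) 0
  <= expR 2 * (expR (3 / 2) * gmass * (1 + Y) * Q Y).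
Proof.
apply: (@le_trans _ _ (expR 2 * gau Y)); last first.
  by rewrite ler_wpM2l ?expR_ge0// gau_le_Q.
rewrite /etilt /gau -expRD ler_expR subr0.
have MhY : Y * (M * h) <= 1.
  apply: le_trans Mh; rewrite mulrC.
  apply: ler_pM => //; first exact: mulr_ge0.
    by rewrite ler_wpM2r// lerDl.
  by rewrite lerDr.
have YhY : Y ^+ 2 * h ^+ 2 <= 1 by rewrite -exprMn exprn_ile1 ?mulr_ge0// mulrC.
move: MhY YhY; have -> : - (Y * (Y - M * h)) + Y ^+ 2 * (1 + h ^+ 2) / 2
  = - Y ^+ 2 / 2 + Y * (M * h) + Y ^+ 2 * h ^+ 2 / 2 by field.
move: (Y ^+ 2) (Y * (M * h)) (Y ^+ 2 * h ^+ 2) => *; lra.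
Qed.

End barrier_start.

(** The barrier starts at the origin at time 1 + eta and is run through all terms down to time eta,
    where it is at least Q(-M) on [Y, oo); Markov's inequality concludes. The error rate c is of
    order rho (1 + Y)^3, and the tilt at the start exceeds [Q Y] by a factor of order 1 + Y, whence
    the fourth power. *)
Lemma cramer_upper (t0 K1 lam : R) : 0 < t0 -> 0 <= K1 -> 1 < lam ->
  exists2 kap : R, 0 < kap &
  forall d (T : measurableType d) (P : probability T R) (I : choiceType)
    (D : pred I) (F : I -> set (set T)) (U : I -> T -> R) (r : I -> R) (s : seq I) (rho Y : R),
  indep_family P D F ->
  (forall b C, D b -> measurable C -> F b (U b @^-1` C)) ->
  (forall b, D b -> std_rv P t0 K1 (U b)) ->
  all D s -> uniq s ->
  (forall b, D b -> 0 <= r b <= rho) -> \sum_(b <- s) r b ^+ 2 = 1 ->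
  0 <= Y -> rho * (1 + Y) ^+ 4 <= kap ->
  (P [set w | (Y <= \sum_(b <- s) r b * U b w)%R] <= (lam * Q Y)%:E)%E.
Proof.
move=> t00 K10 l1.
have Z0 : 0 < gmass :> R := gmass_gt0.
(* For e <= 1 one has (1 + e) (1 + 2 e) <= 1 + 5 e. The first factor comes from dividing by Q(-M),
   the second from the shift and from the error part of the barrier. *)
pose e := Num.min 1 ((lam - 1) / 5).
have e0 : 0 < e by rewrite lt_min; apply/andP; split; lra.
have e1 : e <= 1 by rewrite ge_min lexx.
have el : (1 + e) * (1 + 2 * e) <= lam.
  have : e <= (lam - 1) / 5 by rewrite ge_min lexx orbT.
  nra.
clearbody e.
have [M M0 QM] : exists2 M : R, 0 <= M & Q (- M) * (1 + e) >= 1.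
  have /cvgrPdist_le/(_ (e / 2)) H := @Q_cvg0 R.
  have [|N [_ HN]] := H _; first by rewrite divr_gt0.
  exists (Num.max 0 (N + 1)); first by rewrite le_max lexx.
  have := HN (Num.max 0 (N + 1)).
  rewrite lt_max ltrDl ltr01 orbT => /(_ isT) /=.
  rewrite sub0r normrN gtr0_norm ?Q_gt0// QN; nra.
have E5 := expR_gt0 (5 / 2 : R); have E1 := expR_gt0 (1 : R).
pose del := Num.min 1 (e / ((M + 1) * (1 + expR (5 / 2)))).
have MM : 0 < (M + 1) * (1 + expR (5 / 2)) by rewrite mulr_gt0//; lra.
have del0 : 0 < del by rewrite lt_min ltr01 divr_gt0.
have del1 : del <= 1 by rewrite ge_min lexx.
have delM : del * ((M + 1) * (1 + expR (5 / 2))) <= e.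
  by rewrite -ler_pdivlMr// ge_min lexx orbT.
have dM1 : del * (M + 1) <= 1 by nra.
have dM2 : expR (5 / 2) * (del * (M + 1)) <= e by nra.
clearbody del.
pose A := cramer_const t0 K1.
have C00 : 0 <= 48 / t0 ^+ 3 by rewrite divr_ge0// exprn_ge0// ltW.
have A0 : 0 <= A.
  rewrite /A /cramer_const; apply: addr_ge0; last exact: mulr_ge0.
  by apply: divr_ge0; [apply: addr_ge0 => //; apply: mulr_ge0 => //; exact: mulr_ge0|exact: ltW].
pose B := expR 1 * (expR 2 * (expR (3 / 2) * gmass)) * ((1 + A) / del ^+ 3).
have d3 : 0 < del ^+ 3 := exprn_gt0 3 del0.
have B0 : 0 < B by rewrite /B; do ! apply: mulr_gt0; rewrite ?expR_gt0// ?invr_gt0//; lra.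
pose kap := Num.min (Num.min del (t0 / 2)) (Num.min (del ^+ 3 / (1 + A)) (e / B)).
have kap0 : 0 < kap.
  by rewrite !lt_min del0 divr_gt0//= !divr_gt0//; lra.
have k1 : kap <= del by rewrite !ge_min lexx.
have k2 : kap <= t0 / 2 by rewrite !ge_min lexx ?orbT.
have k3 : kap * (1 + A) <= del ^+ 3.
  by rewrite -ler_pdivlMr; [rewrite !ge_min lexx ?orbT|lra].
have k4 : kap * B <= e by rewrite -ler_pdivlMr// !ge_min lexx ?orbT.
exists kap => // d T P I D F U r s rho Y ind FU sU Ds us rr sr Y0 rY.
have Y1 : 1 <= 1 + Y by rewrite lerDl.
have Y1' : 0 < 1 + Y by exact: lt_le_trans Y1.
have [b Db] : exists b, D b.
  case: s sr Ds {us} => [|b s]; first by rewrite big_nil => /esym/eqP; rewrite oner_eq0.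
  by move=> _ /= /andP[Db _]; exists b.
have rho0 : 0 <= rho by have /andP[] := rr b Db; exact: le_trans.
have pY : 1 + Y <= (1 + Y) ^+ 4 by rewrite exprS ler_peMr ?exprn_ege1// ltW.
have pY3 : (1 + Y) ^+ 3 <= (1 + Y) ^+ 4 by rewrite [leRHS]exprS ler_peMl// exprn_ge0// ltW.
have rY1 : rho * (1 + Y) <= kap by apply: le_trans rY; rewrite ler_wpM2l.
(* The smoothing width 1 / q is a small fraction del of 1 / (1 + Y), the scale on which the Gaussian
   tail changes by a constant factor near Y. *)
pose q := (1 + Y) / del.
have q0 : 0 < q by rewrite divr_gt0.
have qi : q^-1 = del / (1 + Y) by rewrite invf_div.
pose eta := q^-1 ^+ 2.
have eta0 : 0 < eta by rewrite exprn_gt0// invr_gt0.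
have qY : 1 + Y <= q by rewrite ler_peMr ?invf_ge1// ltW.
have qV0 : 0 <= q^-1 by rewrite invr_ge0 ltW.
have MqE : (M + 1) * q^-1 * (1 + Y) = del * (M + 1) by rewrite qi; field; rewrite gt_eqF.
have Mq1 : (M + 1) * q^-1 * (1 + Y) <= 1 by rewrite MqE.
have etaS S : S <= 1 -> eta <= 1 + eta - S by move=> S1; rewrite lerBrDr addrC lerD2r.
have irtq : irt eta = q.
  have := irt_sqr eta0; rewrite /eta -exprMn => h.
  have : irt (q^-1 ^+ 2) * q^-1 = 1.
    by apply/eqP; rewrite -sqrp_eq1 ?h// mulr_ge0 ?invr_ge0 ?(ltW q0)// ltW// irt_gt0.
  by move=> /(congr1 (fun x => x * q)); rewrite mulfVK ?gt_eqF// mul1r.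
pose y := Y - M / q.
pose c := A * rho * q ^+ 3.
have c0 : 0 <= c by rewrite /c; apply: mulr_ge0; [exact: mulr_ge0|rewrite exprn_ge0// ltW].
have cE : c = A * (rho * (1 + Y) ^+ 3) / del ^+ 3 by rewrite /c /q; field; rewrite gt_eqF.
pose G s' w := barrier Y y c eta (1 + eta - \sum_(b <- s') r b ^+ 2) w.
have sfx s' : suffix s' s -> \sum_(b <- s') r b ^+ 2 <= 1.
  move=> /suffixP[s0 se]; rewrite -sr se big_cat/= lerDr sumr_ge0// => b0 _; exact: sqr_ge0.
have mU b' : D b' -> measurable_fun setT (fun w => r b' * U b' w).
  by move=> Db'; have [? _ _ _] := sU _ Db'; apply: measurable_funM.
have rq : rho * q <= 1 by rewrite /q mulrA ler_pdivrMr// mul1r (le_trans rY1).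
have rL : rho * Y <= t0 / 2.
  by apply: le_trans k2; apply: le_trans rY1; rewrite ler_wpM2l// lerDr.
have chain : (\int[P]_w (G s (\sum_(b <- s) r b * U b w))%:E <= (G [::] 0)%:E)%E.
  apply: (@sum_chain _ _ _ P I D F (fun b w => r b * U b w) G s ind) => //.
  - move=> b' C Db' mC; rewrite (_ : _ @^-1` _ = U b' @^-1` ((fun x => r b' * x) @^-1` C)) //.
    apply: FU => //; rewrite -[X in measurable X]setTI.
    by apply: measurable_funM => //; exact: measurable_cst.
  - move=> s' _; exact: measurable_barrier.
  - by move=> s' u /sfx ?; apply: barrier_ge0 => //; exact: etaS.
  - move=> a s' u as'; have := sfx _ as'; rewrite /G big_cons => h.
    have Da : D a.
      move/suffixP : as' => [s0 se]; have /allP := Ds; apply; rewrite se.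
      by rewrite mem_cat inE eqxx orbT.
    rewrite [in leRHS](_ : 1 + eta - _ = 1 + eta - (r a ^+ 2 + \sum_(j <- s') r j ^+ 2) + r a ^+ 2); last by ring.
    apply: (@heat_step _ _ P t0 K1 (U a) Y y eta _ q rho (r a) u c) => //.
    + exact: sU.
    + exact: etaS.
    + by rewrite irtq.
    + by rewrite Y0 (le_trans _ qY)// lerDr.
    + exact: rr.
(* At time eta the error coefficient is 0, and because the threshold was moved left by M / q every w
   >= Y lies at least M smoothing widths beyond it. *)
have GY w : Y <= w -> Q (- M) <= G s w.
  move=> Yw; rewrite /G sr /barrier (_ : 1 + eta - 1 = eta); last by ring.
  rewrite subrr mulr0 expR0 subrr mul0r addr0 /heat; apply: Q_le.
  rewrite irtq /y; have h : q * (M / q) = M by rewrite mulrC divfK// gt_eqF.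
  by rewrite (_ : q * (_ - w) = q * (Y - w) - q * (M / q)); [rewrite h gerDr mulr_ge0_le0 ?(ltW q0)// subr_le0|ring].
have mS : measurable_fun setT (fun w => \sum_(b <- s) r b * U b w).
  rewrite (_ : (fun w => _) = (fun w => \sum_(b <- s) (if D b then r b * U b w else 0))).
    by apply: measurable_sum => b'; have [bs|bs] := boolP (D b'); [exact: mU|exact: measurable_cst].
  by apply/funext => w; rewrite big_seq [RHS]big_seq; apply: eq_bigr => b' bs; rewrite (allP Ds).
have QM0 : 0 < Q (- M) := Q_gt0 _.
have mev : measurable [set w | Y <= \sum_(b <- s) r b * U b w].
  rewrite -[X in measurable X]setTI.
  by apply: measurable_fun_le => //; exact: measurable_cst.
apply: le_trans (markov_le (f := G s) mev mS (measurable_barrier _ _ _ _ _) _ QM0 (fun w => GY _) chain) _.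
  by move=> x; apply: barrier_ge0 => //; exact/etaS/sfx/suffix_refl.
rewrite lee_fin ler_pdivrMr//.
have QY0 := Q_gt0 Y.
have g1 : heat y (1 + eta) 0 <= (1 + e) * Q Y.
  by apply: le_trans (heat_start_le M0 qV0 Y0 Mq1) _; rewrite ler_wpM2r ?(ltW QY0)// lerD2l MqE.
(* As c <= 1, exp(c) - 1 is at most a constant times c, and c (1 + Y) equals A rho (1 + Y)^4 /
   del^3: this is where the condition on rho (1 + Y)^4 is spent. *)
have g2 : (expR (c * (1 + eta - eta)) - 1) * etilt Y y (1 + eta) 0 <= e * Q Y.
  rewrite (_ : c * (1 + eta - eta) = c); last by ring.
  have c1 : c <= 1.
    rewrite cE ler_pdivrMr// mul1r; apply: le_trans k3.
    have : rho * (1 + Y) ^+ 3 <= kap by apply: le_trans rY; rewrite ler_wpM2l.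
    by move=> h; rewrite mulrC; apply: ler_pM => //; [rewrite mulr_ge0// exprn_ge0// ltW|rewrite lerDr].
  have h1 : expR c - 1 <= expR 1 * c by apply: expR_sub1_le; rewrite c0.
  have h4 := etilt_start_le M0 qV0 Y0 Mq1.
  have h5 : (expR c - 1) * etilt Y y (1 + eta) 0 <= expR 1 * c * (expR 2 * (expR (3 / 2) * gmass * (1 + Y) * Q Y)).
    apply: ler_pM => //; last exact: expR_ge0.
    by rewrite subr_ge0 -[leLHS]expR0 ler_expR.
  apply: le_trans h5 _.
  rewrite (_ : expR 1 * c * _ = c * (1 + Y) * (expR 1 * (expR 2 * (expR (3 / 2) * gmass))) * Q Y); last by ring.
  rewrite ler_wpM2r ?(ltW QY0)//; apply: le_trans k4.
  set K := expR 1 * _; have K0 : 0 <= K by rewrite /K !mulr_ge0 ?expR_ge0// ltW.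
  rewrite /B -/K (_ : kap * _ = kap * ((1 + A) / del ^+ 3) * K); last by ring.
  rewrite ler_wpM2r// cE.
  rewrite (_ : _ / del ^+ 3 * (1 + Y) = rho * (1 + Y) ^+ 4 * (A / del ^+ 3)); last by ring.
  apply: ler_pM => //; first by rewrite mulr_ge0// exprn_ge0// ltW.
    by rewrite divr_ge0// ltW.
  by rewrite ler_wpM2r ?invr_ge0 ?(ltW d3)// lerDr.
rewrite /G big_nil subr0 /barrier.
have g3 : heat y (1 + eta) 0 + (expR (c * (1 + eta - eta)) - 1) * etilt Y y (1 + eta) 0 <= (1 + 2 * e) * Q Y.
  by apply: le_trans (lerD g1 g2) _; rewrite -mulrDl ler_wpM2r ?(ltW QY0)// -addrA -mulr2n mulr_natl.
apply: le_trans g3 _.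
have g4 : (1 + 2 * e) * Q Y <= (1 + 2 * e) * Q Y * (Q (- M) * (1 + e)).
  by rewrite ler_peMr// mulr_ge0 ?(ltW QY0)// addr_ge0// mulr_ge0// ltW.
apply: le_trans g4 _.
rewrite (_ : _ * (_ * (1 + e)) = (1 + e) * (1 + 2 * e) * (Q Y * Q (- M))); last by ring.
by rewrite -(mulrA lam) ler_wpM2r// mulr_ge0 ?ltW.
Qed.

End cramer.

(** * Chernoff and Chebyshev bounds for independent sums *)

Section deviations.
Context d (T : measurableType d) {R : realType} (P : probability T R).

Lemma probability_le_add (A B C : set T) (b c : R) :
  measurable A -> measurable B -> measurable C -> A `<=` B `|` C ->
  (P B <= b%:E)%E -> (P C <= c%:E)%E -> (P A <= (b + c)%:E)%E.
Proof.
move=> mA mB mC ABC Bb Cc.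
apply: (@le_trans _ _ (P (B `|` C))).
  by apply: le_measure => //; rewrite inE//; exact: measurableU.
apply: le_trans (measureU2 _ mB mC) _.
by rewrite EFinD leeD.
Qed.

Variables (t0 K1 : R).
Hypotheses (t00 : 0 < t0) (K10 : 0 <= K1).
Variables (I : choiceType) (D : pred I) (F : I -> set (set T)) (U : I -> T -> R).
Hypothesis ind : indep_family P D F.
Hypothesis FU : forall b C, D b -> measurable C -> F b (U b @^-1` C).
Hypothesis sU : forall b, D b -> std_rv P t0 K1 (U b).

Let mU b : D b -> measurable_fun setT (U b). Proof. by move=> /sU []. Qed.

Lemma measurable_psi_sum (psi : I -> R -> R) s : (forall b, measurable_fun setT (psi b)) ->
  all D s -> measurable_fun setT (fun w => \sum_(b <- s) psi b (U b w)).
Proof.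
move=> mpsi Ds.
rewrite (_ : (fun w => _) = (fun w => \sum_(b <- s) (if D b then psi b (U b w) else 0))).
  apply: measurable_sum => b'; have [bs|bs] := boolP (D b'); last exact: measurable_cst.
  by apply: measurableT_comp => //; exact: mU.
by apply/funext => w; rewrite big_seq [RHS]big_seq; apply: eq_bigr => b' bs; rewrite (allP Ds).
Qed.

Lemma measurable_psi_sum_ge (psi : I -> R -> R) s a : (forall b, measurable_fun setT (psi b)) ->
  all D s -> measurable [set w | a <= \sum_(b <- s) psi b (U b w)].
Proof.
move=> mpsi Ds; rewrite -[X in measurable X]setTI.
by apply: measurable_fun_le => //; exact: measurable_psi_sum.
Qed.

Lemma psi_chain (psi : I -> R -> R) (phi : seq I -> R -> R) s :
  (forall b, measurable_fun setT (psi b)) -> all D s -> uniq s ->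
  (forall s', measurable_fun setT (phi s')) ->
  (forall s' u, suffix s' s -> 0 <= phi s' u) ->
  (forall a s' u, D a -> suffix (a :: s') s ->
    (\int[P]_w (phi (a :: s') (u + psi a (U a w)))%:E <= (phi s' u)%:E)%E) ->
  (\int[P]_w (phi s (\sum_(a <- s) psi a (U a w)))%:E <= (phi [::] 0)%:E)%E.
Proof.
move=> mpsi Ds us mphi phi0 step.
apply: (@sum_chain _ _ _ P I D F (fun b w => psi b (U b w)) phi s ind) => //.
- by move=> b Db; apply: measurableT_comp => //; exact: mU.
- move=> b C Db mC; rewrite (_ : _ @^-1` _ = U b @^-1` (psi b @^-1` C)) //.
  by apply: FU => //; rewrite -[X in measurable X]setTI; exact: mpsi.
- move=> a s' u as'; apply: step => //.
  move/suffixP : as' => [s0 se]; have /allP := Ds; apply; rewrite se.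
  by rewrite mem_cat inE eqxx orbT.
Qed.

(** Chernoff's bound; the potential carries one factor e^b for each term that is still to be
    added. *)
Lemma expR_chain (psi : R -> R) (b : R) s (a : R) : measurable_fun setT psi ->
  all D s -> uniq s ->
  (forall i, D i -> (\int[P]_w (expR (psi (U i w)))%:E <= (expR b)%:E)%E) ->
  (P [set w | (a <= \sum_(i <- s) psi (U i w))%R] <= (expR ((size s)%:R * b - a))%:E)%E.
Proof.
move=> mpsi Ds us psib.
pose phi (s' : seq I) (u : R) := expR u * expR (((size s)%:R - (size s')%:R) * b).
have mphi s' : measurable_fun setT (phi s').
  by apply: measurable_funM => //; exact: measurable_cst.
have := @psi_chain (fun=> psi) phi s (fun=> mpsi) Ds us mphi.
move=> /(_ _)/wrap[|/(_ _)/wrap[|H]].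
- by move=> s' u _; rewrite mulr_ge0 ?expR_ge0.
- move=> i s' u Di _; rewrite /phi.
  under eq_integral do rewrite expRD -mulrA mulrC -mulrA EFinM.
  have c0 : 0 <= expR (((size s)%:R - (size (i :: s'))%:R) * b) * expR u by rewrite mulr_ge0 ?expR_ge0.
  rewrite (_ : (fun x => _) = (fun x => ((expR (((size s)%:R - (size (i :: s'))%:R) * b) * expR u)%:E * (expR (psi (U i x)))%:E)%E)); last first.
    by apply/funext => x; rewrite -!EFinM; congr EFin; ring.
  rewrite ge0_integralZl//; last first.
    apply/measurable_EFinP; apply: (measurableT_comp (f := expR)) => //.
    by apply: measurableT_comp => //; exact: mU.
  apply: (@le_trans _ _ ((expR (((size s)%:R - (size (i :: s'))%:R) * b) * expR u)%:E * (expR b)%:E)%E).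
    by rewrite lee_wpmul2l ?lee_fin//; exact: psib.
  rewrite -EFinM lee_fin le_eqVlt; apply/orP; left; apply/eqP.
  rewrite -!expRD; congr expR; rewrite /= -(natr1 (size s')); ring.
have H2 : (\int[P]_w (expR (\sum_(i <- s) psi (U i w)))%:E <= (expR ((size s)%:R * b))%:E)%E.
  move: H; rewrite /phi /= expR0 mul1r subr0.
  by under eq_integral do rewrite subrr mul0r expR0 mulr1.
have := @markov_le _ _ _ P (fun w => \sum_(i <- s) psi (U i w)) expR (expR a) (expR ((size s)%:R * b)) [set w | a <= \sum_(i <- s) psi (U i w)].
rewrite -expRN -expRD; apply => //.
- exact: (@measurable_psi_sum_ge (fun=> psi)).
- exact: (@measurable_psi_sum (fun=> psi)).
- exact: expR_gt0.
- by move=> w /=; rewrite ler_expR.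
Qed.

(** Chebyshev's bound; the potential is u^2 plus the variances of the terms still to be added. *)
Lemma sqr_chain (psi : I -> R -> R) (v : I -> R) s (a : R) :
  (forall b, measurable_fun setT (psi b)) ->
  all D s -> uniq s -> 0 < a -> (forall i, 0 <= v i) ->
  (forall i u, D i -> (\int[P]_w ((u + psi i (U i w)) ^+ 2)%:E <= (u ^+ 2 + v i)%:E)%E) ->
  (P [set w | (a <= `|\sum_(i <- s) psi i (U i w)|)%R] <= ((\sum_(i <- s) v i)%R / a ^+ 2)%:E)%E.
Proof.
move=> mpsi Ds us a0 v0 psiv.
pose phi (s' : seq I) (u : R) := u ^+ 2 + (\sum_(i <- s) v i - \sum_(i <- s') v i).
have mphi s' : measurable_fun setT (phi s').
  by apply: measurable_funD => //; exact: measurable_cst.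
have sfx s' : suffix s' s -> \sum_(b <- s') v b <= \sum_(b <- s) v b.
  by move=> /suffixP[s0 ->]; rewrite big_cat/= lerDr sumr_ge0.
have := @psi_chain psi phi s mpsi Ds us mphi.
move=> /(_ _)/wrap[|/(_ _)/wrap[|H]].
- by move=> s' u ?; rewrite addr_ge0 ?sqr_ge0// subr_ge0 sfx.
- move=> i s' u Di is'; rewrite /phi.
  have := sfx _ is'; rewrite -subr_ge0; set c := \sum_(i <- s) _ - _ => c0.
  have mi : measurable_fun setT (fun w => (u + psi i (U i w)) ^+ 2).
    apply: measurable_funX; apply: measurable_funD => //.
    by apply: measurableT_comp => //; exact: mU.
  under eq_integral do rewrite EFinD.
  rewrite ge0_integralD//; [|by move=> w _; rewrite lee_fin sqr_ge0|exact/measurable_EFinP].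
    rewrite probability_integral_cst; apply: (@le_trans _ _ ((u ^+ 2 + v i)%:E + c%:E)%E).
      by rewrite leeD2r//; exact: psiv.
    rewrite -EFinD lee_fin /c big_cons; lra.
have H2 : (\int[P]_w ((\sum_(i <- s) psi i (U i w)) ^+ 2)%:E <= (\sum_(i <- s) v i)%:E)%E.
  move: H; rewrite /phi /= big_nil expr0n /= add0r subr0.
  by under eq_integral do rewrite subrr addr0.
have mS := measurable_psi_sum mpsi Ds.
apply: (@markov_le _ _ _ P (fun w => \sum_(i <- s) psi i (U i w)) (fun x => x ^+ 2)) => //.
- rewrite -[X in measurable X]setTI; apply: measurable_fun_le => //.
  by apply: measurableT_comp.
- by move=> x; exact: sqr_ge0.
- exact: exprn_gt0.
- move=> w /= aw; rewrite -[leRHS]real_normK ?num_real//.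
  by apply: lerXn2r; rewrite ?nnegrE// ltW.
Qed.

End deviations.

(** * Deviations of sample means and sample variances *)

Section sample_deviations.
Context {R : realType}.

Lemma expRN_le_quadratic (z : R) : 0 <= z -> expR (- z) <= 1 - z + z ^+ 2.
Proof.
move=> z0; have h := expR_ge1Dx z; have e0 := expR_gt0 z.
rewrite expRN -[leLHS]mul1r ler_pdivrMr//.
have : 0 <= 1 - z + z ^+ 2 by nra.
have : (1 - z + z ^+ 2) * (1 + z) = 1 + z ^+ 3 by ring.
have : 0 <= z ^+ 3 by exact: exprn_ge0.
nra.
Qed.

Lemma quartic_expR_le (t0 x : R) : 0 < t0 -> x ^+ 4 <= 24 / t0 ^+ 4 * expR (t0 * `|x|).
Proof.
move=> t00; have := @expR_ge1Dxn R (t0 * `|x|) 3; rewrite (_ : 4`! = 24%N)// => h.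
have t40 : 0 < t0 ^+ 4 := exprn_gt0 4 t00.
have -> : x ^+ 4 = `|x| ^+ 4.
  by rewrite (exprM x 2 2) (exprM `|x| 2 2) real_normK ?num_real.
have := h (mulr_ge0 (ltW t00) (normr_ge0 _)).
rewrite exprMn => {}h.
rewrite -(ler_pM2l t40) (_ : t0 ^+ 4 * (24 / t0 ^+ 4 * _) = 24 * expR (t0 * `|x|)); last by field; rewrite gt_eqF.
lra.
Qed.

(** Bounds the fourth moment by the exponential moment, with 24 = 4!; the added 1 gives room to use
    it in an exponent. *)
Definition quartic_const (t0 K1 : R) : R := 24 / t0 ^+ 4 * K1 + 1.
Definition mgf_const (t0 K1 : R) : R := 1 / 2 + t0 / 2 * (48 / t0 ^+ 3) * K1.
(** Chosen so that h^2 [mgf_const] <= h / 2 for 0 <= h <= [mgf_rate], with h inside the range t0 / 2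
    where the moment generating function is controlled. *)
Definition mgf_rate (t0 K1 : R) : R := Num.min (1 / (2 * mgf_const t0 K1)) (t0 / 2).
Definition ss_rate (t0 K1 : R) : R := Num.min (1 / (16 * quartic_const t0 K1)) (mgf_rate t0 K1 / 4).

Variables (t0 K1 : R).
Hypotheses (t00 : 0 < t0) (K10 : 0 <= K1).

Lemma quartic_const_ge1 : 1 <= quartic_const t0 K1.
Proof. by rewrite /quartic_const lerDr mulr_ge0// divr_ge0// exprn_ge0// ltW. Qed.

Lemma mgf_const_ge : 1 / 2 <= mgf_const t0 K1.
Proof.
rewrite /mgf_const lerDl mulr_ge0// mulr_ge0//; first by rewrite divr_ge0// ltW.
by rewrite divr_ge0// exprn_ge0// ltW.
Qed.

Lemma mgf_rate_gt0 : 0 < mgf_rate t0 K1.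
Proof.
have := mgf_const_ge => h; rewrite lt_min; apply/andP; split; last by rewrite divr_gt0.
by rewrite divr_gt0//; lra.
Qed.

Lemma ss_rate_gt0 : 0 < ss_rate t0 K1.
Proof.
have := quartic_const_ge1 => h; rewrite lt_min; apply/andP; split.
  by rewrite divr_gt0//; lra.
by rewrite divr_gt0// mgf_rate_gt0.
Qed.

Context d (T : measurableType d) (P : probability T R).

(** Valid for every h >= 0, since exp(-h U^2) is bounded: expanding to second order involves the
    fourth moment only. This one-sidedness is what makes small sample variances exponentially
    unlikely. *)
Lemma mgf_neg_sqr_le (U : T -> R) h : std_rv P t0 K1 U -> 0 <= h ->
  (\int[P]_w (expR (- h * U w ^+ 2))%:E <= (expR (- h + h ^+ 2 * quartic_const t0 K1))%:E)%E.
Proof.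
move=> sU h0.
have q0 : 0 <= 24 / t0 ^+ 4 by rewrite divr_ge0// exprn_ge0// ltW.
have m1 : measurable_fun setT (fun x : R => expR (- h * x ^+ 2)).
  by apply: measurableT_comp => //; apply: measurable_funM => //; apply: measurable_funX.
have := @integral_std_le _ _ _ P t0 K1 U (fun x => expR (- h * x ^+ 2)) 1 0 (- h) (h ^+ 2 * (24 / t0 ^+ 4)) sU.
move=> /(_ _)/wrap[|/(_ m1 _)/wrap[|/(_ _)/wrap[|H]]].
- by rewrite mulr_ge0// sqr_ge0.
- by move=> x; exact: expR_ge0.
- move=> x; rewrite mulNr; apply: le_trans (expRN_le_quadratic _) _.
    by rewrite mulr_ge0// sqr_ge0.
  have := ler_wpM2l (sqr_ge0 h) (quartic_expR_le x t00); lra.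
apply: le_trans H _; rewrite lee_fin; apply: le_trans (expR_ge1Dx _).
rewrite /quartic_const; have := sqr_ge0 h; lra.
Qed.

Lemma mgf_le (U : T -> R) h : std_rv P t0 K1 U -> `|h| <= t0 / 2 ->
  (\int[P]_w (expR (h * U w))%:E <= (expR (h ^+ 2 * mgf_const t0 K1))%:E)%E.
Proof.
move=> sU ht; have h0 := normr_ge0 h.
have [C0 C0E] : exists C0, C0 = 48 / t0 ^+ 3 by eexists.
have C00 : 0 <= C0 by rewrite C0E divr_ge0// exprn_ge0// ltW.
have h30 : 0 <= `|h| ^+ 3 := exprn_ge0 3 h0.
have m1 : measurable_fun setT (fun x : R => expR (h * x)).
  by apply: measurableT_comp => //; apply: measurable_funM.
have := @integral_std_le _ _ _ P t0 K1 U (fun x => expR (h * x)) 1 h (h ^+ 2 / 2) (`|h| ^+ 3 * C0) sU.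
move=> /(_ _)/wrap[|/(_ m1 _)/wrap[|/(_ _)/wrap[|H]]].
- exact: mulr_ge0.
- by move=> x; exact: expR_ge0.
- move=> x; apply: le_trans (expR_cubic_le _) _.
  have := cube_expR_le x t00 ht; rewrite -C0E => /(ler_wpM2l h30).
  rewrite !normrM exprMn exprMn; lra.
apply: le_trans H _; rewrite lee_fin; apply: le_trans (expR_ge1Dx _).
rewrite /mgf_const -C0E -!addrA lerD2l.
have -> : h ^+ 2 * (1 / 2 + t0 / 2 * C0 * K1) = h ^+ 2 / 2 + h ^+ 2 * (t0 / 2) * C0 * K1 by ring.
rewrite lerD2l; apply: ler_wpM2r => //; apply: ler_wpM2r => //.
rewrite exprSr real_normK ?num_real// ler_wpM2l ?sqr_ge0//.
Qed.

Lemma second_moment_centered_sqr (U : T -> R) (u : R) : std_rv P t0 K1 U ->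
  (\int[P]_w ((u + (U w ^+ 2 - 1)) ^+ 2)%:E <= (u ^+ 2 + quartic_const t0 K1)%:E)%E.
Proof.
move=> sU.
have q0 : 0 <= 24 / t0 ^+ 4 by rewrite divr_ge0// exprn_ge0// ltW.
have m1 : measurable_fun setT (fun x : R => (u + (x ^+ 2 - 1)) ^+ 2).
  apply: measurable_funX; apply: measurable_funD => //; apply: measurable_funB => //.
have := @integral_std_le _ _ _ P t0 K1 U (fun x => (u + (x ^+ 2 - 1)) ^+ 2) ((u - 1) ^+ 2) 0 (2 * (u - 1)) (24 / t0 ^+ 4) sU q0 m1.
move=> /(_ _)/wrap[|/(_ _)/wrap[|H]].
- by move=> x; exact: sqr_ge0.
- by move=> x; have := quartic_expR_le x t00; lra.
apply: le_trans H _; rewrite lee_fin /quartic_const; lra.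
Qed.

Lemma second_moment_linear (U : T -> R) (u r : R) : std_rv P t0 K1 U ->
  (\int[P]_w ((u + r * U w) ^+ 2)%:E <= (u ^+ 2 + r ^+ 2)%:E)%E.
Proof.
move=> sU.
have m1 : measurable_fun setT (fun x : R => (u + r * x) ^+ 2).
  apply: measurable_funX; apply: measurable_funD => //; apply: measurable_funM => //.
have := @integral_std_le _ _ _ P t0 K1 U (fun x => (u + r * x) ^+ 2) (u ^+ 2) (2 * u * r) (r ^+ 2) 0 sU (lexx _) m1.
move=> /(_ _)/wrap[|/(_ _)/wrap[|H]].
- by move=> x; exact: sqr_ge0.
- move=> x; lra.
by apply: le_trans H _; rewrite mul0r addr0.
Qed.

Variables (I : choiceType) (D : pred I) (F : I -> set (set T)) (U : I -> T -> R).
Hypothesis ind : indep_family P D F.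
Hypothesis FU : forall b C, D b -> measurable C -> F b (U b @^-1` C).
Hypothesis sU : forall b, D b -> std_rv P t0 K1 (U b).

Definition sumsq (s : seq I) (w : T) : R :=
  \sum_(i <- s) U i w ^+ 2 - (\sum_(i <- s) U i w) ^+ 2 / (size s)%:R.

Lemma measurable_sumsq s : all D s -> measurable_fun setT (sumsq s).
Proof.
move=> Ds; apply: measurable_funB.
  apply: (@measurable_psi_sum _ _ _ P t0 K1 _ D _ sU (fun=> fun x => x ^+ 2)) => // _.
apply: measurable_funM => //; apply: measurable_funX.
by apply: (@measurable_psi_sum _ _ _ P t0 K1 _ D _ sU (fun=> fun x => x)) => // _.
Qed.

(** Chernoff with parameter of size a [mgf_rate]; the choice of the rate leaves half of the
    exponent. The sign [sg] serves both tails. *)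
Lemma linear_deviation s (sg a : R) : all D s -> uniq s -> 0 <= a <= 1 -> sg ^+ 2 = 1 ->
  (P [set w | ((size s)%:R * a * mgf_rate t0 K1 * a <= \sum_(i <- s) (sg * a * mgf_rate t0 K1) * U i w)%R]
   <= (expR (- ((size s)%:R * (a ^+ 2 * mgf_rate t0 K1 / 2))))%:E)%E.
Proof.
move=> Ds us /andP[a0 a1] sg2.
set k := mgf_rate t0 K1; have k0 : 0 < k := mgf_rate_gt0.
have k2 : k <= t0 / 2 by rewrite /k ge_min lexx orbT.
have km : k * mgf_const t0 K1 <= 1 / 2.
  have := mgf_const_ge => m0.
  have : k <= 1 / (2 * mgf_const t0 K1) by rewrite /k ge_min lexx.
  by rewrite ler_pdivlMr; lra.
set h := sg * a * k.
have hE : h ^+ 2 = a ^+ 2 * k ^+ 2 by rewrite /h !exprMn sg2 mul1r.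
have mh : measurable_fun setT (fun x : R => h * x) by apply: measurable_funM.
have ht : `|h| <= t0 / 2.
  have sg1 : `|sg| = 1 by apply/eqP; rewrite -sqrp_eq1// real_normK ?num_real// sg2.
  by rewrite /h !normrM sg1 mul1r (ger0_norm a0) (gtr0_norm k0); nra.
have := @expR_chain _ _ _ P t0 K1 I D F U ind FU sU (fun x => h * x) (h ^+ 2 * mgf_const t0 K1) s ((size s)%:R * a * k * a) mh Ds us.
move=> /(_ _)/wrap[|H].
  by move=> i Di; apply: mgf_le => //; exact: sU.
apply: le_trans H _; rewrite lee_fin ler_expR hE.
have : 0 <= (size s)%:R * (a ^+ 2 * k) * (1 / 2 - k * mgf_const t0 K1).
  rewrite mulr_ge0//; last by lra.
  by rewrite mulr_ge0// mulr_ge0 ?sqr_ge0// ltW.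
lra.
Qed.

(** The deficit N e is split in two: either the raw sum of squares falls short by N e / 2, or the
    squared mean removes that much, in which case the sum is large with one of two signs. Each of
    the three events has a Chernoff bound. *)
Lemma sumsq_lower_deviation s (e : R) : all D s -> uniq s -> (0 < size s)%N -> 0 < e <= 1 ->
  (P [set w | (sumsq s w <= (size s)%:R * (1 - e))%R]
   <= (3 * expR (- (ss_rate t0 K1 * (size s)%:R * e ^+ 2)))%:E)%E.
Proof.
move=> Ds us s0 /andP[e0 e1].
set N : R := (size s)%:R; have N0 : 0 < N by rewrite ltr0n.
set C := quartic_const t0 K1; have C1 : 1 <= C := quartic_const_ge1.
set k := mgf_rate t0 K1; have k0 : 0 < k := mgf_rate_gt0.
have r1 : ss_rate t0 K1 * (16 * C) <= 1.
  by rewrite -ler_pdivlMr; [rewrite /ss_rate ge_min lexx|lra].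
have r2 : ss_rate t0 K1 <= k / 4 by rewrite /ss_rate ge_min lexx orbT.
(* A sum of size N a is exactly what makes the mean correction equal to N e / 2. *)
pose a := Num.sqrt (e / 2); have a2 : a ^+ 2 = e / 2 by rewrite sqr_sqrtr// divr_ge0// ltW.
have a0 : 0 < a by rewrite sqrtr_gt0 divr_gt0.
have a1 : a <= 1 by nra.
(* The minimizer of h^2 C - h e / 2, with value -e^2 / (16 C); this explains the 16 in [ss_rate]. *)
pose h := e / (4 * C); have h0 : 0 < h by rewrite divr_gt0//; lra.
have hC : h * C = e / 4 by rewrite /h; field; rewrite gt_eqF//; lra.
pose A1 := [set w | - h * (N * (1 - e / 2)) <= \sum_(i <- s) (- h * U i w ^+ 2)].
pose A2 sg := [set w | N * a * k * a <= \sum_(i <- s) (sg * a * k) * U i w].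
have mh : measurable_fun setT (fun x : R => - h * x ^+ 2) by apply: measurable_funM => //; apply: measurable_funX.
have mA1 : measurable A1.
  exact: (@measurable_psi_sum_ge _ _ _ P t0 K1 _ D _ sU (fun=> fun x => - h * x ^+ 2)).
have mA2 sg : measurable (A2 sg).
  apply: (@measurable_psi_sum_ge _ _ _ P t0 K1 _ D _ sU (fun=> fun x => sg * a * k * x)) => // _.
  exact: measurable_funM.
have PA1 : (P A1 <= (expR (- (ss_rate t0 K1 * N * e ^+ 2)))%:E)%E.
  have := @expR_chain _ _ _ P t0 K1 I D F U ind FU sU (fun x => - h * x ^+ 2) (- h + h ^+ 2 * C) s (- h * (N * (1 - e / 2))) mh Ds us.
  move=> /(_ _)/wrap[|H].
    by move=> i Di; apply: mgf_neg_sqr_le; [exact: sU|exact: ltW].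
  apply: le_trans H _; rewrite lee_fin ler_expR -/N.
  rewrite (_ : N * (- h + h ^+ 2 * C) - _ = N * (h * (h * C) - h * e / 2)); last by ring.
  rewrite hC.
  have : ss_rate t0 K1 * e <= h / 4.
    rewrite /h -mulrA -invfM ler_pdivlMr; last by lra.
    have := ler_wpM2r (ltW e0) r1; lra.
  move=> /(ler_wpM2r (ltW e0)) H2; have := ler_wpM2l (ltW N0) H2; lra.
have PA2 (g : R) : g ^+ 2 = 1 -> (P (A2 g) <= (expR (- (ss_rate t0 K1 * N * e ^+ 2)))%:E)%E.
  move=> sg2; apply: le_trans (linear_deviation Ds us _ sg2) _; first by rewrite (ltW a0).
  rewrite lee_fin ler_expR lerN2 -/k -/N a2.
  have H1 : ss_rate t0 K1 * e ^+ 2 <= k / 4 * e.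
    apply: ler_pM => //; [exact: ltW ss_rate_gt0|exact: sqr_ge0|].
    by rewrite expr2 ler_piMl// ltW.
  have := ler_wpM2l (ltW N0) H1; lra.
have mE : measurable [set w | sumsq s w <= N * (1 - e)].
  rewrite -[X in measurable X]setTI; apply: measurable_fun_le => //.
  exact: measurable_sumsq.
have PA23 : (P (A2 1%R `|` A2 (-1)%R) <= (expR (- (ss_rate t0 K1 * N * e ^+ 2)) + expR (- (ss_rate t0 K1 * N * e ^+ 2)))%:E)%E.
  apply: (probability_le_add _ (mA2 1%R) (mA2 (-1)%R)) => //.
  - exact: measurableU.
  - by apply: PA2; rewrite expr1n.
  - by apply: PA2; rewrite sqrrN expr1n.
rewrite (_ : 3 * _ = expR (- (ss_rate t0 K1 * N * e ^+ 2)) + (expR (- (ss_rate t0 K1 * N * e ^+ 2)) + expR (- (ss_rate t0 K1 * N * e ^+ 2)))); last by ring.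
apply: (probability_le_add mE mA1 _ _ PA1 PA23); first exact: measurableU.
move=> w /=; rewrite /sumsq -/N => H.
have [L1|L1] := leP (\sum_(i <- s) U i w ^+ 2) (N * (1 - e / 2)).
  left; rewrite /A1 /= -mulr_sumr; nra.
right; have H2 : N * (e / 2) <= (\sum_(i <- s) U i w) ^+ 2 / N by lra.
have H3 : (N * a) ^+ 2 <= (\sum_(i <- s) U i w) ^+ 2.
  move: H2; rewrite ler_pdivlMr// exprMn a2; lra.
have : N * a <= `|\sum_(i <- s) U i w|.
  rewrite -(@ler_pXn2r _ 2) ?nnegrE ?mulr_ge0 ?(ltW a0) ?(ltW N0)//.
  by rewrite real_normK ?num_real.
have ak : 0 <= a * k by rewrite mulr_ge0 ?ltW.
rewrite /A2 /= -!mulr_sumr.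
have [S0|S0] := leP 0 (\sum_(i <- s) U i w).
  by rewrite (ger0_norm S0) => H4; left; have := ler_wpM2l ak H4; lra.
by rewrite (ltr0_norm S0) => H4; right; have := ler_wpM2l ak H4; lra.
Qed.

(** U^2 need not have exponential moments, so Chebyshev is used; removing the squared mean only
    decreases the statistic. *)
Lemma sumsq_upper_deviation s (e : R) : all D s -> uniq s -> (0 < size s)%N -> 0 < e ->
  (P [set w | ((size s)%:R * (1 + e) <= sumsq s w)%R]
   <= (quartic_const t0 K1 / ((size s)%:R * e ^+ 2))%:E)%E.
Proof.
move=> Ds us s0 e0.
set N : R := (size s)%:R; have N0 : 0 < N by rewrite ltr0n.
have C1 := quartic_const_ge1.
have mp : measurable_fun setT (fun x : R => x ^+ 2 - 1) by apply: measurable_funB.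
have mS : measurable_fun setT (fun w => \sum_(i <- s) (U i w ^+ 2 - 1)).
  exact: (@measurable_psi_sum _ _ _ P t0 K1 _ D _ sU (fun=> fun x => x ^+ 2 - 1)).
have Ne0 : 0 < N * e by exact: mulr_gt0.
have := @sqr_chain _ _ _ P t0 K1 I D F U ind FU sU (fun=> fun x => x ^+ 2 - 1) (fun=> quartic_const t0 K1) s (N * e) (fun=> mp) Ds us Ne0.
move=> /(_ _)/wrap[|/(_ _)/wrap[|H]].
- by move=> _; lra.
- by move=> i u Di; apply: second_moment_centered_sqr; exact: sU.
apply: (@le_trans _ _ (P [set w | (N * e <= `|\sum_(i <- s) (U i w ^+ 2 - 1)|)%R])).
  apply: le_measure; rewrite ?inE.
  - rewrite -[X in measurable X]setTI; apply: measurable_fun_le => //.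
    exact: measurable_sumsq.
  - rewrite -[X in measurable X]setTI; apply: measurable_fun_le => //.
    exact: measurableT_comp.
  - move=> w /=; rewrite /sumsq -/N => h.
    apply: le_trans (ler_norm _); rewrite sumrB (big_const_seq _ _ _ _ (1 : R)) count_predT iter_addr_0 -/N.
    have : 0 <= (\sum_(i <- s) U i w) ^+ 2 / N by rewrite divr_ge0 ?sqr_ge0// ltW.
    lra.
apply: le_trans H _; rewrite lee_fin (big_const_seq _ _ _ _ (quartic_const t0 K1)) count_predT iter_addr_0.
rewrite -mulr_natr -/N le_eqVlt; apply/orP; left; apply/eqP; field.
by rewrite !gt_eqF.
Qed.

Lemma weighted_deviation (r : I -> R) s (a : R) : all D s -> uniq s -> 0 < a ->
  (P [set w | (a <= `|\sum_(i <- s) r i * U i w|)%R] <= ((\sum_(i <- s) r i ^+ 2)%R / a ^+ 2)%:E)%E.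
Proof.
move=> Ds us a0.
apply: (@sqr_chain _ _ _ P t0 K1 I D F U ind FU sU (fun i x => r i * x) (fun i => r i ^+ 2)) => //.
- by move=> b; apply: measurable_funM.
- by move=> i; exact: sqr_ge0.
- by move=> i u Di; apply: second_moment_linear; exact: sU.
Qed.

End sample_deviations.

(** * Algebra of the two-sample statistic *)

Section tstat_bounds.
Context {R : realType}.
Implicit Types (n : nat) (u : nat -> R).

Definition csq n u : R := \sum_(k < n) u k ^+ 2 - (\sum_(k < n) u k) ^+ 2 / n%:R.

Lemma smean_affine n (mu s : R) u : (0 < n)%N ->
  smean n (fun k => mu + s * u k) = mu + s * (\sum_(k < n) u k) / n%:R.
Proof.
move=> n0; rewrite /smean big_split/= sumr_const card_ord -mulr_sumr mulrDl.
by rewrite -[mu *+ n]mulr_natr mulfK// pnatr_eq0 -lt0n.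
Qed.

Lemma centered_sum_affine n (mu s : R) u : (0 < n)%N ->
  \sum_(k < n) ((mu + s * u k) - smean n (fun k => mu + s * u k)) ^+ 2 = s ^+ 2 * csq n u.
Proof.
move=> n0; have nn : n%:R != 0 :> R by rewrite pnatr_eq0 -lt0n.
set b := (\sum_(k < n) u k) / n%:R.
rewrite (eq_bigr (fun k : 'I_n => s ^+ 2 * (u k ^+ 2 + (- 2 * b) * u k + b ^+ 2))); last first.
  by move=> k _; rewrite smean_affine// /b; ring.
rewrite -mulr_sumr big_split/= big_split/= -mulr_sumr sumr_const card_ord -[(_ ^+ 2) *+ n]mulr_natr /csq /b.
by field.
Qed.

(* The squared denominator of the statistic, from the two centered sums of squares. *)
Definition tvar (pooled : bool) n1 n2 (A1 A2 : R) : R :=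
  if pooled then (A1 + A2) / (n1%:R + n2%:R - 2) * (n1%:R^-1 + n2%:R^-1)
  else A1 / (n1%:R - 1) / n1%:R + A2 / (n2%:R - 1) / n2%:R.

Lemma tstatE pooled n1 n2 (x : nat -> nat -> nat -> R) i :
  (1 < n1)%N -> (1 < n2)%N ->
  let A1 := \sum_(k < n1) (x 1%N k i - smean n1 (fun k => x 1%N k i)) ^+ 2 in
  let A2 := \sum_(k < n2) (x 2%N k i - smean n2 (fun k => x 2%N k i)) ^+ 2 in
  tstat pooled n1 n2 x i =
  (smean n1 (fun k => x 1%N k i) - smean n2 (fun k => x 2%N k i)) / Num.sqrt (tvar pooled n1 n2 A1 A2).
Proof.
move=> n1g n2g A1 A2; rewrite /tstat /tvar /svar; case: pooled; last by [].
rewrite -/A1 -/A2 mulrC; congr (_ * _).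
have n11 : 1 < n1%:R :> R by rewrite ltr1n.
have n21 : 1 < n2%:R :> R by rewrite ltr1n.
have A10 : 0 <= A1 by apply: sumr_ge0 => k _; exact: sqr_ge0.
have A20 : 0 <= A2 by apply: sumr_ge0 => k _; exact: sqr_ge0.
rewrite -sqrtrV; last first.
  apply: mulr_ge0; first by apply: divr_ge0; [exact: addr_ge0|lra].
  by rewrite addr_ge0// invr_ge0; lra.
congr Num.sqrt; rewrite -invf_div; congr (_^-1).
set sp := (A1 + A2) / _.
by field; rewrite !gt_eqF//; lra.
Qed.

Variables (pooled : bool) (n1 n2 : nat) (x : nat -> nat -> nat -> R) (i : nat).
Variables (mu1 mu2 s1 s2 : R) (u1 u2 : nat -> R) (e : R).
Hypotheses (n1g : (1 < n1)%N) (n2g : (1 < n2)%N) (s10 : 0 < s1) (s20 : 0 < s2).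
Hypothesis pool : pooled -> s1 = s2.
Hypothesis x1E : forall k, x 1%N k i = mu1 + s1 * u1 k.
Hypothesis x2E : forall k, x 2%N k i = mu2 + - s2 * u2 k.

Let n11 : 1 < n1%:R :> R. Proof. by rewrite ltr1n. Qed.
Let n21 : 1 < n2%:R :> R. Proof. by rewrite ltr1n. Qed.
Ltac nlra := have := n11; have := n21; lra.
Let D2 : R := s1 ^+ 2 / n1%:R + s2 ^+ 2 / n2%:R.
(** The minus sign in [x2E] makes the noise a combination of all residuals with nonnegative weights,
    as [cramer_upper] requires. *)
Let W : R := (s1 / n1%:R * (\sum_(k < n1) u1 k) + s2 / n2%:R * (\sum_(k < n2) u2 k)) / Num.sqrt D2.
Let g : R := (mu1 - mu2) / Num.sqrt D2.
Let T := tstat pooled n1 n2 x i.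
Let V := tvar pooled n1 n2 (s1 ^+ 2 * csq n1 u1) (s2 ^+ 2 * csq n2 u2).

Let D20 : 0 < D2.
Proof. by rewrite addr_gt0// divr_gt0 ?exprn_gt0//; nlra. Qed.

Let TE : T = Num.sqrt D2 * (g + W) / Num.sqrt V.
Proof.
have x1f : (fun k => x 1%N k i) = (fun k => mu1 + s1 * u1 k) by exact/funext.
have x2f : (fun k => x 2%N k i) = (fun k => mu2 + - s2 * u2 k) by exact/funext.
have n1p : (0 < n1)%N := ltnW n1g; have n2p : (0 < n2)%N := ltnW n2g.
have H1 : \sum_(k < n1) (x 1%N k i - smean n1 (fun k => x 1%N k i)) ^+ 2 = s1 ^+ 2 * csq n1 u1.
  by rewrite x1f -(centered_sum_affine mu1)//; apply: eq_bigr => k _; rewrite x1E.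
have H2 : \sum_(k < n2) (x 2%N k i - smean n2 (fun k => x 2%N k i)) ^+ 2 = s2 ^+ 2 * csq n2 u2.
  by rewrite x2f -(sqrrN s2) -(centered_sum_affine mu2)//; apply: eq_bigr => k _; rewrite x2E.
rewrite /T tstatE// H1 H2 -/V x1f x2f !smean_affine//; congr (_ / _).
have sD : Num.sqrt D2 != 0 by rewrite sqrtr_eq0 -ltNge.
by rewrite /g /W; field; rewrite sD !gt_eqF//; nlra.
Qed.

(** Centered sums equal to c times their expectations give c times the true variance of the
    difference of means, for both versions of the statistic; in the pooled one this is where the
    equality of variances enters. Monotonicity of [tvar] then turns bounds on the sums into bounds
    on the denominator. *)
Let VD (c : R) : c * D2 = tvar pooled n1 n2 (s1 ^+ 2 * ((n1%:R - 1) * c)) (s2 ^+ 2 * ((n2%:R - 1) * c)).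
Proof.
rewrite /tvar /D2; case: ifP => [/pool <-|_]; last by field; rewrite !gt_eqF//; nlra.
by field; rewrite !gt_eqF//; nlra.
Qed.

Let tvar_le A1 A2 B1 B2 : A1 <= B1 -> A2 <= B2 -> tvar pooled n1 n2 A1 A2 <= tvar pooled n1 n2 B1 B2.
Proof.
move=> h1 h2; have i1 : 0 <= n1%:R^-1 :> R by [].
have i2 : 0 <= n2%:R^-1 :> R by [].
have j1 : 0 <= (n1%:R - 1)^-1 :> R by rewrite invr_ge0; nlra.
have j2 : 0 <= (n2%:R - 1)^-1 :> R by rewrite invr_ge0; nlra.
rewrite /tvar; case: ifP => _; last by apply: lerD; do 2 apply: ler_wpM2r => //.
apply: ler_wpM2r; first exact: addr_ge0.
by apply: ler_wpM2r; [rewrite invr_ge0; nlra|exact: lerD].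
Qed.

Let V_ge : (n1%:R - 1) * (1 - e) <= csq n1 u1 -> (n2%:R - 1) * (1 - e) <= csq n2 u2 ->
  (1 - e) * D2 <= V.
Proof.
by move=> h1 h2; rewrite VD; apply: tvar_le; rewrite ler_wpM2l ?sqr_ge0.
Qed.

Lemma tstat_upper : e < 1 ->
  (n1%:R - 1) * (1 - e) <= csq n1 u1 -> (n2%:R - 1) * (1 - e) <= csq n2 u2 ->
  T ^+ 2 * (1 - e) <= (g + W) ^+ 2.
Proof.
move=> e1 h1 h2; have hV := V_ge h1 h2.
have e10 : 0 < 1 - e by nlra.
have V0 : 0 < V by apply: lt_le_trans hV; rewrite mulr_gt0.
rewrite TE !exprMn exprVn !sqr_sqrtr ?(ltW D20) ?(ltW V0)//.
rewrite (_ : _ * (1 - e) = (g + W) ^+ 2 * ((1 - e) * D2) / V); last by ring.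
rewrite ler_pdivrMr//.
by rewrite ler_wpM2l// sqr_ge0.
Qed.

Lemma tstat_lower : e < 1 ->
  (n1%:R - 1) * (1 - e) <= csq n1 u1 -> (n2%:R - 1) * (1 - e) <= csq n2 u2 ->
  csq n1 u1 <= (n1%:R - 1) * (1 + e) -> csq n2 u2 <= (n2%:R - 1) * (1 + e) ->
  (g + W) ^+ 2 <= T ^+ 2 * (1 + e).
Proof.
move=> e1 h1 h2 h3 h4; have hV := V_ge h1 h2.
have e10 : 0 < 1 - e by nlra.
have V0 : 0 < V by apply: lt_le_trans hV; rewrite mulr_gt0.
have hV2 : V <= (1 + e) * D2 by rewrite VD; apply: tvar_le; rewrite ler_wpM2l ?sqr_ge0.
rewrite TE !exprMn exprVn !sqr_sqrtr ?(ltW D20) ?(ltW V0)//.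
rewrite (_ : _ * (1 + e) = (g + W) ^+ 2 * ((1 + e) * D2) / V); last by ring.
rewrite ler_pdivlMr//.
by rewrite ler_wpM2l// sqr_ge0.
Qed.

End tstat_bounds.

(** Stated for an arbitrary measurable structure, since it is also applied to the sigma-algebra
    generated by the coordinates of a single test. *)
Lemma measurable_tstat d (T : measurableType d) (R : realType) (pooled : bool) (n1 n2 : nat)
    (x : nat -> nat -> nat -> T -> R) i :
  (forall k, (k < n1)%N -> measurable_fun setT (x 1%N k i)) ->
  (forall k, (k < n2)%N -> measurable_fun setT (x 2%N k i)) ->
  measurable_fun setT (fun w => tstat pooled n1 n2 (fun j k i => x j k i w) i).
Proof.
move=> m1 m2.
have mm n j : (forall k, (k < n)%N -> measurable_fun setT (x j k i)) ->
    measurable_fun setT (fun w => smean n (fun k => x j k i w)).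
  move=> mj; apply: measurable_funM => //; apply: measurable_sum => k; exact: mj.
have mq n j : (forall k, (k < n)%N -> measurable_fun setT (x j k i)) ->
    measurable_fun setT (fun w => \sum_(k < n) (x j k i w - smean n (fun k => x j k i w)) ^+ 2).
  move=> mj; apply: measurable_sum => k; apply: measurable_funX; apply: measurable_funB; [exact: mj|exact: mm].
have mV (f : T -> R) : measurable_fun setT f -> measurable_fun setT (fun w => (f w)^-1).
  move=> mf; have -> : (fun w => (f w)^-1) = (fun w => f w * expR (- ln (f w ^+ 2))).
    apply/funext => w; have [->|f0] := eqVneq (f w) 0; first by rewrite invr0 mul0r.
    have f2 : 0 < f w ^+ 2 by rewrite exprn_even_gt0.
    by rewrite expRN lnK// expr2 invfM mulrA divff// mul1r.
  apply: measurable_funM => //; apply: (measurableT_comp (f := expR)) => //.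
  apply: measurable_funN; apply: (measurableT_comp (f := @ln R)); first exact: measurable_ln.
  exact: measurable_funX.
have msq (f : T -> R) : measurable_fun setT f -> measurable_fun setT (fun w => Num.sqrt (f w)).
  have h : measurable_fun setT (Num.sqrt : R -> R).
    by apply: continuous_measurable_fun; exact: sqrt_continuous.
  by move=> mf; exact: (measurableT_comp h mf).
rewrite /tstat; case: pooled.
  apply: measurable_funM; last by apply: measurable_funB; exact: mm.
  apply: msq; apply: measurable_funM => //; apply: mV; apply: measurable_funM => //.
  apply: measurable_funM => //; apply: measurable_funD; exact: mq.
apply: measurable_funM; first by apply: measurable_funB; exact: mm.
apply: mV; apply: msq; rewrite /svar.
by apply: measurable_funD; apply: measurable_funM => //; apply: measurable_funM => //; exact: mq.
Qed.

(** * Tail bounds for a single test at fixed sample sizes *)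

Section one_test.
Context {R : realType} d (T : measurableType d) (P : probability T R).
Variables (t0 K1 : R).
Hypotheses (t00 : 0 < t0) (K10 : 0 <= K1).
Variables (n1 n2 : nat).

Definition sample_pred : pred (nat * nat) :=
  fun a => ((a.1 == 1%N) && (a.2 < n1)%N) || ((a.1 == 2%N) && (a.2 < n2)%N).

Variables (F : nat * nat -> set (set T)) (U : nat * nat -> T -> R).
Hypothesis ind : indep_family P sample_pred F.
Hypothesis FU : forall b C, sample_pred b -> measurable C -> F b (U b @^-1` C).
Hypothesis sU : forall b, sample_pred b -> std_rv P t0 K1 (U b).
Hypotheses (n1g : (1 < n1)%N) (n2g : (1 < n2)%N).

Definition sample_seq (j n : nat) : seq (nat * nat) := [seq (j, k) | k <- iota 0 n].

Let size_sample j n : size (sample_seq j n) = n.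
Proof. by rewrite size_map size_iota. Qed.

Lemma big_sample j n (f : nat * nat -> R) : \sum_(a <- sample_seq j n) f a = \sum_(k < n) f (j, val k).
Proof. by rewrite big_map -[X in iota 0 X]subn0 -/(index_iota 0 n) big_mkord. Qed.

Let uniq_sample j n : uniq (sample_seq j n).
Proof. by rewrite map_inj_uniq ?iota_uniq// => k k' []. Qed.

Let all1 : all sample_pred (sample_seq 1 n1).
Proof. by apply/allP => a /mapP[k]; rewrite mem_iota => /andP[_ kn] ->; rewrite /sample_pred/= kn. Qed.

Let all2 : all sample_pred (sample_seq 2 n2).
Proof. by apply/allP => a /mapP[k]; rewrite mem_iota => /andP[_ kn] ->; rewrite /sample_pred/= kn. Qed.

Let all12 : all sample_pred (sample_seq 1 n1 ++ sample_seq 2 n2).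
Proof. by rewrite all_cat all1 all2. Qed.

Let uniq12 : uniq (sample_seq 1 n1 ++ sample_seq 2 n2).
Proof.
rewrite cat_uniq !uniq_sample andbT/=; apply/hasPn => a /mapP[k _ ->].
by apply/negP => /mapP[k' _ []].
Qed.

Let nmin := minn n1 n2.
Let n11 : 1 < n1%:R :> R. Proof. by rewrite ltr1n. Qed.
Let n21 : 1 < n2%:R :> R. Proof. by rewrite ltr1n. Qed.
Let nm1 : nmin%:R <= n1%:R :> R. Proof. by rewrite ler_nat geq_minl. Qed.
Let nm2 : nmin%:R <= n2%:R :> R. Proof. by rewrite ler_nat geq_minr. Qed.
Let nm0 : 1 < nmin%:R :> R. Proof. by rewrite ltr1n leq_min n1g. Qed.

Variables (mu1 mu2 s1 s2 : R).
Hypotheses (s10 : 0 < s1) (s20 : 0 < s2).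
Variable (pooled : bool) (i : nat) (x : nat -> nat -> nat -> T -> R).
Hypothesis pool : pooled -> s1 = s2.
Hypothesis x1E : forall k w, x 1%N k i w = mu1 + s1 * U (1%N, k) w.
Hypothesis x2E : forall k w, x 2%N k i w = mu2 + - s2 * U (2%N, k) w.

Let D2 : R := s1 ^+ 2 / n1%:R + s2 ^+ 2 / n2%:R.
Let r (a : nat * nat) : R := (if a.1 == 1%N then s1 / n1%:R else s2 / n2%:R) / Num.sqrt D2.
Let W (w : T) : R := \sum_(a <- sample_seq 1 n1 ++ sample_seq 2 n2) r a * U a w.
Let g : R := (mu1 - mu2) / Num.sqrt D2.
Let Tst (w : T) : R := tstat pooled n1 n2 (fun j k i => x j k i w) i.
Let lowbad (e : R) := [set w | sumsq U (sample_seq 1 n1) w <= n1%:R * (1 - e)] `|`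
  [set w | sumsq U (sample_seq 2 n2) w <= n2%:R * (1 - e)].
Let highbad (e : R) := [set w | n1%:R * (1 + e) <= sumsq U (sample_seq 1 n1) w] `|`
  [set w | n2%:R * (1 + e) <= sumsq U (sample_seq 2 n2) w].

Let D20 : 0 < D2.
Proof. by rewrite addr_gt0// divr_gt0 ?exprn_gt0// (lt_trans ltr01). Qed.

(** The variance D2 of the difference of means is at least the contribution s^2 / n of the sample in
    question, so a weight (s / n) / sqrt(D2) is at most n^(-1/2). *)
Let r_bound a : sample_pred a -> 0 <= r a <= (Num.sqrt nmin%:R)^-1.
Proof.
move=> _; have sD : 0 < Num.sqrt D2 by rewrite sqrtr_gt0.
have rb (s : R) n : 0 < s -> 1 < n%:R :> R -> nmin%:R <= n%:R :> R -> s ^+ 2 / n%:R <= D2 ->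
    0 <= s / n%:R / Num.sqrt D2 <= (Num.sqrt nmin%:R)^-1.
  move=> ss nn nm sn; have n0 : 0 < n%:R :> R by lra.
  have q0 : 0 < Num.sqrt nmin%:R :> R by rewrite sqrtr_gt0; have := nm0; lra.
  rewrite !divr_ge0 ?(ltW ss) ?(ltW sD)//= ler_pdivrMr// ler_pdivlMl//.
  rewrite -(@ler_pXn2r _ 2) ?nnegrE ?(ltW sD)//; last first.
    by rewrite mulr_ge0 ?(ltW q0)// divr_ge0// ltW.
  rewrite exprMn !sqr_sqrtr ?(ltW D20)//; apply: le_trans sn.
  rewrite exprMn exprVn (_ : n%:R ^+ 2 = n%:R * n%:R) // invfM mulrCA.
  rewrite ler_wpM2l ?sqr_ge0// mulrA -[leRHS]mul1r ler_wpM2r ?invr_ge0 ?(ltW n0)//.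
  by rewrite ler_pdivrMr// mul1r.
rewrite /r; case: ifP => _; apply: rb => //.
  by rewrite lerDl divr_ge0 ?sqr_ge0//.
by rewrite lerDr divr_ge0 ?sqr_ge0//.
Qed.

Let r_sum : \sum_(a <- sample_seq 1 n1 ++ sample_seq 2 n2) r a ^+ 2 = 1.
Proof.
rewrite big_cat/= !big_sample /r /= !sumr_const !card_ord -[_ *+ n1]mulr_natr -[_ *+ n2]mulr_natr.
have E (c : R) : (c / Num.sqrt D2) ^+ 2 = c ^+ 2 / D2 by rewrite expr_div_n sqr_sqrtr// ltW.
rewrite !E.
have h1 := n11; have h2 := n21; have h3 := D20.
transitivity ((s1 ^+ 2 / n1%:R + s2 ^+ 2 / n2%:R) / D2); last by rewrite divff// gt_eqF.
by move: D2 h3 => D h3; field; rewrite !gt_eqF//; lra.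
Qed.

Let WE w : W w = (s1 / n1%:R * (\sum_(k < n1) U (1%N, val k) w) + s2 / n2%:R * (\sum_(k < n2) U (2%N, val k) w)) / Num.sqrt D2.
Proof.
rewrite /W big_cat/= !big_sample /r /= mulrDl; congr (_ + _).
  by rewrite -mulr_sumr; ring.
by rewrite -mulr_sumr; ring.
Qed.

Let sumsqE j n w : sumsq U (sample_seq j n) w = csq n (fun k => U (j, k) w).
Proof. by rewrite /sumsq !big_sample size_sample. Qed.

Let lowbad_prob e : 0 < e <= 1 ->
  (P (lowbad e) <= (6 * expR (- (ss_rate t0 K1 * nmin%:R * e ^+ 2)))%:E)%E.
Proof.
move=> e01; have rt := ss_rate_gt0 t00 K10.
have b n : nmin%:R <= n%:R :> R -> 3 * expR (- (ss_rate t0 K1 * n%:R * e ^+ 2)) <= 3 * expR (- (ss_rate t0 K1 * nmin%:R * e ^+ 2)).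
  by move=> h; rewrite ler_pM2l// ler_expR lerN2 ler_wpM2r ?sqr_ge0// ler_pM2l.
have mm j n : all sample_pred (sample_seq j n) -> measurable [set w | sumsq U (sample_seq j n) w <= n%:R * (1 - e)].
  move=> aj; rewrite -[X in measurable X]setTI; apply: measurable_fun_le => //.
  exact: (measurable_sumsq sU).
rewrite (_ : 6 * _ = 3 * expR (- (ss_rate t0 K1 * nmin%:R * e ^+ 2)) + 3 * expR (- (ss_rate t0 K1 * nmin%:R * e ^+ 2))); last by ring.
apply: (probability_le_add _ (mm _ _ all1) (mm _ _ all2)) => //.
- by apply: measurableU; exact: mm.
- have := @sumsq_lower_deviation _ t0 K1 t00 K10 d T P _ _ F U ind FU sU (sample_seq 1 n1) e all1 (uniq_sample _ _).
  rewrite size_sample => /(_ (ltnW n1g) e01) h; apply: le_trans h _.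
  by rewrite lee_fin; exact: b.
- have := @sumsq_lower_deviation _ t0 K1 t00 K10 d T P _ _ F U ind FU sU (sample_seq 2 n2) e all2 (uniq_sample _ _).
  rewrite size_sample => /(_ (ltnW n2g) e01) h; apply: le_trans h _.
  by rewrite lee_fin; exact: b.
Qed.

Let highbad_prob e : 0 < e ->
  (P (highbad e) <= (2 * (quartic_const t0 K1 / (nmin%:R * e ^+ 2)))%:E)%E.
Proof.
move=> e0; have C1 := quartic_const_ge1 t00 K10.
have e20 : 0 < e ^+ 2 := exprn_gt0 2 e0.
have b n : nmin%:R <= n%:R :> R -> quartic_const t0 K1 / (n%:R * e ^+ 2) <= quartic_const t0 K1 / (nmin%:R * e ^+ 2).
  move=> h; have h0 := nm0; apply: ler_wpM2l; first by lra.
  have a1 : 0 < nmin%:R * e ^+ 2 by apply: mulr_gt0 => //; lra.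
  have a2 : 0 < n%:R * e ^+ 2 by apply: mulr_gt0 => //; lra.
  by rewrite lef_pV2 ?posrE// ler_wpM2r// ltW.
have mm j n : all sample_pred (sample_seq j n) -> measurable [set w | n%:R * (1 + e) <= sumsq U (sample_seq j n) w].
  move=> aj; rewrite -[X in measurable X]setTI; apply: measurable_fun_le => //.
  exact: (measurable_sumsq sU).
rewrite (_ : 2 * _ = quartic_const t0 K1 / (nmin%:R * e ^+ 2) + quartic_const t0 K1 / (nmin%:R * e ^+ 2)); last by ring.
apply: (probability_le_add _ (mm _ _ all1) (mm _ _ all2)) => //.
- by apply: measurableU; exact: mm.
- have := @sumsq_upper_deviation _ t0 K1 t00 K10 d T P _ _ F U ind FU sU (sample_seq 1 n1) e all1 (uniq_sample _ _).
  rewrite size_sample => /(_ (ltnW n1g) e0) h; apply: le_trans h _.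
  by rewrite lee_fin; exact: b.
- have := @sumsq_upper_deviation _ t0 K1 t00 K10 d T P _ _ F U ind FU sU (sample_seq 2 n2) e all2 (uniq_sample _ _).
  rewrite size_sample => /(_ (ltnW n2g) e0) h; apply: le_trans h _.
  by rewrite lee_fin; exact: b.
Qed.

Let m_low e : measurable (lowbad e).
Proof.
apply: measurableU; (rewrite -[X in measurable X]setTI; apply: measurable_fun_le => //);
  exact: (measurable_sumsq sU).
Qed.

Let m_high e : measurable (highbad e).
Proof.
apply: measurableU; (rewrite -[X in measurable X]setTI; apply: measurable_fun_le => //);
  exact: (measurable_sumsq sU).
Qed.

Let mW : measurable_fun setT W.
Proof.
apply: (@measurable_psi_sum _ _ _ P t0 K1 _ _ _ sU (fun a x => r a * x)) => // b.
exact: measurable_funM.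
Qed.

Let mT : measurable_fun setT Tst.
Proof.
have mU b : sample_pred b -> measurable_fun setT (U b) by move=> /sU[].
apply: measurable_tstat => k kn.
  rewrite (_ : x 1%N k i = (fun w => mu1 + s1 * U (1%N, k) w)); last exact/funext.
  apply: measurable_funD => //; apply: measurable_funM => //; apply: mU.
  by rewrite /sample_pred/= kn.
rewrite (_ : x 2%N k i = (fun w => mu2 + - s2 * U (2%N, k) w)); last exact/funext.
apply: measurable_funD => //; apply: measurable_funM => //; apply: mU.
by rewrite /sample_pred/= kn.
Qed.

Lemma measurable_tstat_ge z : measurable [set w | z <= `|Tst w|].
Proof.
rewrite -[X in measurable X]setTI; apply: measurable_fun_le => //.
exact: (measurableT_comp (@measurable_realfun.normr_measurable R setT) mT).
Qed.

Lemma measurable_tstat_lt z : measurable [set w | `|Tst w| < z].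
Proof.
rewrite (_ : [set w | _] = ~` [set w | z <= `|Tst w|]).
  by apply: measurableC; exact: measurable_tstat_ge.
by apply/seteqP; split => w /=; rewrite ltNge => /negP.
Qed.

Let mWge y : measurable [set w | y <= `|W w|].
Proof.
rewrite -[X in measurable X]setTI; apply: measurable_fun_le => //.
exact: (measurableT_comp (@measurable_realfun.normr_measurable R setT) mW).
Qed.

Let W_prob y : 0 < y -> (P [set w | (y <= `|W w|)%R] <= (1 / y ^+ 2)%:E)%E.
Proof.
move=> y0; have := @weighted_deviation _ t0 K1 d T P _ _ F U ind FU sU r _ y all12 uniq12 y0.
by rewrite r_sum.
Qed.

Let csq_low e j n w : (1 < n)%N -> e < 1 -> ~ (sumsq U (sample_seq j n) w <= n%:R * (1 - e)) ->
  (n%:R - 1) * (1 - e) <= csq n (fun k => U (j, k) w).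
Proof.
move=> n0 e1; rewrite sumsqE => /negP; rewrite -ltNge => h.
apply: le_trans (ltW h); rewrite ler_wpM2r//; lra.
Qed.

(** The bound on the square has 1 - e, and (1 - e)^2 <= 1 - e avoids taking its root. *)
Let T_up e w : 0 < e < 1 -> ~ lowbad e w -> `|Tst w| * (1 - e) <= `|g + W w|.
Proof.
move=> /andP[e0 e1] /not_orP[l1 l2].
have := @tstat_upper R pooled n1 n2 (fun j k i => x j k i w) i mu1 mu2 s1 s2
  (fun k => U (1%N, k) w) (fun k => U (2%N, k) w) e n1g n2g s10 s20 pool (x1E^~ w) (x2E ^~ w) e1
  (csq_low n1g e1 l1) (csq_low n2g e1 l2).
rewrite -WE -/g -/(Tst w) => H.
rewrite -(@ler_pXn2r _ 2) ?nnegrE ?mulr_ge0//; last by lra.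
rewrite exprMn !real_normK ?num_real//; apply: le_trans H.
by rewrite ler_wpM2l ?sqr_ge0//; nra.
Qed.

(** The sums of squares are compared with n (1 + e / 2) and the statistic uses n - 1; the condition
    4 <= n e makes n (1 + e / 2) <= (n - 1) (1 + e). *)
Let T_low e w : 0 < e < 1 -> 4 <= nmin%:R * e -> ~ lowbad e w -> ~ highbad (e / 2) w ->
  `|g + W w| <= `|Tst w| * (1 + e).
Proof.
move=> /andP[e0 e1] ne /not_orP[l1 l2] /not_orP[h1 h2].
have hh j n : nmin%:R <= n%:R :> R -> ~ (n%:R * (1 + e / 2) <= sumsq U (sample_seq j n) w) ->
    csq n (fun k => U (j, k) w) <= (n%:R - 1) * (1 + e).
  move=> nm; rewrite sumsqE => /negP; rewrite -ltNge => /ltW h; apply: le_trans h _.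
  have : nmin%:R * e <= n%:R * e by rewrite ler_wpM2r// ltW.
  lra.
have := @tstat_lower R pooled n1 n2 (fun j k i => x j k i w) i mu1 mu2 s1 s2
  (fun k => U (1%N, k) w) (fun k => U (2%N, k) w) e n1g n2g s10 s20 pool (x1E^~ w) (x2E ^~ w) e1
  (csq_low n1g e1 l1) (csq_low n2g e1 l2) (hh _ _ nm1 h1) (hh _ _ nm2 h2).
rewrite -WE -/g -/(Tst w) => H.
rewrite -(@ler_pXn2r _ 2) ?nnegrE ?mulr_ge0//; last by lra.
rewrite exprMn !real_normK ?num_real//; apply: le_trans H _.
by rewrite ler_wpM2l ?sqr_ge0//; nra.
Qed.

(** The Cramer bound is taken as a hypothesis and applied to the residuals and to their negatives,
    giving the factor 2 lam for the two-sided event; the last term covers sample variances that are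
    too small. *)
Lemma tstat_null_tail (lam kap y e : R) :
  (forall (V : nat * nat -> T -> R) (r : nat * nat -> R) (s : seq (nat * nat)) (rho Y : R),
   (forall b C, sample_pred b -> measurable C -> F b (V b @^-1` C)) ->
   (forall b, sample_pred b -> std_rv P t0 K1 (V b)) ->
   all sample_pred s -> uniq s ->
   (forall b, sample_pred b -> 0 <= r b <= rho) -> \sum_(b <- s) r b ^+ 2 = 1 ->
   0 <= Y -> rho * (1 + Y) ^+ 4 <= kap ->
   (P [set w | (Y <= \sum_(b <- s) r b * V b w)%R] <= (lam * Q Y)%:E)%E) ->
  mu1 = mu2 -> 0 <= y -> 0 < e < 1 -> (Num.sqrt nmin%:R)^-1 * (1 + y * (1 - e)) ^+ 4 <= kap ->
  (P [set w | (y <= `|Tst w|)%R] <=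
   (2 * lam * Q (y * (1 - e)) + 6 * expR (- (ss_rate t0 K1 * nmin%:R * e ^+ 2)))%:E)%E.
Proof.
move=> cram mu12 y0 /andP[e0 e1] yk.
have z0 : 0 <= y * (1 - e) by rewrite mulr_ge0//; lra.
have g0 : g = 0 by rewrite /g mu12 subrr mul0r.
have mW2 (V : nat * nat -> T -> R) : (forall b, sample_pred b -> std_rv P t0 K1 (V b)) ->
   measurable [set w | y * (1 - e) <= \sum_(a <- sample_seq 1 n1 ++ sample_seq 2 n2) r a * V a w].
  move=> sV; apply: (@measurable_psi_sum_ge _ _ _ P t0 K1 _ _ _ sV (fun a x => r a * x)) => // b.
  exact: measurable_funM.
have sV : forall b, sample_pred b -> std_rv P t0 K1 (fun w => - U b w).
  by move=> b Db; apply: std_rvN; exact: sU.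
have FV : forall b C, sample_pred b -> measurable C -> F b ((fun w => - U b w) @^-1` C).
  move=> b C Db mC; rewrite (_ : _ @^-1` C = U b @^-1` ((fun x => - x) @^-1` C)) //.
  apply: FU => //; rewrite -[X in measurable X]setTI.
  exact: (measurable_funN (@measurable_id _ R setT)).
have c1 := cram U r _ _ _ FU sU all12 uniq12 r_bound r_sum z0 yk.
have c2 := cram (fun b w => - U b w) r _ _ _ FV sV all12 uniq12 r_bound r_sum z0 yk.
apply: (@probability_le_add _ _ _ _ _ _ (lowbad e) _ _ (measurable_tstat_ge y) (measurableU _ _ (mW2 _ sU) (mW2 _ sV)) (m_low e)).
- move=> w /= yT; have [lb|nlb] := pselect (lowbad e w); first by right.
  left; have := T_up (introT andP (conj e0 e1)) nlb; rewrite g0 add0r => h.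
  have : y * (1 - e) <= `|W w| by apply: le_trans h; rewrite ler_wpM2r//; lra.
  rewrite /W; have [w0|w0] := leP 0 (\sum_(a <- sample_seq 1 n1 ++ sample_seq 2 n2) r a * U a w).
    by rewrite ger0_norm//; left.
  rewrite ltr0_norm// -sumrN => h'; right => /=.
  by under eq_bigr do rewrite mulrN.
- rewrite (_ : 2 * lam * _ = lam * Q (y * (1 - e)) + lam * Q (y * (1 - e))); last by ring.
  by apply: (@probability_le_add _ _ _ _ _ _ _ _ _ (measurableU _ _ (mW2 _ sU) (mW2 _ sV)) (mW2 _ sU) (mW2 _ sV)).
- by apply: lowbad_prob; rewrite e0 ltW.
Qed.

Lemma tstat_upper_tail (G y z e : R) : `|g| = G -> 0 < y -> 0 < e < 1 -> G + y <= z * (1 - e) ->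
  (P [set w | (z <= `|Tst w|)%R] <=
   (1 / y ^+ 2 + 6 * expR (- (ss_rate t0 K1 * nmin%:R * e ^+ 2)))%:E)%E.
Proof.
move=> gG y0 /andP[e0 e1] Gz.
apply: (@probability_le_add _ _ _ _ _ _ (lowbad e) _ _ (measurable_tstat_ge z) (mWge y) (m_low e)).
- move=> w /= zT; have [lb|nlb] := pselect (lowbad e w); first by right.
  left; have := T_up (introT andP (conj e0 e1)) nlb => h.
  have h1 : z * (1 - e) <= `|g + W w| by apply: le_trans h; rewrite ler_wpM2r//; lra.
  have := ler_normD g (W w); rewrite gG; lra.
- exact: W_prob.
- by apply: lowbad_prob; rewrite e0 ltW.
Qed.

Lemma tstat_lower_tail (G y z e : R) : `|g| = G -> 0 < y -> 0 < e < 1 -> 4 <= nmin%:R * e ->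
  z * (1 + e) <= G - y ->
  (P [set w | (`|Tst w| < z)%R] <=
   (1 / y ^+ 2 + (6 * expR (- (ss_rate t0 K1 * nmin%:R * e ^+ 2))
    + 2 * (quartic_const t0 K1 / (nmin%:R * (e / 2) ^+ 2))))%:E)%E.
Proof.
move=> gG y0 /andP[e0 e1] ne Gz.
have mlh : measurable (lowbad e `|` highbad (e / 2)) by exact: measurableU.
apply: (@probability_le_add _ _ _ _ _ _ _ _ _ (measurable_tstat_lt z) (mWge y) mlh).
- move=> w /= zT; have [lb|nlb] := pselect (lowbad e w); first by right; left.
  have [hb|nhb] := pselect (highbad (e / 2) w); first by right; right.
  left; have h := T_low (introT andP (conj e0 e1)) ne nlb nhb.
  have h1 : `|Tst w| * (1 + e) < z * (1 + e) by rewrite ltr_pM2r//; lra.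
  have := ler_normB (g + W w) (W w); rewrite addrK gG; lra.
- exact: W_prob.
- apply: (@probability_le_add _ _ _ _ _ _ _ _ _ mlh (m_low e) (m_high (e / 2))) => //.
    by apply: lowbad_prob; rewrite e0 ltW.
  by apply: highbad_prob; rewrite divr_gt0.
Qed.

End one_test.

(** * From the model hypotheses to standardized residuals *)

Section model.
Context {R : realType} d (T : measurableType d) (P : probability T R).

(** Collects the hypotheses at one value of m, so that the asymptotic lemmas can quantify over all
    models after the threshold on l has been fixed. *)
Record two_sample_model (m : nat) (n : nat -> nat) (mu sig : nat -> nat -> R)
    (Xb : nat -> nat -> T -> R) (X : nat -> nat -> nat -> T -> R)
    (pooled : bool) (t0 K1 : R) : Prop := TwoSampleModel {
  tsm_generic : forall j i, (j == 1%N) || (j == 2%N) -> (i < m)%N ->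
     [/\ measurable_fun setT (Xb j i), 0 < sig j i,
         has_mean P (Xb j i) (mu j i) &
         has_variance P (Xb j i) (mu j i) (sig j i ^+ 2)];
  tsm_copy : forall j k, (j == 1%N) || (j == 2%N) -> (k < n j)%N ->
     (forall i, (i < m)%N -> measurable_fun setT (X j k i)) /\
     same_law P m (X j k) (Xb j);
  tsm_indep : indep_family P
     (fun a : nat * nat => ((a.1 == 1%N) || (a.1 == 2%N)) && (a.2 < n a.1)%N)
     (fun a => gen_sigma [set f | exists i, (i < m)%N /\ f = X a.1 a.2 i]);
  tsm_pool : pooled -> forall i, (i < m)%N -> sig 1%N i = sig 2%N i;
  tsm_exp : forall j i, (j == 1%N) || (j == 2%N) -> (i < m)%N ->
     (\int[P]_x (expR (t0 * `|Xb j i x - mu j i| / sig j i))%:E <= K1%:E)%E }.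

Variables (m : nat) (n : nat -> nat) (mu sig : nat -> nat -> R).
Variables (Xb : nat -> nat -> T -> R) (X : nat -> nat -> nat -> T -> R).
Variables (pooled : bool) (t0 K1 : R).
Hypothesis mod : two_sample_model m n mu sig Xb X pooled t0 K1.

Let sp := sample_pred (n 1%N) (n 2%N).
Let F (a : nat * nat) := gen_sigma [set f | exists i, (i < m)%N /\ f = X a.1 a.2 i].

Let spE : sp = (fun a : nat * nat => ((a.1 == 1%N) || (a.1 == 2%N)) && (a.2 < n a.1)%N).
Proof.
apply/funext => -[j k]; rewrite /sp /sample_pred /=.
by case: eqP => [->|_] /=; rewrite ?orbF//; case: eqP => [->|_].
Qed.

Lemma model_indep : indep_family P sp F.
Proof. by rewrite spE; exact: tsm_indep mod. Qed.

Let spP a : sp a -> ((a.1 == 1%N) || (a.1 == 2%N)) /\ (a.2 < n a.1)%N.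
Proof. by rewrite spE => /andP. Qed.

Lemma measurable_copy a i : sp a -> (i < m)%N -> measurable_fun setT (X a.1 a.2 i).
Proof. by move=> /spP[a1 a2] im; have [h _] := tsm_copy mod a1 a2; exact: h. Qed.

Lemma copy_sigma a i C : (i < m)%N -> measurable C -> F a (X a.1 a.2 i @^-1` C).
Proof.
move=> im mC; apply: sub_sigma_algebra; exists (X a.1 a.2 i); split; first by exists i.
by exists C.
Qed.

(** The case i = l is allowed, which is why the rectangle uses an intersection at each coordinate;
    [marginal_law] is that case. *)
Lemma pair_law a i l C C' : sp a -> (i < m)%N -> (l < m)%N -> measurable C -> measurable C' ->
  P (X a.1 a.2 i @^-1` C `&` X a.1 a.2 l @^-1` C') = P (Xb a.1 i @^-1` C `&` Xb a.1 l @^-1` C').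
Proof.
move=> /spP[a1 a2] im lm mC mC'; have [_ law] := tsm_copy mod a1 a2.
pose E k := (if k == i then C else setT) `&` (if k == l then C' else setT).
have mE k : measurable (E k) by apply: measurableI; case: ifP.
have bigE (Y : nat -> T -> R) : \big[setI/setT]_(k < m) (Y k @^-1` E k) = Y i @^-1` C `&` Y l @^-1` C'.
  rewrite (eq_bigr (fun k : 'I_m => (Y k @^-1` (if val k == i then C else setT)) `&` (Y k @^-1` (if val k == l then C' else setT)))) //.
  rewrite big_split/=; congr (_ `&` _).
    rewrite (bigD1 (Ordinal im))//= eqxx big1 ?setIT// => k.
    by rewrite -val_eqE /= => /negbTE ->; rewrite preimage_setT.
  rewrite (bigD1 (Ordinal lm))//= eqxx big1 ?setIT// => k.
  by rewrite -val_eqE /= => /negbTE ->; rewrite preimage_setT.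
by have := law E mE; rewrite !bigE.
Qed.

Lemma marginal_law a i C : sp a -> (i < m)%N -> measurable C ->
  P (X a.1 a.2 i @^-1` C) = P (Xb a.1 i @^-1` C).
Proof. by move=> sa im mC; have := pair_law sa im im mC mC; rewrite !setIid. Qed.

Definition residual i (a : nat * nat) (w : T) : R :=
  (if a.1 == 1%N then 1 else - 1) * ((X a.1 a.2 i w - mu a.1 i) / sig a.1 i).

Let affine_meas i (a : nat * nat) : measurable_fun setT
  (fun x : R => (if a.1 == 1%N then 1 else - 1) * ((x - mu a.1 i) / sig a.1 i)).
Proof. by apply: measurable_funM => //; apply: measurable_funM => //; apply: measurable_funB. Qed.

Lemma residual_sigma i b C : (i < m)%N -> sp b -> measurable C -> F b (residual i b @^-1` C).
Proof.
move=> im sb mC.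
rewrite (_ : _ @^-1` C = X b.1 b.2 i @^-1` ((fun x : R => (if b.1 == 1%N then 1 else - 1) * ((x - mu b.1 i) / sig b.1 i)) @^-1` C)) //.
by apply: copy_sigma => //; rewrite -[X in measurable X]setTI; exact: affine_meas.
Qed.

Lemma residual_std i b : (i < m)%N -> sp b -> std_rv P t0 K1 (residual i b).
Proof.
move=> im sb; have [b1 b2] := spP sb; have [mX s0 hm hv] := tsm_generic mod b1 im.
have std := has_mean_std_rv mX s0 hm hv (tsm_exp mod b1 im).
have stdX : std_rv P t0 K1 (fun w => (X b.1 b.2 i w - mu b.1 i) / sig b.1 i).
  apply: (eq_law_std_rv _ _ std).
    apply: measurable_funM => //; apply: measurable_funB => //; exact: measurable_copy.
  move=> C mC; pose psi := (fun x : R => (x - mu b.1 i) / sig b.1 i).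
  have mpsi : measurable_fun setT psi by apply: measurable_funM => //; apply: measurable_funB.
  apply: (marginal_law (C := psi @^-1` C)) => //.
  by rewrite -[X in measurable X]setTI; exact: mpsi.
rewrite /residual; case: ifP => _.
  by rewrite (_ : (fun w => _) = (fun w => (X b.1 b.2 i w - mu b.1 i) / sig b.1 i))//; apply/funext => w; rewrite mul1r.
rewrite (_ : (fun w => _) = (fun w => - ((X b.1 b.2 i w - mu b.1 i) / sig b.1 i))); first exact: std_rvN.
by apply/funext => w; rewrite mulN1r.
Qed.

Lemma residual1 i k w : (i < m)%N -> X 1%N k i w = mu 1%N i + sig 1%N i * residual i (1%N, k) w.
Proof.
move=> im; have [_ s0 _ _] := tsm_generic mod (isT : (1 == 1)%N || (1 == 2)%N) im.
by rewrite /residual /= mul1r; field; rewrite gt_eqF.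
Qed.

Lemma residual2 i k w : (i < m)%N -> X 2%N k i w = mu 2%N i + - sig 2%N i * residual i (2%N, k) w.
Proof.
move=> im; have [_ s0 _ _] := tsm_generic mod (isT : (2 == 1)%N || (2 == 2)%N) im.
by rewrite /residual /=; field; rewrite gt_eqF.
Qed.

Definition tstat_rv i (w : T) : R := tstat pooled (n 1%N) (n 2%N) (fun j k i => X j k i w) i.

Lemma measurable_tstat_rv i : (i < m)%N -> measurable_fun setT (tstat_rv i).
Proof.
move=> im; apply: measurable_tstat => k kn.
  by apply: (measurable_copy (a := (1%N, k))) => //; rewrite /sp /sample_pred/= kn.
by apply: (measurable_copy (a := (2%N, k))) => //; rewrite /sp /sample_pred/= kn.
Qed.

Let all_samples := sample_seq 1 (n 1%N) ++ sample_seq 2 (n 2%N).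

Let uniq_all : uniq all_samples.
Proof.
have us j k : uniq (sample_seq j k) by rewrite map_inj_uniq ?iota_uniq// => u v [].
rewrite cat_uniq !us andbT/=; apply/hasPn => a /mapP[k _ ->].
by apply/negP => /mapP[k' _ []].
Qed.

Let sp_all a : a \in all_samples -> sp a.
Proof.
rewrite mem_cat => /orP[] /mapP[k]; rewrite mem_iota => /andP[_ kn] ->; rewrite /sp /sample_pred/= kn //.
Qed.

Let all_sp1 k : (k < n 1%N)%N -> (1%N, k) \in all_samples.
Proof. by move=> kn; rewrite mem_cat map_f// mem_iota. Qed.

Let all_sp2 k : (k < n 2%N)%N -> (2%N, k) \in all_samples.
Proof. by move=> kn; rewrite mem_cat orbC map_f// mem_iota. Qed.

(** The probability of two joint rectangles factors over the observation vectors by independence of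
    the samples; within one vector the hypothesis on the generic vectors factors it further.
    Regrouping the factors by test gives independence on rectangles. *)
Lemma indep_tstat i l : (i < m)%N -> (l < m)%N ->
  (forall j C C', (j == 1%N) || (j == 2%N) -> measurable C -> measurable C' ->
    (P (Xb j i @^-1` C `&` Xb j l @^-1` C') = P (Xb j i @^-1` C) * P (Xb j l @^-1` C'))%E) ->
  indep_rv P (tstat_rv i) (tstat_rv l).
Proof.
move=> im lm ind.
apply: (@indep_rects _ T R P _ all_samples all_samples (fun a => X a.1 a.2 i) (fun a => X a.1 a.2 l)).
- by move=> a /sp_all sa; exact: measurable_copy.
- by move=> a /sp_all sa; exact: measurable_copy.
- move=> _ _ [C mC ->] [C' mC' ->]; rewrite -big_split.
  have prodE (E : nat * nat -> set T) : (forall a, a \in all_samples -> F a (E a)) ->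
      P (\big[setI/setT]_(a <- all_samples) E a) = (\big[*%E/1%E]_(a <- all_samples) P (E a))%E.
    by move=> FE; apply: model_indep => // a sa; split; [exact: sp_all|exact: FE].
  rewrite prodE; last first.
    move=> a sa; have : @measurable _ (g_sigma_algebraType [set A | exists f, [set f | exists i, (i < m)%N /\ f = X a.1 a.2 i] f /\ exists C : set R, measurable C /\ A = f @^-1` C])
       (X a.1 a.2 i @^-1` C a `&` X a.1 a.2 l @^-1` C' a).
      by apply: measurableI; apply: copy_sigma.
    by [].
  rewrite prodE; last by move=> a sa; apply: copy_sigma.
  rewrite prodE; last by move=> a sa; apply: copy_sigma.
  rewrite -big_split; rewrite big_seq [RHS]big_seq; apply: eq_bigr => a /sp_all sa.
  have [a1 _] := spP sa.
  by rewrite pair_law// ind// !marginal_law.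
- apply: measurable_tstat => k kn.
    exact: (@measurable_rects _ T R _ all_samples (fun a => X a.1 a.2 i) (1%N, k) uniq_all (all_sp1 kn)).
  exact: (@measurable_rects _ T R _ all_samples (fun a => X a.1 a.2 i) (2%N, k) uniq_all (all_sp2 kn)).
- apply: measurable_tstat => k kn.
    exact: (@measurable_rects _ T R _ all_samples (fun a => X a.1 a.2 l) (1%N, k) uniq_all (all_sp1 kn)).
  exact: (@measurable_rects _ T R _ all_samples (fun a => X a.1 a.2 l) (2%N, k) uniq_all (all_sp2 kn)).
Qed.

End model.

Lemma measurable_set_le d (T : measurableType d) (R : realType) (f g : T -> R) :
  measurable_fun setT f -> measurable_fun setT g -> measurable [set w | f w <= g w].
Proof.
by move=> mf mg; rewrite -[X in measurable X]setTI; exact: measurable_fun_le.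
Qed.

Lemma measurable_set_lt d (T : measurableType d) (R : realType) (f g : T -> R) :
  measurable_fun setT f -> measurable_fun setT g -> measurable [set w | f w < g w].
Proof.
move=> mf mg; rewrite (_ : [set w | _] = ~` [set w | g w <= f w]).
  by apply: measurableC; exact: measurable_set_le.
by apply/seteqP; split => w /=; rewrite ltNge => /negP.
Qed.

(** * Single tests as l tends to infinity *)

Section one_test_asymptotics.
Context {R : realType}.
Variables (t0 K1 c : R).
Hypotheses (t00 : 0 < t0) (K10 : 0 <= K1) (c0 : 0 < c).

Definition signal (n : nat -> nat) (mu sig : nat -> nat -> R) i : R :=
  `|mu 1%N i - mu 2%N i| /
  Num.sqrt (sig 1%N i ^+ 2 / (n 1%N)%:R + sig 2%N i ^+ 2 / (n 2%N)%:R).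

Definition pval_rv d (T : measurableType d) (n : nat -> nat)
    (X : nat -> nat -> nat -> T -> R) (pooled : bool) i (w : T) : R :=
  student_pval ((n 1%N)%:R + (n 2%N)%:R - 2) `|tstat_rv n X pooled i w|.

Lemma measurable_student_pval_abs nu : 1 <= nu ->
  measurable_fun setT (fun x : R => student_pval nu `|x|).
Proof.
move=> n1; apply: measurableT_comp => //.
by apply: continuous_measurable_fun; exact: continuous_student_pval.
Qed.

Section wrappers.
Context d (T : measurableType d) (P : probability T R) (m : nat) (n : nat -> nat)
  (mu sig : nat -> nat -> R) (Xb : nat -> nat -> T -> R) (X : nat -> nat -> nat -> T -> R)
  (pooled : bool).
Hypothesis mod : two_sample_model P m n mu sig Xb X pooled t0 K1.
Hypotheses (n1g : (1 < n 1%N)%N) (n2g : (1 < n 2%N)%N).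
Variable i : nat.
Hypothesis im : (i < m)%N.

Let F (a : nat * nat) := gen_sigma [set f | exists i, (i < m)%N /\ f = X a.1 a.2 i].
Let s0 j : (j == 1%N) || (j == 2%N) -> 0 < sig j i.
Proof. by move=> jj; have [] := tsm_generic mod jj im. Qed.
Let pool : pooled -> sig 1%N i = sig 2%N i.
Proof. by move=> p; exact: (tsm_pool mod p im). Qed.

Let indP : indep_family P (sample_pred (n 1%N) (n 2%N)) F.
Proof. exact: model_indep mod. Qed.
Let FUP b C : sample_pred (n 1%N) (n 2%N) b -> measurable C -> F b (residual mu sig X i b @^-1` C).
Proof. exact: residual_sigma. Qed.
Let sUP b : sample_pred (n 1%N) (n 2%N) b -> std_rv P t0 K1 (residual mu sig X i b).
Proof. by move=> sb; exact: (residual_std mod im sb). Qed.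
Let x1P k w : X 1%N k i w = mu 1%N i + sig 1%N i * residual mu sig X i (1%N, k) w.
Proof. exact: (residual1 mod k w im). Qed.
Let x2P k w : X 2%N k i w = mu 2%N i + - sig 2%N i * residual mu sig X i (2%N, k) w.
Proof. exact: (residual2 mod k w im). Qed.

Lemma model_null_tail (lam kap y e : R) :
  (forall (V : nat * nat -> T -> R) (r : nat * nat -> R) (s : seq (nat * nat)) (rho Y : R),
   (forall b C, sample_pred (n 1%N) (n 2%N) b -> measurable C -> F b (V b @^-1` C)) ->
   (forall b, sample_pred (n 1%N) (n 2%N) b -> std_rv P t0 K1 (V b)) ->
   all (sample_pred (n 1%N) (n 2%N)) s -> uniq s ->
   (forall b, sample_pred (n 1%N) (n 2%N) b -> 0 <= r b <= rho) -> \sum_(b <- s) r b ^+ 2 = 1 ->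
   0 <= Y -> rho * (1 + Y) ^+ 4 <= kap ->
   (P [set w | (Y <= \sum_(b <- s) r b * V b w)%R] <= (lam * Q Y)%:E)%E) ->
  mu 1%N i = mu 2%N i -> 0 <= y -> 0 < e < 1 ->
  (Num.sqrt (minn (n 1%N) (n 2%N))%:R)^-1 * (1 + y * (1 - e)) ^+ 4 <= kap ->
  (P [set w | (y <= `|tstat_rv n X pooled i w|)%R] <=
   (2 * lam * Q (y * (1 - e)) + 6 * expR (- (ss_rate t0 K1 * (minn (n 1%N) (n 2%N))%:R * e ^+ 2)))%:E)%E.
Proof.
move=> cram mu12 y0 e01 yk.
exact: (@tstat_null_tail R d T P t0 K1 t00 K10 (n 1%N) (n 2%N) F (residual mu sig X i)
 indP FUP sUP n1g n2g
 (mu 1%N i) (mu 2%N i) (sig 1%N i) (sig 2%N i) (@s0 1%N isT) (@s0 2%N isT) pooled i X pool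
 x1P x2P lam kap y e cram mu12 y0 e01 yk).
Qed.

Let absg G : signal n mu sig i = G ->
  `|(mu 1%N i - mu 2%N i) / Num.sqrt (sig 1%N i ^+ 2 / (n 1%N)%:R + sig 2%N i ^+ 2 / (n 2%N)%:R)| = G.
Proof. by rewrite normrM normfV (ger0_norm (sqrtr_ge0 _)). Qed.

Lemma model_upper_tail (G y z e : R) : signal n mu sig i = G -> 0 < y -> 0 < e < 1 -> G + y <= z * (1 - e) ->
  (P [set w | (z <= `|tstat_rv n X pooled i w|)%R] <=
   (1 / y ^+ 2 + 6 * expR (- (ss_rate t0 K1 * (minn (n 1%N) (n 2%N))%:R * e ^+ 2)))%:E)%E.
Proof.
move=> /absg gG y0 e01 Gz.
exact: (@tstat_upper_tail R d T P t0 K1 t00 K10 (n 1%N) (n 2%N) F (residual mu sig X i)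
 indP FUP sUP n1g n2g
 (mu 1%N i) (mu 2%N i) (sig 1%N i) (sig 2%N i) (@s0 1%N isT) (@s0 2%N isT) pooled i X pool
 x1P x2P G y z e gG y0 e01 Gz).
Qed.

Lemma model_lower_tail (G y z e : R) : signal n mu sig i = G -> 0 < y -> 0 < e < 1 ->
  4 <= (minn (n 1%N) (n 2%N))%:R * e -> z * (1 + e) <= G - y ->
  (P [set w | (`|tstat_rv n X pooled i w| < z)%R] <=
   (1 / y ^+ 2 + (6 * expR (- (ss_rate t0 K1 * (minn (n 1%N) (n 2%N))%:R * e ^+ 2))
    + 2 * (quartic_const t0 K1 / ((minn (n 1%N) (n 2%N))%:R * (e / 2) ^+ 2))))%:E)%E.
Proof.
move=> /absg gG y0 e01 ne Gz.
exact: (@tstat_lower_tail R d T P t0 K1 t00 K10 (n 1%N) (n 2%N) F (residual mu sig X i)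
 indP FUP sUP n1g n2g
 (mu 1%N i) (mu 2%N i) (sig 1%N i) (sig 2%N i) (@s0 1%N isT) (@s0 2%N isT) pooled i X pool
 x1P x2P G y z e gG y0 e01 ne Gz).
Qed.

Lemma measurable_pval_rv : measurable_fun setT (pval_rv n X pooled i).
Proof.
have nu1 : 1 <= (n 1%N)%:R + (n 2%N)%:R - 2 :> R.
  rewrite lerBrDr -natrD (_ : 1 + 2 = 3%:R :> R); last by ring.
  by rewrite ler_nat (leq_trans _ (leq_add n1g n2g)).
exact: (measurableT_comp (measurable_student_pval_abs nu1) (measurable_tstat_rv mod im)).
Qed.

End wrappers.

Lemma sample_size_bounds (n1 n2 : nat) (l : R) : 1 <= l -> 4 <= c * l ->
  c * l ^+ 5 <= (minn n1 n2)%:R ->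
  [/\ (1 < n1)%N, (1 < n2)%N, c * l ^+ 5 <= n1%:R + n2%:R - 2 & 3 <= n1%:R + n2%:R - 2 :> R].
Proof.
move=> l1 cl h.
have l5 : l <= l ^+ 5 by rewrite exprS ler_peMr// ?exprn_ege1//; lra.
have cl5 : c * l <= c * l ^+ 5 by rewrite ler_wpM2l// ltW.
have h4 : 4 <= (minn n1 n2)%:R :> R by lra.
have g1 : (4 <= n1)%N by move: h4; rewrite ler_nat leq_min => /andP[].
have g2 : (4 <= n2)%N by move: h4; rewrite ler_nat leq_min => /andP[].
have m1 : (minn n1 n2)%:R <= n1%:R :> R by rewrite ler_nat geq_minl.
have r2 : 4 <= n2%:R :> R by rewrite ler_nat.
by split; [exact: leq_trans g1|exact: leq_trans g2|lra|lra].
Qed.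

(* The critical value z = theta sqrt(l) has p-value below exp(-a l) when a < theta^2/2. *)
Lemma student_pval_small (theta a : R) : 0 < theta -> a < theta ^+ 2 / 2 ->
  \forall l \near +oo, forall nu : R, 3 <= nu -> c * l ^+ 5 <= nu ->
    student_pval nu (theta * Num.sqrt l) < expR (- (a * l)).
Proof.
move=> th0 ath; pose kap := theta ^+ 2 / 2 - a.
have kap0 : 0 < kap by rewrite /kap subr_gt0.
pose C := 6 / gmass * expR 1 : R.
have C0 : 0 < C by rewrite mulr_gt0 ?expR_gt0// divr_gt0// gmass_gt0.
near=> l; move=> nu n3 nl.
have l1 : 1 <= l by near: l; apply: nbhs_pinfty_ge; exact: num_real.
have l2 : theta ^+ 4 / c <= l by near: l; apply: nbhs_pinfty_ge; exact: num_real.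
have l3 : theta ^- 2 <= l by near: l; apply: nbhs_pinfty_ge; exact: num_real.
have l4 : (C + 1) / kap <= l by near: l; apply: nbhs_pinfty_ge; exact: num_real.
have sl : Num.sqrt l ^+ 2 = l by rewrite sqr_sqrtr//; lra.
have z1 : 1 <= theta * Num.sqrt l.
  rewrite -(@ler_pXn2r _ 2) ?nnegrE// ?mulr_ge0 ?sqrtr_ge0 ?(ltW th0)//.
  rewrite expr1n exprMn sl mulrC -ler_pdivrMr ?exprn_gt0//; lra.
have z4 : (theta * Num.sqrt l) ^+ 4 <= nu.
  apply: le_trans nl; rewrite (_ : _ ^+ 4 = theta ^+ 4 * (Num.sqrt l ^+ 2) ^+ 2); last by ring.
  rewrite sl; move: l2; rewrite ler_pdivrMr// => l2.
  have a1 : theta ^+ 4 * l ^+ 2 <= l * c * l ^+ 2 by rewrite ler_wpM2r// sqr_ge0.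
  have a2 : l * c * l ^+ 2 = c * l ^+ 3 by ring.
  have a3 : c * l ^+ 3 <= c * l ^+ 5.
    by rewrite ler_wpM2l ?(ltW c0)// ler_weXn2l.
  lra.
apply: le_lt_trans (student_pval_le n3 z1 z4) _.
rewrite -/C exprMn sl.
have -> : expR (- (a * l)) = expR (kap * l) * expR (- (theta ^+ 2 * l / 2)).
  by rewrite -expRD; congr expR; rewrite /kap; field.
rewrite ltr_pM2r ?expR_gt0//.
apply: lt_le_trans (expR_ge1Dx _); move: l4; rewrite ler_pdivrMr//; lra.
Unshelve. all: by end_near. Qed.

(** [student_pval_ge] with lam = 2 and the lower Mills bound lose only a factor linear in l against
    the Gaussian density, which exp(kap l) outweighs. *)
Lemma student_pval_large (theta a : R) : 0 < theta -> theta ^+ 2 / 2 < a ->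
  \forall l \near +oo, forall nu : R, 3 <= nu -> c * l ^+ 5 <= nu ->
    expR (- (a * l)) < student_pval nu (theta * Num.sqrt l).
Proof.
move=> th0 ath; pose kap := a - theta ^+ 2 / 2.
have kap0 : 0 < kap by rewrite /kap subr_gt0.
have [nu0 [kp [kp0 H]]] := @student_pval_ge R 2 ltac:(lra).
have Z0 : 0 < gmass :> R := gmass_gt0.
pose C := expR (3 / 2) * gmass * (1 + theta) : R.
have C0 : 0 < C by rewrite !mulr_gt0 ?expR_gt0//; lra.
near=> l; move=> nu n3 nl.
have l1 : 1 <= l by near: l; apply: nbhs_pinfty_ge; exact: num_real.
have l2 : (1 + theta) ^+ 2 / kp / c <= l by near: l; apply: nbhs_pinfty_ge; exact: num_real.
have l3 : nu0 / c <= l by near: l; apply: nbhs_pinfty_ge; exact: num_real.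
have l4 : (C + 1) * 2 / kap ^+ 2 <= l by near: l; apply: nbhs_pinfty_ge; exact: num_real.
have l0 : 0 < l by lra.
have sl : Num.sqrt l ^+ 2 = l by rewrite sqr_sqrtr//; lra.
have s1 : 1 <= Num.sqrt l by rewrite -(@ler_pXn2r _ 2) ?nnegrE ?sqrtr_ge0// expr1n sl.
have sll : Num.sqrt l <= l by nra.
have cl5 : c * l ^+ 2 <= nu.
  apply: le_trans nl; rewrite ler_wpM2l ?(ltW c0)// ler_weXn2l//.
have cl1 : c * l <= nu.
  apply: le_trans cl5; rewrite ler_wpM2l ?(ltW c0)//; nra.
have z0 : 0 <= theta * Num.sqrt l by rewrite mulr_ge0 ?sqrtr_ge0// ltW.
have zl : 1 + theta * Num.sqrt l <= (1 + theta) * Num.sqrt l by nra.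
have h1 : nu0 <= nu by apply: le_trans cl1; move: l3; rewrite ler_pdivrMr// mulrC.
have h2 : (1 + theta * Num.sqrt l) ^+ 2 <= kp * nu.
  apply: (@le_trans _ _ (((1 + theta) * Num.sqrt l) ^+ 2)).
    by apply: lerXn2r; rewrite ?nnegrE ?mulr_ge0 ?sqrtr_ge0//; lra.
  rewrite exprMn sl; move: l2; rewrite -mulrA -invfM ler_pdivrMr ?mulr_gt0// => l2.
  have : kp * (c * l ^+ 2) <= kp * nu by rewrite ler_wpM2l// ltW.
  have : (1 + theta) ^+ 2 * l <= l * (kp * c) * l by rewrite ler_wpM2r// ltW.
  lra.
have := H nu _ h1 z0 h2 => H1.
have H2 := gau_le_Q z0.
have H3 : gau (theta * Num.sqrt l) <= C * l * student_pval nu (theta * Num.sqrt l).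
  apply: le_trans H2 _.
  have q1 : Q (theta * Num.sqrt l) <= student_pval nu (theta * Num.sqrt l) by lra.
  have qz0 := ltW (Q_gt0 (theta * Num.sqrt l)).
  have EZ : 0 <= expR (3 / 2) * gmass :> R by rewrite mulr_ge0 ?expR_ge0// ltW.
  apply: ler_pM => //; first by rewrite mulr_ge0// addr_ge0.
  rewrite /C -!(mulrA (expR (3 / 2) * gmass)) ler_wpM2l//; apply: le_trans zl _.
  by rewrite ler_wpM2l//; lra.
have H4 : gau (theta * Num.sqrt l) = expR (kap * l) * expR (- (a * l)).
  by rewrite /gau exprMn sl -expRD; congr expR; rewrite /kap; field.
have H5 : C * l < expR (kap * l).
  have := @expR_ge1Dxn R (kap * l) 1 (mulr_ge0 (ltW kap0) (ltW l0)).
  rewrite (_ : 2`! = 2%N)// => H5.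
  move: l4; rewrite ler_pdivrMr ?exprn_gt0// => l4.
  have : (C + 1) * 2 * l <= l * kap ^+ 2 * l by rewrite ler_wpM2r// ltW.
  have : l * kap ^+ 2 * l = (kap * l) ^+ 2 by ring.
  lra.
have Cl0 : 0 < C * l by exact: mulr_gt0.
rewrite -(ltr_pM2l Cl0); apply: lt_le_trans H3.
by rewrite H4 ltr_pM2r ?expR_gt0.
Unshelve. all: by end_near. Qed.

(** The critical value is b sqrt(l) with b midway between sqrt(2 a) and theta: above sqrt(2 a), so
    its p-value is below exp(-a l), and below theta, so a multiple of sqrt(l) is left for the
    noise. *)
Lemma alternative_detected (theta a : R) : 0 < theta -> a < theta ^+ 2 / 2 -> 0 <= a ->
  exists C : R, \forall l \near +oo,
  forall d (T : measurableType d) (P : probability T R) m n mu sig Xb X pooled i,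
    two_sample_model P m n mu sig Xb X pooled t0 K1 -> (i < m)%N ->
    c * l ^+ 5 <= (minn (n 1%N) (n 2%N))%:R -> signal n mu sig i = theta * Num.sqrt l ->
    (P [set w | (expR (- (a * l)) < pval_rv n X pooled i w)%R] <= (C / l)%:E)%E.
Proof.
move=> th0 ath a0.
pose b := (theta + Num.sqrt (2 * a)) / 2.
have sa2 : Num.sqrt (2 * a) ^+ 2 = 2 * a by rewrite sqr_sqrtr// mulr_ge0.
have sa0 := sqrtr_ge0 (2 * a).
have sat : Num.sqrt (2 * a) < theta by nra.
have bt : b < theta by rewrite /b; lra.
have b0 : 0 < b by rewrite /b; lra.
have ab : a < b ^+ 2 / 2.
  have : Num.sqrt (2 * a) < b by rewrite /b; lra.
  nra.
(* Keeps b (1 + e) below the midpoint of b and theta; the remaining distance is f. *)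
pose e := Num.min (1 / 2) ((theta - b) / (2 * b)).
have e0 : 0 < e by rewrite lt_min; apply/andP; split; [lra|apply: divr_gt0; [rewrite subr_gt0|exact: mulr_gt0]].
have e1 : e < 1 by rewrite (@le_lt_trans _ _ (1 / 2))// ?ge_min ?lexx//; lra.
have b20 : 0 < 2 * b by exact: mulr_gt0.
have eb : e * (2 * b) <= theta - b.
  have h : e <= (theta - b) / (2 * b) by rewrite ge_min lexx orbT.
  by move: h; rewrite ler_pdivlMr.
clearbody e.
pose f := (theta - b) / 2; have f0 : 0 < f by rewrite /f; lra.
have fb : b * (1 + e) <= theta - f by rewrite /f; lra.
clearbody f.
have r0 := ss_rate_gt0 t00 K10.
have C1 := quartic_const_ge1 t00 K10.
(* One term for each cause of failure: the noise, a sample variance that is too small, one that is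
   too large. Since the sample sizes are at least c l, each is O(1 / l). *)
exists (1 / f ^+ 2 + (6 / (ss_rate t0 K1 * c * e ^+ 2) + 2 * (quartic_const t0 K1 / (c * (e / 2) ^+ 2)))).
have small := student_pval_small b0 ab.
near=> l; move=> d T P m n mu sig Xb X pooled i mod im nl sg.
have l1 : 1 <= l by near: l; apply: nbhs_pinfty_ge; exact: num_real.
have l2 : 4 / c <= l by near: l; apply: nbhs_pinfty_ge; exact: num_real.
have l3 : 4 / (c * e) <= l by near: l; apply: nbhs_pinfty_ge; exact: num_real.
have H : forall nu : R, 3 <= nu -> c * l ^+ 5 <= nu -> student_pval nu (b * Num.sqrt l) < expR (- (a * l)) by near: l.
have l0 : 0 < l by exact: lt_le_trans l1.
have sl : Num.sqrt l ^+ 2 = l by rewrite sqr_sqrtr// ltW.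
have sl0 : 0 < Num.sqrt l by rewrite sqrtr_gt0.
have cl4 : 4 <= c * l by move: l2; rewrite ler_pdivrMr// mulrC.
have [n1g n2g nu5 nu3] := sample_size_bounds l1 cl4 nl.
have cln : c * l <= (minn (n 1%N) (n 2%N))%:R.
  apply: le_trans nl; rewrite ler_wpM2l ?(ltW c0)//.
  by rewrite exprS ler_peMr ?exprn_ege1// ltW.
set N : R := (minn (n 1%N) (n 2%N))%:R in nl cln *.
have N0 : 0 < N := lt_le_trans (mulr_gt0 c0 l0) cln.
have y0 : 0 < f * Num.sqrt l by exact: mulr_gt0.
have ne : 4 <= N * e.
  move: l3; rewrite ler_pdivrMr ?mulr_gt0// => l3.
  by apply: le_trans l3 _; rewrite mulrCA mulrA ler_wpM2r// ltW.
have Gz : b * Num.sqrt l * (1 + e) <= theta * Num.sqrt l - f * Num.sqrt l.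
  by rewrite -mulrBl mulrAC ler_wpM2r ?(ltW sl0).
have := model_lower_tail mod n1g n2g im sg y0 (introT andP (conj e0 e1)) ne Gz.
move=> HT; apply: (@le_trans _ _ (P [set w | (`|tstat_rv n X pooled i w| < b * Num.sqrt l)%R])).
  apply: le_measure; rewrite ?inE.
  - apply: measurable_set_lt => //.
    exact: (measurable_pval_rv mod n1g n2g im).
  - apply: measurable_set_lt => //.
    apply: measurableT_comp => //; exact: (measurable_tstat_rv mod im).
  - move=> w /=; rewrite /pval_rv => h; rewrite ltNge; apply/negP => h2.
    have n1 : 1 <= (n 1%N)%:R + (n 2%N)%:R - 2 :> R by apply: le_trans nu3; rewrite ler1n.
    have := H _ nu3 nu5 => h3.
    move: h2; rewrite le_eqVlt => /predU1P[h2|/(student_pval_decr n1)h2].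
      by rewrite -h2 in h; have := lt_trans h h3; rewrite ltxx.
    by have := lt_trans (lt_trans h h2) h3; rewrite ltxx.
apply: le_trans HT _; rewrite lee_fin -/N.
have g1 : 1 / (f * Num.sqrt l) ^+ 2 = 1 / f ^+ 2 / l.
  by rewrite exprMn sl; field; rewrite !gt_eqF.
have e20 : 0 < e ^+ 2 := exprn_gt0 2 e0.
have e220 : 0 < (e / 2) ^+ 2 by rewrite exprn_gt0// divr_gt0.
have g2 : expR (- (ss_rate t0 K1 * N * e ^+ 2)) <= 1 / (ss_rate t0 K1 * c * e ^+ 2) / l.
  have q : 0 < ss_rate t0 K1 * c * e ^+ 2 * l by rewrite !mulr_gt0.
  rewrite [leRHS](_ : _ = (ss_rate t0 K1 * c * e ^+ 2 * l)^-1); last by rewrite [RHS]invfM mul1r.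
  rewrite expRN lef_pV2 ?posrE ?expR_gt0//.
  apply: le_trans (expR_ge1Dx _).
  rewrite (mulrAC _ _ l) -(mulrA _ c l) -[leLHS]add0r lerD ?ler01//.
  by rewrite ler_wpM2r ?(ltW e20)// ler_wpM2l// ltW.
have g3 : quartic_const t0 K1 / (N * (e / 2) ^+ 2) <= quartic_const t0 K1 / (c * (e / 2) ^+ 2) / l.
  rewrite [leRHS](_ : _ = quartic_const t0 K1 * (c * (e / 2) ^+ 2 * l)^-1); last by rewrite -[LHS]mulrA -(invfM (c * (e / 2) ^+ 2)).
  apply: ler_wpM2l; first exact: le_trans ler01 C1.
  rewrite lef_pV2 ?posrE ?mulr_gt0//.
  by rewrite mulrAC ler_wpM2r ?(ltW e220).
rewrite g1.
rewrite (_ : (_ + (_ + _)) / l = 1 / f ^+ 2 / l + (6 * (1 / (ss_rate t0 K1 * c * e ^+ 2) / l) + 2 * (quartic_const t0 K1 / (c * (e / 2) ^+ 2) / l))); last by ring.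
by rewrite lerD2l lerD// ler_wpM2l.
Unshelve. all: by end_near. Qed.

(** The mirror image, with b between theta and sqrt(2 a). Overestimated variances only shrink the
    statistic, so only the lower deviations of the sums of squares appear. *)
Lemma alternative_missed (theta a : R) : 0 < theta -> theta ^+ 2 / 2 < a ->
  exists C : R, \forall l \near +oo,
  forall d (T : measurableType d) (P : probability T R) m n mu sig Xb X pooled i,
    two_sample_model P m n mu sig Xb X pooled t0 K1 -> (i < m)%N ->
    c * l ^+ 5 <= (minn (n 1%N) (n 2%N))%:R -> signal n mu sig i = theta * Num.sqrt l ->
    (P [set w | (pval_rv n X pooled i w <= expR (- (a * l)))%R] <= (C / l)%:E)%E.
Proof.
move=> th0 ath.
have a0 : 0 < a by have := sqr_ge0 theta; lra.
pose b := (theta + Num.sqrt (2 * a)) / 2.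
have sa2 : Num.sqrt (2 * a) ^+ 2 = 2 * a by rewrite sqr_sqrtr// mulr_ge0// ltW.
have sa0 := sqrtr_ge0 (2 * a).
have sat : theta < Num.sqrt (2 * a) by nra.
have bt : theta < b by rewrite /b; lra.
have b0 : 0 < b by rewrite /b; lra.
have ab : b ^+ 2 / 2 < a.
  have : b < Num.sqrt (2 * a) by rewrite /b; lra.
  nra.
pose e := Num.min (1 / 2) ((b - theta) / (2 * b)).
have e0 : 0 < e by rewrite lt_min; apply/andP; split; [lra|apply: divr_gt0; [rewrite subr_gt0|exact: mulr_gt0]].
have e1 : e < 1 by rewrite (@le_lt_trans _ _ (1 / 2))// ?ge_min ?lexx//; lra.
have b20 : 0 < 2 * b by exact: mulr_gt0.
have eb : e * (2 * b) <= b - theta.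
  have h : e <= (b - theta) / (2 * b) by rewrite ge_min lexx orbT.
  by move: h; rewrite ler_pdivlMr.
clearbody e.
pose f := (b - theta) / 2; have f0 : 0 < f by rewrite /f; lra.
have fb : theta + f <= b * (1 - e) by rewrite /f; lra.
clearbody f.
have r0 := ss_rate_gt0 t00 K10.
exists (1 / f ^+ 2 + 6 / (ss_rate t0 K1 * c * e ^+ 2)).
have large := student_pval_large b0 ab.
near=> l; move=> d T P m n mu sig Xb X pooled i mod im nl sg.
have l1 : 1 <= l by near: l; apply: nbhs_pinfty_ge; exact: num_real.
have l2 : 4 / c <= l by near: l; apply: nbhs_pinfty_ge; exact: num_real.
have H : forall nu : R, 3 <= nu -> c * l ^+ 5 <= nu -> expR (- (a * l)) < student_pval nu (b * Num.sqrt l) by near: l.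
have l0 : 0 < l by exact: lt_le_trans l1.
have sl : Num.sqrt l ^+ 2 = l by rewrite sqr_sqrtr// ltW.
have sl0 : 0 < Num.sqrt l by rewrite sqrtr_gt0.
have cl4 : 4 <= c * l by move: l2; rewrite ler_pdivrMr// mulrC.
have [n1g n2g nu5 nu3] := sample_size_bounds l1 cl4 nl.
have cln : c * l <= (minn (n 1%N) (n 2%N))%:R.
  apply: le_trans nl; rewrite ler_wpM2l ?(ltW c0)//.
  by rewrite exprS ler_peMr ?exprn_ege1// ltW.
set N : R := (minn (n 1%N) (n 2%N))%:R in nl cln *.
have y0 : 0 < f * Num.sqrt l by exact: mulr_gt0.
have Gz : theta * Num.sqrt l + f * Num.sqrt l <= b * Num.sqrt l * (1 - e).
  by rewrite -mulrDl (mulrAC b) ler_wpM2r ?(ltW sl0).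
have := model_upper_tail mod n1g n2g im sg y0 (introT andP (conj e0 e1)) Gz.
move=> HT; apply: (@le_trans _ _ (P [set w | (b * Num.sqrt l <= `|tstat_rv n X pooled i w|)%R])).
  apply: le_measure; rewrite ?inE.
  - apply: measurable_set_le => //.
    exact: (measurable_pval_rv mod n1g n2g im).
  - apply: measurable_set_le => //.
    apply: measurableT_comp => //; exact: (measurable_tstat_rv mod im).
  - move=> w /=; rewrite /pval_rv => h; rewrite leNgt; apply/negP.
    have n1 : 1 <= (n 1%N)%:R + (n 2%N)%:R - 2 :> R by apply: le_trans nu3; rewrite ler1n.
    have := H _ nu3 nu5 => h3 /(student_pval_decr n1) h2.
    by have := lt_le_trans (lt_trans h3 h2) h; rewrite ltxx.
apply: le_trans HT _; rewrite lee_fin -/N.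
have g1 : 1 / (f * Num.sqrt l) ^+ 2 = 1 / f ^+ 2 / l.
  by rewrite exprMn sl; field; rewrite !gt_eqF.
have e20 : 0 < e ^+ 2 := exprn_gt0 2 e0.
have g2 : expR (- (ss_rate t0 K1 * N * e ^+ 2)) <= 1 / (ss_rate t0 K1 * c * e ^+ 2) / l.
  have q : 0 < ss_rate t0 K1 * c * e ^+ 2 * l by rewrite !mulr_gt0.
  rewrite [leRHS](_ : _ = (ss_rate t0 K1 * c * e ^+ 2 * l)^-1); last by rewrite [RHS]invfM mul1r.
  rewrite expRN lef_pV2 ?posrE ?expR_gt0//.
  apply: le_trans (expR_ge1Dx _).
  rewrite (mulrAC _ _ l) -(mulrA _ c l) -[leLHS]add0r lerD ?ler01//.
  by rewrite ler_wpM2r ?(ltW e20)// ler_wpM2l// ltW.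
rewrite g1 [leRHS]mulrDl lerD2l (_ : 6 / _ / l = 6 * (1 / (ss_rate t0 K1 * c * e ^+ 2) / l)); last by ring.
by rewrite ler_wpM2l.
Unshelve. all: by end_near. Qed.

End one_test_asymptotics.

(** Write t as the p-value of a critical value x. Three factors lm are lost: in the Cramer bound, in
    passing from Q(x (1 - e)) to Q(x), and in 2 Q(x) <= lm t. The failure of the variances adds at
    most u t. *)
Lemma null_level (R : realType) (t0 K1 c L a : R) :
  0 < t0 -> 0 <= K1 -> 0 < c -> 1 < L -> 0 <= a < 1 ->
  \forall l \near +oo,
  forall d (T : measurableType d) (P : probability T R) m n mu sig Xb X pooled i t,
    two_sample_model P m n mu sig Xb X pooled t0 K1 -> (i < m)%N ->
    c * l ^+ 5 <= (minn (n 1%N) (n 2%N))%:R -> mu 1%N i = mu 2%N i ->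
    expR (- (a * l)) <= t <= 1 ->
    (P [set w | (pval_rv n X pooled i w <= t)%R] <= (L * t)%:E)%E.
Proof.
move=> t00 K10 c0 L1 /andP[a0 a1].
(* For u <= 1 one has (1 + u)^3 + u <= 1 + 8 u. *)
pose u := Num.min 1 ((L - 1) / 8).
have u0 : 0 < u by rewrite lt_min; apply/andP; split; lra.
have u1 : u <= 1 by rewrite ge_min lexx.
have uL : u <= (L - 1) / 8 by rewrite ge_min lexx orbT.
clearbody u; pose lm := 1 + u.
have lm1 : 1 < lm by rewrite /lm; lra.
have [kap kap0 cram] := cramer_upper t00 K10 lm1.
have [nu0 [kp [kp0 pge]]] := student_pval_ge lm1.
have E5 := expR_gt0 (5 / 2 : R).
pose del := u / (12 * (1 + expR (5 / 2))).
have EE : 0 < 12 * (1 + expR (5 / 2)) :> R by lra.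
have del0 : 0 < del by rewrite divr_gt0.
have delE : del * (12 * (1 + expR (5 / 2))) = u by rewrite /del divfK// gt_eqF.
have del1 : del <= 1 / 12 by nra.
have del2 : 6 * expR (5 / 2) * del <= u by nra.
clearbody del.
have r0 := ss_rate_gt0 t00 K10.
(* Since 2^2 / 2 exceeds every a < 1, the p-value of 2 sqrt(l) is below all levels considered, which
   gives the right end of the interval for the intermediate value theorem. *)
have small := @student_pval_small R c c0 2 a (ltr0Sn _ _) ltac:(lra).
pose rc := ss_rate t0 K1 * c * del ^+ 2.
have rc0 : 0 < rc by rewrite /rc !mulr_gt0.
near=> l; move=> d T P m n mu sig Xb X pooled i t mod im nl mu12 /andP[tl t1].
have l1 : 1 <= l by near: l; apply: nbhs_pinfty_ge; exact: num_real.
have l2 : 4 / c <= l by near: l; apply: nbhs_pinfty_ge; exact: num_real.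
have l3 : nu0 / c <= l by near: l; apply: nbhs_pinfty_ge; exact: num_real.
have l4 : 9 / (kp * c) <= l by near: l; apply: nbhs_pinfty_ge; exact: num_real.
have l5 : 6561 / kap ^+ 2 / c <= l by near: l; apply: nbhs_pinfty_ge; exact: num_real.
have l6 : (6 / u + 1) / rc <= l by near: l; apply: nbhs_pinfty_ge; exact: num_real.
have H : forall nu : R, 3 <= nu -> c * l ^+ 5 <= nu -> student_pval nu (2 * Num.sqrt l) < expR (- (a * l)) by near: l.
have l0 : 0 < l := lt_le_trans ltr01 l1.
have sl : Num.sqrt l ^+ 2 = l by rewrite sqr_sqrtr// ltW.
have s1 : 1 <= Num.sqrt l by rewrite -(@ler_pXn2r _ 2) ?nnegrE ?sqrtr_ge0// expr1n sl.
have cl4 : 4 <= c * l by move: l2; rewrite ler_pdivrMr// mulrC.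
have [n1g n2g nu5 nu3] := sample_size_bounds c0 l1 cl4 nl.
have cl5 : c * l <= c * l ^+ 5.
  by apply: ler_wpM2l; [exact: ltW|exact: ler_eXnr].
set nu := (n 1%N)%:R + (n 2%N)%:R - 2 in nu5 nu3.
have nu1 : 1 <= nu by clear - nu3; lra.
set N : R := (minn (n 1%N) (n 2%N))%:R in nl *.
have N0 : 0 < N := lt_le_trans (mulr_gt0 c0 (exprn_gt0 5 l0)) nl.
have t0' : 0 < t := lt_le_trans (expR_gt0 _) tl.
have [|||x x01 xt] := @IVT R (student_pval nu) 0 (2 * Num.sqrt l) t.
- by rewrite mulr_ge0// sqrtr_ge0.
- by apply: continuous_subspaceT; exact: continuous_student_pval.
- have Hs := H nu nu3 nu5; rewrite student_pval0// ge_min le_max t1 andbT orbC.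
  by rewrite (ltW (lt_le_trans Hs tl)).
have /andP[x0 xl] : 0 <= x <= 2 * Num.sqrt l by move: x01; rewrite in_itv.
have x3 : 1 + x <= 3 * Num.sqrt l by clear - s1 xl; lra.
(* At arguments of order sqrt(l) the tail tolerates a relative shift of order 1 / l only. With
   sample sizes of order at least l^5 the failure probability is still at most of order exp(-rc
   l^3), far below t. *)
pose e := del / l.
have e0 : 0 < e by rewrite divr_gt0.
have edel : e <= del by rewrite /e ler_pdivrMr// ler_peMr// ltW.
have el : e * l = del by rewrite /e divfK// gt_eqF.
have e1 : e < 1 by clear - edel del1; move: e edel => e edel; lra.
have xe : 0 <= x * (1 - e) <= x.
  clear - x0 e0 e1; move: e e0 e1 => e e0 e1; nra.
have /andP[xe0 xex] := xe.
(* The fourth power in [cramer_upper] is at most 81 l^2, against sqrt(c l^5) from the sample sizes;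
   6561 is 81^2. *)
have cond : (Num.sqrt N)^-1 * (1 + x * (1 - e)) ^+ 4 <= kap.
  have sN : 0 < Num.sqrt N by rewrite sqrtr_gt0.
  rewrite mulrC ler_pdivrMr//.
  apply: (@le_trans _ _ ((3 * Num.sqrt l) ^+ 4)).
    apply: lerXn2r; rewrite ?nnegrE; last by clear - x3 xex; lra.
      by rewrite addr_ge0.
    by rewrite mulr_ge0// sqrtr_ge0.
  rewrite (_ : (3 * Num.sqrt l) ^+ 4 = 81 * (Num.sqrt l ^+ 2) ^+ 2); last by ring.
  rewrite sl -(@ler_pXn2r _ 2) ?nnegrE ?mulr_ge0 ?sqr_ge0 ?(ltW kap0) ?(ltW sN)//.
  rewrite [leRHS]exprMn sqr_sqrtr ?(ltW N0)//.
  have k2 : 0 < kap ^+ 2 := exprn_gt0 2 kap0.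
  move: l5; rewrite -mulrA -invfM ler_pdivrMr ?mulr_gt0// => l5.
  have : kap ^+ 2 * (c * l ^+ 5) <= kap ^+ 2 * N by rewrite ler_wpM2l// ltW.
  have l40 : 0 <= l ^+ 4 by rewrite exprn_ge0// ltW.
  have := ler_wpM2r l40 l5.
  rewrite (_ : (81 * l ^+ 2) ^+ 2 = 6561 * l ^+ 4); last by ring.
  rewrite (_ : l * (kap ^+ 2 * c) * l ^+ 4 = kap ^+ 2 * (c * l ^+ 5)); last by ring.
  by move=> h1 h2; exact: le_trans h1 h2.
have cramP := cram d T P _ (sample_pred (n 1%N) (n 2%N)) (fun a : nat * nat => gen_sigma [set f | exists i, (i < m)%N /\ f = X a.1 a.2 i]).
have HT := @model_null_tail R t0 K1 t00 K10 d T P m n mu sig Xb X pooled mod n1g n2g i im lm kap x e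
  (fun V r s rho Y FV sV => cramP V r s rho Y (model_indep mod) FV sV) mu12 x0 (introT andP (conj e0 e1)) cond.
apply: (@le_trans _ _ (P [set w | (x <= `|tstat_rv n X pooled i w|)%R])).
  apply: le_measure; rewrite ?inE.
  - apply: measurable_set_le => //.
    exact: (measurable_pval_rv mod n1g n2g im).
  - apply: measurable_set_le => //.
    apply: measurableT_comp => //; exact: (measurable_tstat_rv mod im).
  - move=> w /=; rewrite /pval_rv -xt => h; rewrite leNgt; apply/negP.
    by move=> /(student_pval_decr nu1); rewrite ltNge h.
apply: le_trans HT _; rewrite lee_fin -/N.
have h1 : nu0 <= nu.
  move: l3; rewrite ler_pdivrMr// => l3; clear - l3 cl5 nu5; lra.
have h2 : (1 + x) ^+ 2 <= kp * nu.
  apply: (@le_trans _ _ ((3 * Num.sqrt l) ^+ 2)); first by apply: lerXn2r; rewrite ?nnegrE ?addr_ge0 ?mulr_ge0 ?sqrtr_ge0.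
  rewrite exprMn sl; move: l4; rewrite ler_pdivrMr ?mulr_gt0// => l4.
  have l41 : 9 * l <= l * (kp * c) * l by rewrite ler_wpM2r// ltW.
  have l42 : kp * (c * l ^+ 5) <= kp * nu by rewrite ler_wpM2l// ltW.
  have l43 : kp * (c * l ^+ 2) <= kp * (c * l ^+ 5).
    by apply: ler_wpM2l; [exact: ltW|apply: ler_wpM2l; [exact: ltW|exact: ler_weXn2l]].
  rewrite (_ : l * (kp * c) * l = kp * (c * l ^+ 2)) in l41; last by ring.
  rewrite (_ : 3 ^+ 2 = 9 :> R); last by ring.
  exact: le_trans l41 (le_trans l43 l42).
have h3 := pge nu x h1 x0 h2; rewrite xt in h3.
have shift : x * e * (1 + x) <= 6 * del.
  have : x * (1 + x) <= 6 * l.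
    have : x * (1 + x) <= 2 * Num.sqrt l * (3 * Num.sqrt l) by apply: ler_pM => //; rewrite addr_ge0.
    rewrite (_ : 2 * Num.sqrt l * (3 * Num.sqrt l) = 6 * Num.sqrt l ^+ 2); last by ring.
    by rewrite sl.
  move=> /(ler_wpM2l (ltW e0)); rewrite (_ : e * (6 * l) = 6 * (e * l)); last by ring.
  by rewrite el; rewrite (_ : e * (x * (1 + x)) = x * e * (1 + x)); last by ring.
have q0 := Q_gt0 x.
have sh0 : 0 <= x * e by rewrite mulr_ge0// ltW.
have h4 : Q (x * (1 - e)) <= lm * Q x.
  have sh1 : x * e * (1 + x) <= 1 by apply: le_trans shift _; clear - del1; lra.
  have := @Q_shift R x (x * e) x0 sh0 sh1.
  rewrite (_ : x - x * e = x * (1 - e)); last by ring.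
  move=> h; apply: le_trans h _; rewrite ler_wpM2r ?(ltW q0)// /lm lerD2l.
  have := ler_wpM2l (ltW E5) shift; rewrite (_ : expR (5 / 2) * (6 * del) = 6 * expR (5 / 2) * del); last by ring.
  by move=> h; exact: le_trans h del2.
have h5 : 6 * expR (- (ss_rate t0 K1 * N * e ^+ 2)) <= u * t.
  have h51 : rc * l ^+ 3 <= ss_rate t0 K1 * N * e ^+ 2.
    rewrite (_ : rc * l ^+ 3 = ss_rate t0 K1 * (c * l ^+ 5) * e ^+ 2); last first.
      by rewrite /rc -el; ring.
    by rewrite ler_wpM2r ?sqr_ge0// ler_wpM2l// ltW.
  have h52 : 6 / u + l <= rc * l ^+ 3.
    have u6 : 0 < 6 / u by rewrite divr_gt0.
    move: l6; rewrite ler_pdivrMr// => l6.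
    have a2 : (6 / u + 1) * l ^+ 2 <= l * rc * l ^+ 2 by rewrite ler_wpM2r ?sqr_ge0.
    rewrite (_ : l * rc * l ^+ 2 = rc * l ^+ 3) in a2; last by ring.
    apply: le_trans a2; rewrite [leRHS]mulrDl mul1r; apply: lerD.
      by rewrite ler_peMr ?(ltW u6)// exprn_ege1.
    by rewrite expr2 ler_peMl// ltW.
  have h53 : expR (- (ss_rate t0 K1 * N * e ^+ 2)) <= expR (- (6 / u)) * expR (- (a * l)).
    rewrite -expRD ler_expR.
    have al : a * l <= l by rewrite ler_piMl// ltW.
    rewrite -opprD lerN2; apply: le_trans h51; apply: le_trans h52.
    by rewrite lerD2l.
  have h54 : 6 * expR (- (6 / u)) <= u.
    rewrite expRN ler_pdivrMr ?expR_gt0// mulrC -ler_pdivrMr//.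
    by apply: le_trans (expR_ge1Dx _); rewrite lerDr.
  apply: (@le_trans _ _ (6 * expR (- (6 / u)) * t)).
    rewrite -[leRHS]mulrA; apply: ler_wpM2l => //; apply: le_trans h53 _.
    by apply: ler_wpM2l => //; exact: expR_ge0.
  by rewrite ler_wpM2r// ltW.
have lm0 : 0 <= lm := ltW (lt_trans ltr01 lm1).
have h6 : 2 * lm * Q (x * (1 - e)) <= lm * lm * (lm * t).
  have h61 : 2 * lm * Q (x * (1 - e)) <= 2 * lm * (lm * Q x) by rewrite ler_wpM2l// mulr_ge0.
  have h62 : lm * lm * (2 * Q x) <= lm * lm * (lm * t) by rewrite ler_wpM2l// mulr_ge0.
  by apply: le_trans h61 _; apply: le_trans h62; rewrite le_eqVlt; apply/orP; left; apply/eqP; ring.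
have h7 : lm * lm * lm + u <= L.
  rewrite /lm; clear -u0 u1 uL; nra.
apply: le_trans (lerD h6 h5) _; apply: le_trans (ler_wpM2r (ltW t0') h7).
by rewrite le_eqVlt; apply/orP; left; apply/eqP; ring.
Unshelve. all: by end_near. Qed.

Lemma integral_cond_sum (R : realType) d (T : measurableType d) (P : probability T R)
    m (H : pred 'I_m) (f : 'I_m -> T -> R) :
  (forall i, measurable_fun setT (f i)) -> (forall i w, 0 <= f i w) ->
  (\int[P]_w (\sum_(i < m | H i) f i w)%:E = \sum_(i < m | H i) \int[P]_w (f i w)%:E)%E.
Proof.
move=> mf f0; rewrite [RHS]big_mkcond.
under eq_integral do rewrite big_mkcond -sumEFin.
rewrite ge0_integral_sum//.
- by apply: eq_bigr => i _; case: ifP => // _; rewrite integral0.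
- by move=> i; case: (H i); [exact/measurable_EFinP|exact: measurable_cst].
- by move=> i w _; rewrite lee_fin; case: ifP.
Qed.

(** * Moments of the number of small p-values *)

Section counts.
Context {R : realType} d (T : measurableType d) (P : probability T R).
Variables (m : nat) (A : nat -> set T) (H : pred nat).
Hypothesis mA : forall i, (i < m)%N -> measurable (A i).

Definition hits (w : T) : R := \sum_(i < m | H i) \1_(A i) w.
Definition hsize : R := (\sum_(i < m | H i) 1%N)%:R.

Lemma hsizeE : hsize = \sum_(i < m | H i) 1.
Proof. by rewrite /hsize natr_sum. Qed.

Lemma measurable_hits : measurable_fun setT hits.
Proof.
rewrite (_ : hits = (fun w => \sum_(i < m) (if H i then \1_(A i) w else 0))).
  apply: measurable_sum => i; have [Hi|Hi] := boolP (H i); last exact: measurable_cst.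
  by apply: measurable_indic; exact: mA.
by apply/funext => w; rewrite /hits big_mkcond.
Qed.

Lemma hits_ge0 w : 0 <= hits w.
Proof. by apply: sumr_ge0 => i _; rewrite indicE. Qed.

Lemma integral_hits : (\int[P]_w (hits w)%:E = \sum_(i < m | H i) P (A i))%E.
Proof.
rewrite /hits integral_cond_sum.
- by apply: eq_bigr => i _; rewrite integral_indic ?setIT//; exact: mA.
- by move=> i; apply: measurable_indic; exact: mA.
- by move=> i w; rewrite indicE.
Qed.

Lemma count_markov (b e : R) : 0 < e -> 0 < hsize ->
  (forall i, (i < m)%N -> H i -> (P (A i) <= b%:E)%E) ->
  (P [set w | (e * hsize <= hits w)%R] <= (b / e)%:E)%E.
Proof.
move=> e0 h0 Pb.
have eh0 : 0 < e * hsize by exact: mulr_gt0.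
have mE : measurable [set w | e * hsize <= hits w].
  rewrite -[X in measurable X]setTI; apply: measurable_fun_le => //.
  exact: measurable_hits.
rewrite -(@lee_pmul2l _ (e * hsize)%:E)// ?lte_fin//.
apply: (@le_trans _ _ (\int[P]_w (hits w)%:E)%E).
  have -> : ((e * hsize)%:E * P [set w | (e * hsize <= hits w)%R] = \int[P]_w ((e * hsize) * \1_[set w | (e * hsize <= hits w)%R] w)%:E)%E.
    under eq_integral do rewrite EFinM.
    rewrite ge0_integralZl//.
    - by rewrite integral_indic// setIT.
    - by apply/measurable_EFinP; exact: measurable_indic.
    - by rewrite lee_fin ltW.
  apply: ge0_le_integral => //.
  - by move=> w _; rewrite lee_fin mulr_ge0// ?indicE// ltW.
  - by apply/measurable_EFinP; apply: measurable_funM => //; exact: measurable_indic.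
  - by apply/measurable_EFinP; exact: measurable_hits.
  move=> w _; rewrite lee_fin indicE; case: (boolP (w \in _)) => wA.
    by rewrite mulr1; rewrite inE in wA.
  by rewrite mulr0 hits_ge0.
rewrite integral_hits.
apply: (@le_trans _ _ (\sum_(i < m | H i) b%:E)%E).
  by apply: lee_sum => i Hi; exact: Pb.
rewrite -EFinM sumEFin lee_fin hsizeE [leRHS](_ : _ = b * \sum_(i < m | H i) 1); last by field; rewrite gt_eqF.
by rewrite mulr_sumr; apply: ler_sum => i _; rewrite mulr1.
Qed.

Let pr i l : R := fine (P (A i `&` A l)).
Let p i : R := fine (P (A i)).

Let PE i : (i < m)%N -> P (A i) = (p i)%:E.
Proof. by move=> im; rewrite fineK// fin_num_measure//; exact: mA. Qed.

Let PIE i l : (i < m)%N -> (l < m)%N -> P (A i `&` A l) = (pr i l)%:E.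
Proof. by move=> im lm; rewrite fineK// fin_num_measure//; apply: measurableI; exact: mA. Qed.

Let e : R := \sum_(i < m | H i) p i.

Let e0 : 0 <= e.
Proof. by apply: sumr_ge0 => i _; apply: fine_ge0; exact: measure_ge0. Qed.

Lemma second_moment_hits :
  (\int[P]_w ((hits w - e) ^+ 2)%:E = (\sum_(i < m | H i) \sum_(l < m | H l) pr i l - e ^+ 2)%:E)%E.
Proof.
have mh := measurable_hits.
have m2 : measurable_fun setT (fun w => (hits w - e) ^+ 2).
  by apply: measurable_funX; apply: measurable_funB.
have sq w : hits w ^+ 2 = \sum_(i < m | H i) \sum_(l < m | H l) \1_(A i `&` A l) w.
  rewrite expr2 /hits mulr_suml; apply: eq_bigr => i _; rewrite mulr_sumr.
  by apply: eq_bigr => l _; rewrite indicI.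
have I2 : (\int[P]_w (hits w ^+ 2)%:E = (\sum_(i < m | H i) \sum_(l < m | H l) pr i l)%:E)%E.
  have mI (i l : 'I_m) : measurable_fun setT (\1_(A i `&` A l) : T -> R).
     apply: measurable_indic; apply: measurableI; exact: mA.
  under eq_integral do rewrite sq.
  rewrite integral_cond_sum; last 2 first.
  - move=> i; rewrite (_ : (fun w => _) = (fun w => \sum_(l < m) (if H l then \1_(A i `&` A l) w else 0 : R))).
      by apply: measurable_sum => l; have [Hl|Hl] := boolP (H l); [exact: mI|exact: measurable_cst].
    by apply/funext => w; rewrite big_mkcond.
  - by move=> i w; apply: sumr_ge0 => l _; rewrite indicE.
  rewrite -sumEFin; apply: eq_bigr => i _.
  rewrite integral_cond_sum; [|by move=> l; exact: mI|by move=> l w; rewrite indicE].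
  rewrite -sumEFin; apply: eq_bigr => l _.
  rewrite integral_indic//; last by apply: measurableI; exact: mA.
  by rewrite setIT; apply: PIE.
have I1 : (\int[P]_w (hits w)%:E = e%:E)%E.
  by rewrite integral_hits -sumEFin; apply: eq_bigr => i _; rewrite PE.
(* The cross term is moved to the side of the square, so that all integrands are nonnegative and
   additivity needs no integrability. *)
have J : (\int[P]_w ((hits w - e) ^+ 2)%:E + (2 * e)%:E * \int[P]_w (hits w)%:E =
   \int[P]_w (hits w ^+ 2)%:E + \int[P]_w (e ^+ 2)%:E)%E.
  rewrite -ge0_integralZl//; last 3 first.
  - exact/measurable_EFinP.
  - by move=> w _; rewrite lee_fin hits_ge0.
  - by rewrite lee_fin mulr_ge0.
  rewrite -ge0_integralD//; last 4 first.
  - by move=> w _; rewrite lee_fin sqr_ge0.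
  - exact/measurable_EFinP.
  - by move=> w _; rewrite mule_ge0// lee_fin ?mulr_ge0// hits_ge0.
  - by apply/measurable_EFinP; apply: measurable_funM.
  rewrite -ge0_integralD//; last 3 first.
  - by move=> w _; rewrite lee_fin sqr_ge0.
  - by apply/measurable_EFinP; apply: measurable_funX.
  - by move=> w _; rewrite lee_fin sqr_ge0.
  apply: eq_integral => w _; rewrite -EFinM -!EFinD; congr EFin; ring.
move: J; rewrite I1 I2 integral_cst//= probability_setT mule1 -EFinM -EFinD.
case: (integral _ _ _) => [r| |]// [] h; congr EFin; lra.
Qed.

(** For each index i the covariances with [Ms i] vanish, and at most K further terms remain, each at
    most P(A i) <= b. So the variance is at most [hsize] K b, of the order of the mean. *)
Lemma count_chebyshev (Ms : nat -> seq nat) (K b x : R) :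
  0 <= K -> 0 <= b -> 0 < x ->
  (forall i, (i < m)%N -> H i -> (P (A i) <= b%:E)%E) ->
  (forall i, (i < m)%N -> H i -> uniq (Ms i)) ->
  (forall i l, (i < m)%N -> H i -> l \in Ms i -> [/\ (l < m)%N, H l & (P (A i `&` A l) = P (A i) * P (A l))%E]) ->
  (forall i, (i < m)%N -> H i -> hsize - K <= (size (Ms i))%:R) ->
  (P [set w | (hsize * b + x <= hits w)%R] <= (hsize * K * b / x ^+ 2)%:E)%E.
Proof.
move=> K0 b0 x0 Pb uM indM sM.
have pb i : (i < m)%N -> H i -> p i <= b by move=> im Hi; rewrite -lee_fin -PE// Pb.
have p0 i : 0 <= p i by apply: fine_ge0; exact: measure_ge0.
have prp i l : (i < m)%N -> (l < m)%N -> pr i l <= p i.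
  move=> im lm; rewrite -lee_fin -PE// -PIE//; apply: le_measure; rewrite ?inE//.
  - by apply: measurableI; exact: mA.
  - exact: mA.
have eb : e <= hsize * b.
  by rewrite hsizeE mulr_suml; apply: ler_sum => i Hi; rewrite mul1r pb.
have var : \sum_(i < m | H i) \sum_(l < m | H l) pr i l - e ^+ 2 <= hsize * K * b.
  rewrite lerBlDr expr2 {1}/e mulr_suml hsizeE -mulrA mulr_suml -big_split/=.
  apply: ler_sum => i Hi; rewrite mul1r addrC.
  rewrite (bigID (fun l : 'I_m => val l \in Ms i))/=; apply: lerD.
    rewrite /e mulr_sumr [leRHS](bigID (fun l : 'I_m => val l \in Ms i))/=.
    rewrite -[leLHS]addr0; apply: lerD; last by apply: sumr_ge0 => l _; rewrite mulr_ge0.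
    apply: ler_sum => l /andP[Hl lM].
    have [lm _ ind] := indM _ _ (ltn_ord i) Hi lM.
    by rewrite /pr ind !PE//.
  apply: (@le_trans _ _ (\sum_(l < m | H l && (val l \notin Ms i)) b)).
    by apply: ler_sum => l _; apply: le_trans (prp _ _ _ _) (pb _ _ _).
  rewrite sumr_const -[_ *+ _]mulr_natl ler_wpM2r//.
  have cnt : (#|[pred l : 'I_m | H l && (val l \in Ms i)]| = size (Ms i))%N.
    rewrite cardE -(size_map val); apply/eqP; rewrite -uniq_size_uniq ?uM//.
      by rewrite map_inj_uniq ?enum_uniq//; exact: val_inj.
    move=> l; apply/idP/mapP => [lM|[l']]; last by rewrite mem_enum inE => /andP[_ ?] ->.
    have [lm Hl _] := indM _ _ (ltn_ord i) Hi lM.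
    by exists (Ordinal lm) => //; rewrite mem_enum inE/= Hl lM.
  have tot : hsize = (size (Ms i))%:R + #|[pred l : 'I_m | H l && (val l \notin Ms i)]|%:R.
    by rewrite -cnt /hsize (bigID (fun l : 'I_m => val l \in Ms i))/= !sum1_card natrD.
  suff : (#|[pred l : 'I_m | H l && (val l \notin Ms i)]|%:R : R) <= K by [].
  have := sM i (ltn_ord i) Hi; rewrite tot; lra.
have mE : measurable [set w | hsize * b + x <= hits w].
  rewrite -[X in measurable X]setTI; apply: measurable_fun_le => //.
  exact: measurable_hits.
have x2 : 0 < x ^+ 2 by exact: exprn_gt0.
have m2 : measurable_fun setT (fun w => (hits w - e) ^+ 2).
  by apply: measurable_funX; apply: measurable_funB => //; exact: measurable_hits.
rewrite -(@lee_pmul2l _ (x ^+ 2)%:E)// ?lte_fin//.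
apply: (@le_trans _ _ (\int[P]_w ((hits w - e) ^+ 2)%:E)%E); last first.
  by rewrite second_moment_hits -EFinM lee_fin mulrC divfK// gt_eqF.
have -> : ((x ^+ 2)%:E * P [set w | (hsize * b + x <= hits w)%R] = \int[P]_w ((x ^+ 2) * \1_[set w | (hsize * b + x <= hits w)%R] w)%:E)%E.
  under eq_integral do rewrite EFinM.
  rewrite ge0_integralZl//.
  - by rewrite integral_indic// setIT.
  - by apply/measurable_EFinP; exact: measurable_indic.
  - by rewrite lee_fin ltW.
apply: ge0_le_integral => //.
- by move=> w _; rewrite lee_fin mulr_ge0// ?indicE// ltW.
- by apply/measurable_EFinP; apply: measurable_funM => //; exact: measurable_indic.
- exact/measurable_EFinP.
move=> w _; rewrite lee_fin indicE; case: (boolP (w \in _)) => wA.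
  rewrite mulr1; rewrite inE/= in wA; apply: lerXn2r; rewrite ?nnegrE; lra.
by rewrite mulr0 sqr_ge0.
Qed.

End counts.

(** * From counts to the power of the procedure *)

Section BH_thresholds.
Context {R : realType}.
Implicit Types (p : nat -> R) (alpha t : R).

Lemma BH_all_rejected alpha m p t : 0 <= alpha -> (0 < num_le m p t)%N ->
  t <= alpha * (num_le m p t)%:R / m%:R ->
  forall i, (i < m)%N -> p i <= t -> BH_rejects alpha m p i.
Proof.
move=> a0 k0 tk i im pt; apply/(BH_rejectsP _ a0 im); exists (num_le m p t); split.
- by rewrite k0 num_le_size.
- by rewrite /num_le; apply: sub_count => j /= pj; exact: le_trans tk.
- exact: le_trans tk.
Qed.

Lemma BH_few_rejected alpha m p t : 0 <= alpha ->
  (forall k, (0 < k <= m)%N -> t < alpha * k%:R / m%:R -> (num_le m p (alpha * k%:R / m%:R)%R < k)%N) ->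
  forall i, (i < m)%N -> BH_rejects alpha m p i -> p i <= t.
Proof.
move=> a0 few i im /(BH_rejectsP _ a0 im)[k [km kn pik]].
have [h|h] := ltP t (alpha * k%:R / m%:R); last exact: le_trans h.
by have := few k km h; rewrite ltnNge kn.
Qed.

End BH_thresholds.

Section random_BH.
Context {R : realType} d (T : measurableType d) (P : probability T R).
Variables (m : nat) (p : nat -> T -> R) (H1 : pred nat) (alpha : R).
Hypothesis mp : forall i, (i < m)%N -> measurable_fun setT (p i).
Hypothesis alpha01 : 0 < alpha < 1.

Let H0 : pred nat := fun i => ~~ H1 i.
Let pow (w : T) : R := power_BH alpha m H1 (p ^~ w).
Let rej (i : nat) : set T := [set w | BH_rejects alpha m (p ^~ w) i].
Let a0 : 0 < alpha. Proof. by case/andP: alpha01. Qed.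
Let a1 : alpha < 1. Proof. by case/andP: alpha01. Qed.

Let mrej i : (i < m)%N -> measurable (rej i).
Proof. by move=> im; apply: measurable_BH_rejects => //; exact: ltW. Qed.

Lemma power_BHE w : power_BH alpha m H1 (p ^~ w) = hits m rej H1 w / hsize m H1.
Proof.
rewrite /power_BH; congr (_ / _); rewrite natr_sum /hits big_mkcondr; apply: eq_bigr => i _.
rewrite indicE; case: ifPn => h; first by rewrite mem_set.
by rewrite memNset//; exact/negP.
Qed.

Lemma measurable_power_BH : measurable_fun setT (fun w => power_BH alpha m H1 (p ^~ w)).
Proof.
rewrite (_ : (fun w => _) = (fun w => hits m rej H1 w / hsize m H1)).
  by apply: measurable_funM => //; exact: measurable_hits.
by apply/funext => w; rewrite power_BHE.
Qed.

Lemma hits_le (A B : nat -> set T) (H : pred nat) w :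
  (forall i, (i < m)%N -> H i -> A i w -> B i w) -> hits (R := R) m A H w <= hits m B H w.
Proof.
move=> AB; apply: ler_sum => i Hi; rewrite !indicE ler_nat.
case: (boolP (w \in A i)) => // wA; rewrite mem_set//; apply: AB => //.
by rewrite inE in wA.
Qed.

Lemma hits_setC (A : nat -> set T) (H : pred nat) w :
  hits (R := R) m (fun i => ~` A i) H w = hsize m H - hits m A H w.
Proof.
rewrite hsizeE /hits -sumrB; apply: eq_bigr => i _; rewrite !indicE in_setC.
by case: (w \in A i); rewrite ?subrr ?subr0.
Qed.

Lemma hits_le_hsize (A : nat -> set T) (H : pred nat) w : hits m A H w <= hsize m H :> R.
Proof. by rewrite hsizeE; apply: ler_sum => i _; rewrite indicE; case: (w \in A i). Qed.

Lemma num_le_hits w t :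
  (num_le m (p ^~ w) t)%:R = hits m (fun i => [set w | p i w <= t]) H1 w
    + hits m (fun i => [set w | p i w <= t]) H0 w :> R.
Proof.
rewrite num_leE natr_sum (bigID (fun i : 'I_m => H1 i))/=.
by congr (_ + _); apply: eq_bigr => i _; rewrite indicE mem_setE.
Qed.

Let mle i t : (i < m)%N -> measurable [set w | p i w <= t].
Proof. by move=> im; apply: measurable_set_le => //; exact: mp. Qed.

Let mlt i t : (i < m)%N -> measurable [set w | t < p i w].
Proof. by move=> im; apply: measurable_set_lt => //; exact: mp. Qed.

Let hsize_gt0_m : 0 < hsize m H1 :> R -> 0 < m%:R :> R.
Proof.
case: m => [|k _]; last by rewrite ltr0n.
by rewrite /hsize big_ord0 ltxx.
Qed.

(** Unless a fraction e of the alternatives exceeds t, the alternatives below t alone make t an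
    admissible threshold, whatever the null p-values are; Markov's inequality bounds the exceptional
    event. *)
Lemma BH_power_to_one (t b e : R) : 0 < e < 1 -> 0 < hsize m H1 :> R ->
  t <= alpha * ((1 - e) * hsize m H1) / m%:R ->
  (forall i, (i < m)%N -> H1 i -> (P [set w | (t < p i w)%R] <= b%:E)%E) ->
  (P [set w | (e < `|pow w - 1|)%R] <= (b / e)%:E)%E.
Proof.
move=> /andP[e0 e1] h0 te Pb; have m0 := hsize_gt0_m h0.
pose A i := [set w | t < p i w].
apply: le_trans (count_markov (A := A) _ e0 h0 Pb); last by move=> i im; exact: mlt.
apply: le_measure; rewrite ?inE.
- apply: measurable_set_lt => //; apply: measurableT_comp => //.
  by apply: measurable_funB => //; exact: measurable_power_BH.
- apply: measurable_set_le => //; apply: measurable_hits => i im; exact: mlt.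
move=> w /= ew; rewrite leNgt; apply/negP => hw; move: ew; apply/negP; rewrite -leNgt.
have hA : hits m (fun i => [set w | p i w <= t]) H1 w = hsize m H1 - hits m A H1 w :> R.
  have <- := hits_setC A H1 w; apply: eq_bigr => i _; congr (\1__ w); apply/seteqP.
  by split => z /=; rewrite /A /= leNgt => /negP.
have nl : (1 - e) * hsize m H1 < (num_le m (p ^~ w) t)%:R.
  by rewrite num_le_hits hA; have := @hits_ge0 R _ _ m (fun i => [set w | p i w <= t]) H0 w; lra.
have nl0 : (0 < num_le m (p ^~ w) t)%N.
  by rewrite -(ltr0n R); apply: lt_trans nl; rewrite mulr_gt0//; lra.
have tn : t <= alpha * (num_le m (p ^~ w) t)%:R / m%:R.
  apply: le_trans te _; rewrite ler_wpM2r ?invr_ge0 ?(ltW m0)// ler_wpM2l ?(ltW a0)//.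
  exact: ltW.
have rejw := BH_all_rejected (ltW a0) nl0 tn.
have H2 : hsize m H1 - hits m A H1 w <= hits m rej H1 w :> R.
  by rewrite -hA; apply: hits_le => i im _ /= pt; exact: rejw.
have H3 : hits m rej H1 w <= hsize m H1 :> R := hits_le_hsize rej H1 w.
rewrite /pow power_BHE ler_norml; apply/andP; split.
  by rewrite lerBrDr ler_pdivlMr//; lra.
by rewrite lerBlDr ler_pdivrMr//; nra.
Qed.

Lemma probability_bigsetU_le (B : nat -> set T) (L : nat) (b : R) :
  (forall l, measurable (B l)) -> (forall l, (P (B l) <= b%:E)%E) ->
  measurable (\big[setU/set0]_(l < L) B l) /\
  (P (\big[setU/set0]_(l < L) B l) <= (L%:R * b)%:E)%E.
Proof.
move=> mB Bb; elim: L => [|L [mL IH]]; first by rewrite big_ord0 measure0 mul0r.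
rewrite big_ord_recr /=; have mU := measurableU _ _ mL (mB L).
by split=> //; rewrite -natr1 mulrDl mul1r; apply: probability_le_add IH (Bb L).
Qed.

(* A geometric grid of ratio [q] suffices to control all the thresholds [alpha k / m > t]. *)
Lemma BH_power_to_zero (Ms : nat -> seq nat) (t q del lam K b e : R) (L : nat) :
  0 < e -> 0 < hsize m H1 :> R -> 0 < t -> 0 < q < 1 -> 0 < del -> 0 <= lam -> 0 <= K ->
  q ^+ L < t -> lam + 2 * del <= q / alpha -> hsize m H1 <= del * (m%:R * t) ->
  (forall i, (i < m)%N -> H1 i -> (P [set w | (p i w <= t)%R] <= b%:E)%E) ->
  (forall i u, (i < m)%N -> H0 i -> t <= u <= 1 -> (P [set w | (p i w <= u)%R] <= (lam * u)%:E)%E) ->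
  (forall i, (i < m)%N -> H0 i -> uniq (Ms i)) ->
  (forall i l u, (i < m)%N -> H0 i -> l \in Ms i -> [/\ (l < m)%N, H0 l &
     (P ([set w | (p i w <= u)%R] `&` [set w | (p l w <= u)%R])
      = P [set w | (p i w <= u)%R] * P [set w | (p l w <= u)%R])%E]) ->
  (forall i, (i < m)%N -> H0 i -> hsize m H0 - K <= (size (Ms i))%:R :> R) ->
  (P [set w | (e < `|pow w|)%R] <= (b / e + L%:R * (K * lam / (del ^+ 2 * (m%:R * t))))%:E)%E.
Proof.
move=> e0 h0 t0 /andP[q0 q1] del0 lam0 K0 qL ldq h1m Pb Pn uM iM sM.
have m0 := hsize_gt0_m h0.
have mt0 : 0 < m%:R * t by exact: mulr_gt0.
pose A u i := [set w | p i w <= u].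
have mA u i : (i < m)%N -> measurable (A u i) by exact: mle.
have h0m : hsize m H0 <= m%:R :> R.
  rewrite hsizeE; apply: (@le_trans _ _ (\sum_(i < m) 1)).
    by rewrite big_mkcond; apply: ler_sum => i _; case: ifP.
  by rewrite sumr_const card_ord.
have h00 : 0 <= hsize m H0 :> R by rewrite /hsize.
(* Levels below t are given the empty event, so that the union bound runs over a fixed range of
   l. *)
pose B l := if t <= q ^+ l then [set w | hsize m H0 * (lam * q ^+ l) + del * (m%:R * q ^+ l) <= hits m (A (q ^+ l)) H0 w] else set0.
have mB l : measurable (B l).
  rewrite /B; case: ifP => // _; apply: measurable_set_le => //.
  by apply: measurable_hits; exact: mA.
have c0 : 0 <= K * lam / (del ^+ 2 * (m%:R * t)).
  by rewrite divr_ge0 ?mulr_ge0 ?sqr_ge0// ltW.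
have PB l : (P (B l) <= (K * lam / (del ^+ 2 * (m%:R * t)))%:E)%E.
  rewrite /B; case: ifP => [tq|_]; last by rewrite measure0 lee_fin.
  have ql0 : 0 < q ^+ l by exact: exprn_gt0.
  have mq0 : 0 < m%:R * q ^+ l by exact: mulr_gt0.
  have x0 : 0 < del * (m%:R * q ^+ l) by exact: mulr_gt0.
  have b0 : 0 <= lam * q ^+ l by rewrite mulr_ge0// ltW.
  have Pu i : (i < m)%N -> H0 i -> (P (A (q ^+ l)%R i) <= (lam * q ^+ l)%:E)%E.
    by move=> im Hi; apply: Pn => //; rewrite tq exprn_ile1// ltW.
  have iu i l' : (i < m)%N -> H0 i -> l' \in Ms i -> [/\ (l' < m)%N, H0 l' &
      (P (A (q ^+ l)%R i `&` A (q ^+ l)%R l') = P (A (q ^+ l)%R i) * P (A (q ^+ l)%R l'))%E].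
    by move=> im Hi l'M; exact: iM.
  have h := count_chebyshev (mA (q ^+ l)) K0 b0 x0 Pu uM iu sM.
  apply: le_trans h _; rewrite lee_fin.
  apply: (@le_trans _ _ (m%:R * K * (lam * q ^+ l) / (del * (m%:R * q ^+ l)) ^+ 2)).
    rewrite ler_wpM2r ?invr_ge0 ?sqr_ge0//.
    by apply: ler_wpM2r => //; apply: ler_wpM2r.
  rewrite (_ : _ / _ = K * lam * (del ^+ 2 * (m%:R * q ^+ l))^-1); last first.
    by field; rewrite !gt_eqF.
  apply: ler_wpM2l; first exact: mulr_ge0.
  have d2 : 0 < del ^+ 2 by exact: exprn_gt0.
  by rewrite lef_pV2 ?posrE ?mulr_gt0// ler_pM2l// ler_pM2l.
have [mBL PBL] := probability_bigsetU_le L mB PB.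
have mE1 : measurable [set w | e * hsize m H1 <= hits m (A t) H1 w].
  by apply: measurable_set_le => //; apply: measurable_hits; exact: mA.
apply: (probability_le_add _ mE1 mBL _ (count_markov (A := A t) (mA t) e0 h0 Pb) PBL).
  apply: measurable_set_lt => //; apply: measurableT_comp => //; exact: measurable_power_BH.
move=> w /= ew; apply: contrapT => /not_orP[nE1 nB]; move: ew; apply/negP; rewrite -leNgt.
have nB' l : (l < L)%N -> t <= q ^+ l -> hits m (A (q ^+ l)) H0 w < hsize m H0 * (lam * q ^+ l) + del * (m%:R * q ^+ l).
  move=> lL tq; rewrite ltNge; apply/negP => h; apply: nB.
  rewrite -bigcup_mkord; exists l => //=; by rewrite /B tq.
have few : forall k, (0 < k <= m)%N -> t < alpha * k%:R / m%:R ->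
    (num_le m (p ^~ w) (alpha * k%:R / m%:R)%R < k)%N.
  move=> k /andP[k0 km]; set u := alpha * k%:R / m%:R => tu.
  have u1 : u < 1.
    rewrite /u ltr_pdivrMr// mul1r; apply: lt_le_trans (_ : k%:R <= _); last by rewrite ler_nat.
    by rewrite gtr_pMl// ltr0n.
  (* The least such exponent j gives u <= q^(j - 1): rounding u up to the grid costs a factor less
     than 1 / q. *)
  have exj : exists j, q ^+ j < u by exists L; exact: lt_trans tu.
  have [j ju jmin] := ex_minnP exj.
  have j0 : (0 < j)%N by case: j ju {jmin} => //; rewrite expr0 => /(lt_trans u1); rewrite ltxx.
  pose l := j.-1; have jE : j = l.+1 by rewrite /l prednK.
  have ul : u <= q ^+ l.
    rewrite leNgt; apply/negP => h; have := jmin l h; by rewrite jE ltnn.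
  have lL : (l < L)%N by rewrite -jE; apply: jmin; exact: lt_trans tu.
  have ql0 : 0 < q ^+ l by exact: exprn_gt0.
  have tq : t <= q ^+ l by exact: le_trans (ltW tu) ul.
  have hb := nB' l lL tq.
  rewrite -(ltr_nat R); apply: (@le_lt_trans _ _ (num_le m (p ^~ w) (q ^+ l))%:R).
    by rewrite ler_nat /num_le; apply: sub_count => i /= pi; exact: le_trans ul.
  rewrite num_le_hits.
  (* All alternatives are conceded to lie below the level; there are at most del m q^l of them.
     Together with the nulls the count stays below (lam + 2 del) m q^l <= m q^(l + 1) / alpha <
     k. *)
  have g1 : _ <= _ :> R := hits_le_hsize (A (q ^+ l)) H1 w.
  have g2 : hsize m H1 <= del * (m%:R * q ^+ l).
    by apply: le_trans h1m _; rewrite ler_pM2l// ler_pM2l.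
  have g3 : hsize m H0 * (lam * q ^+ l) <= m%:R * (lam * q ^+ l).
    by rewrite ler_wpM2r// mulr_ge0// ltW.
  have g4 : m%:R * q ^+ l * (lam + 2 * del) <= m%:R * q ^+ l * (q / alpha).
    by rewrite ler_wpM2l// mulr_ge0// ltW.
  have g5 : m%:R * q ^+ l * (q / alpha) < k%:R.
    have -> : k%:R = m%:R / alpha * u by rewrite /u; field; rewrite !gt_eqF.
    have -> : m%:R * q ^+ l * (q / alpha) = m%:R / alpha * q ^+ j by rewrite jE exprS; ring.
    by rewrite ltr_pM2l// divr_gt0.
  rewrite -/(A (q ^+ l)); lra.
have rejt := BH_few_rejected (ltW a0) few.
have H2 : hits m rej H1 w <= hits m (A t) H1 w :> R.
  by apply: hits_le => i im _ /=; exact: rejt.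
rewrite /pow power_BHE ger0_norm; last by rewrite divr_ge0 ?hits_ge0// ltW.
by rewrite ler_pdivrMr//; apply: le_trans H2 _; rewrite leNgt; apply/negP => /ltW.
Qed.

End random_BH.

(** * Rates for the power in the two regimes *)

Section power_rates.
Context {R : realType}.

Lemma expR_ge_lin (x y : R) : 0 < x -> 0 < y -> forall l, y / x <= l -> y <= expR (x * l).
Proof.
move=> x0 y0 l; rewrite ler_pdivrMr// mulrC => h.
by apply: le_trans h _; apply: le_trans (expR_ge1Dx _); rewrite lerDr.
Qed.

Lemma expR_ge_sqr (x : R) : 0 <= x -> x ^+ 2 / 4 <= expR x.
Proof.
move=> x0; have h : x / 2 <= expR (x / 2) by apply: le_trans (expR_ge1Dx _); rewrite lerDr.
have -> : x ^+ 2 / 4 = (x / 2) ^+ 2 by field.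
have {2}-> : x = x / 2 + x / 2 by field.
by rewrite expRD -expr2 ler_sqr ?nnegrE ?divr_ge0 ?expR_ge0.
Qed.

(** Since q <= exp(-(1 - q)), a number of levels linear in l reaches below exp(-a l). *)
Lemma geometric_grid (q a l : R) : 0 < q < 1 -> 0 < a -> 0 <= l ->
  exists2 L : nat, q ^+ L < expR (- (a * l)) & L%:R <= a / (1 - q) * l + 1.
Proof.
move=> /andP[q0 q1] a0 l0; have q1' : 0 < 1 - q by rewrite subr_gt0.
have x0 : 0 <= a / (1 - q) * l by rewrite mulr_ge0// divr_ge0// ltW.
exists (Num.truncn (a / (1 - q) * l)).+1; last first.
  by rewrite -natr1 lerD2r truncn_le.
have qe : q <= expR (- (1 - q)).
  by apply: le_trans (expR_ge1Dx _); rewrite opprB addrCA subrr addr0.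
apply: (@le_lt_trans _ _ (expR (- (1 - q)) ^+ (Num.truncn (a / (1 - q) * l)).+1)).
  by rewrite lerXn2r ?nnegrE ?expR_ge0// ltW.
rewrite -expRM_natl ltr_expR mulrN ltrN2.
have -> : a * l = a / (1 - q) * l * (1 - q) by field; rewrite gt_eqF.
by rewrite ltr_pM2r// truncnS_gt.
Qed.

Lemma alternatives_power_to_one (t0 K1 c theta beta alpha : R) : 0 < t0 -> 0 <= K1 -> 0 < c ->
  0 < theta -> beta < 1 -> 2 * (1 - beta) < theta ^+ 2 -> 0 < alpha < 1 ->
  forall e : R, 0 < e -> exists C : R, \forall l \near +oo,
  forall d (T : measurableType d) (P : probability T R) m n mu sig Xb X pooled,
    two_sample_model P m n mu sig Xb X pooled t0 K1 ->
    c * l ^+ 5 <= (minn (n 1%N) (n 2%N))%:R ->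
    m%:R = expR l -> hsize m (fun i => mu 1%N i != mu 2%N i) = expR (beta * l) ->
    (forall i, (i < m)%N -> mu 1%N i != mu 2%N i -> signal n mu sig i = theta * Num.sqrt l) ->
    (P [set w | (e < `|power_BH alpha m (fun i => mu 1%N i != mu 2%N i)
         (pval_rv n X pooled ^~ w) - 1|)%R] <= (C / l)%:E)%E.
Proof.
move=> t00 K10 c0 th0 be1 thbe al01 e e0.
have [al0 al1] := andP al01.
pose a := (1 - beta + theta ^+ 2 / 2) / 2.
have a0 : 0 <= a by rewrite /a; nra.
have ath : a < theta ^+ 2 / 2 by rewrite /a; lra.
have abe : 0 < a + beta - 1 by rewrite /a; lra.
have [C det] := alternative_detected t00 K10 c0 th0 ath a0.
(* [BH_power_to_one] takes a fraction below 1; a smaller tolerance only enlarges the event to be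
   bounded. *)
clearbody a; pose f := Num.min e (1 / 2).
have f0 : 0 < f by rewrite lt_min e0 divr_gt0.
have f1 : f <= 1 / 2 by rewrite ge_min lexx orbT.
have fe : f <= e by rewrite ge_min lexx.
clearbody f; exists (C / f).
have af0 : 0 < alpha * (1 - f) by rewrite mulr_gt0//; lra.
near=> l; move=> d T P m n mu sig Xb X pooled mod nl ml h1 sg.
have l1 : 1 <= l by near: l; apply: nbhs_pinfty_ge; exact: num_real.
have l2 : 4 / c <= l by near: l; apply: nbhs_pinfty_ge; exact: num_real.
have l3 : (alpha * (1 - f))^-1 / (a + beta - 1) <= l.
  by near: l; apply: nbhs_pinfty_ge; exact: num_real.
have cl4 : 4 <= c * l by move: l2; rewrite ler_pdivrMr// mulrC.
have [n1g n2g _ _] := sample_size_bounds c0 l1 cl4 nl.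
have mp := @measurable_pval_rv _ _ _ _ _ _ _ _ _ _ _ _ _ mod n1g n2g.
have Pd i : (i < m)%N -> mu 1%N i != mu 2%N i ->
    (P [set w | (expR (- (a * l)) < pval_rv n X pooled i w)%R] <= (C / l)%:E)%E.
  move=> im Hi; move: d T P m n mu sig Xb X pooled mod nl im Hi {ml h1 mp n1g n2g} sg.
  move=> d T P m n mu sig Xb X pooled mod nl im Hi /(_ _ im Hi).
  by move: d T P m n mu sig Xb X pooled i mod im nl {Hi}; near: l.
have fl : 0 < f < 1 by rewrite f0 /=; lra.
have hh : 0 < hsize m (fun i => mu 1%N i != mu 2%N i) :> R by rewrite h1 expR_gt0.
have tl : expR (- (a * l)) <= alpha * ((1 - f) * hsize m (fun i => mu 1%N i != mu 2%N i)) / m%:R.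
  rewrite h1 ml -expRN mulrA -mulrA -expRD.
  have -> : beta * l - l = (a + beta - 1) * l + - (a * l) by ring.
  rewrite expRD mulrA ler_peMl ?expR_ge0//.
  rewrite -(ler_pM2l (_ : 0 < (alpha * (1 - f))^-1)) ?invr_gt0// mulr1 mulKf ?gt_eqF//.
  by apply: expR_ge_lin; rewrite ?invr_gt0.
have H := BH_power_to_one mp al01 fl hh tl Pd.
rewrite (_ : C / f / l = C / l / f); last by rewrite mulrAC.
apply: le_trans H; apply: le_measure; rewrite ?inE.
- apply: measurable_set_lt => //; apply: measurableT_comp => //.
  by apply: measurable_funB => //; exact: measurable_power_BH.
- apply: measurable_set_lt => //; apply: measurableT_comp => //.
  by apply: measurable_funB => //; exact: measurable_power_BH.
by move=> w /=; apply: le_lt_trans.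
Unshelve. all: by end_near. Qed.

(* Condition (C3). *)
Definition weakly_dependent d (T : measurableType d) (P : probability T R) m
    (mu : nat -> nat -> R) (Xb : nat -> nat -> T -> R) (K : R) :=
  forall i, (i < m)%N -> mu 1%N i = mu 2%N i ->
    exists M : seq nat, [/\ uniq M,
      (forall j, j \in M -> (j < m)%N /\ mu 1%N j = mu 2%N j),
      hsize m (fun j => mu 1%N j == mu 2%N j) - K <= (size M)%:R :> R &
      indep2 P (gen_sigma [set f | exists j, j \in M /\ (f = Xb 1%N j \/ f = Xb 2%N j)])
        (gen_sigma [set f | f = Xb 1%N i \/ f = Xb 2%N i])].

Lemma gen_sigma_preimage d (T : measurableType d) (F : set (T -> R)) f (C : set R) :
  F f -> measurable C -> gen_sigma F (f @^-1` C).
Proof. by move=> Ff mC; apply: sub_sigma_algebra; exists f; split=> //; exists C. Qed.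

Lemma pval_rv_indep d (T : measurableType d) (P : probability T R) m n mu sig Xb X pooled t0 K1
    (M : seq nat) (i l : nat) (u : R) :
  two_sample_model P m n mu sig Xb X pooled t0 K1 -> 3 <= (n 1%N)%:R + (n 2%N)%:R - 2 :> R ->
  (i < m)%N -> (l < m)%N -> l \in M ->
  indep2 P (gen_sigma [set f | exists j, j \in M /\ (f = Xb 1%N j \/ f = Xb 2%N j)])
    (gen_sigma [set f | f = Xb 1%N i \/ f = Xb 2%N i]) ->
  (P ([set w | (pval_rv n X pooled i w <= u)%R] `&` [set w | (pval_rv n X pooled l w <= u)%R])
   = P [set w | (pval_rv n X pooled i w <= u)%R] * P [set w | (pval_rv n X pooled l w <= u)%R])%E.
Proof.
move=> mod n3 im lm lM ind.
have nu1 : 1 <= (n 1%N)%:R + (n 2%N)%:R - 2 :> R by apply: le_trans n3; rewrite ler1n.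
pose A := [set x : R | student_pval ((n 1%N)%:R + (n 2%N)%:R - 2) `|x| <= u].
have mA : measurable A.
  by apply: measurable_set_le => //; exact: measurable_student_pval_abs.
apply: (indep_tstat mod im lm _ mA mA) => j C C' j12 mC mC'.
rewrite setIC [RHS]muleC; apply: ind; apply: gen_sigma_preimage => //=.
- by exists l; split => //; case/orP: j12 => /eqP ->; [left|right].
- by case/orP: j12 => /eqP ->; [left|right].
Qed.

Lemma alternatives_power_to_zero (t0 K1 c theta beta alpha K : R) : 0 < t0 -> 0 <= K1 -> 0 < c ->
  0 < theta -> 0 < beta -> theta ^+ 2 < 2 * (1 - beta) -> 0 < alpha < 1 -> 0 <= K ->
  forall e : R, 0 < e -> exists C : R, \forall l \near +oo,
  forall d (T : measurableType d) (P : probability T R) m n mu sig Xb X pooled,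
    two_sample_model P m n mu sig Xb X pooled t0 K1 ->
    c * l ^+ 5 <= (minn (n 1%N) (n 2%N))%:R ->
    m%:R = expR l -> hsize m (fun i => mu 1%N i != mu 2%N i) = expR (beta * l) ->
    weakly_dependent P m mu Xb K ->
    (forall i, (i < m)%N -> mu 1%N i != mu 2%N i -> signal n mu sig i = theta * Num.sqrt l) ->
    (P [set w | (e < `|power_BH alpha m (fun i => mu 1%N i != mu 2%N i)
         (pval_rv n X pooled ^~ w)|)%R] <= (C / l)%:E)%E.
Proof.
move=> t00 K10 c0 th0 be0 thbe al01 K0 e e0.
have [al0 al1] := andP al01.
pose a := (1 - beta + theta ^+ 2 / 2) / 2.
have a0 : 0 < a by rewrite /a; nra.
have ath : theta ^+ 2 / 2 < a by rewrite /a; lra.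
have abe : 0 < 1 - a - beta by rewrite /a; lra.
have [C mis] := alternative_missed t00 K10 c0 th0 ath.
clearbody a.
(* The slack 1 / alpha = 1 + r is shared out: q / alpha = 1 + r / 2, then r / 4 goes to lam and 2
   del = r / 4 to the fluctuations and the alternatives. *)
pose r := alpha^-1 - 1; have r0 : 0 < r by rewrite subr_gt0 invf_gt1.
pose q := (1 + alpha) / 2; pose lam := 1 + r / 4; pose del := r / 8.
have q01 : 0 < q < 1 by rewrite /q; apply/andP; split; lra.
have del0 : 0 < del by rewrite divr_gt0.
have lam1 : 1 < lam by rewrite ltrDl divr_gt0.
have ldq : lam + 2 * del <= q / alpha.
  have -> : q / alpha = 1 + r / 2 by rewrite /q /r; field; rewrite gt_eqF.
  by rewrite /lam /del; lra.
have a01 : 0 <= a < 1 by rewrite ltW//=; lra.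
have a1 : 0 < 1 - a by lra.
have nul := null_level t00 K10 c0 lam1 a01.
have lam0 : 0 <= lam by exact: le_trans (ltW lam1).
clearbody lam del q.
(* At most D l levels are used, and each fails with probability at most G / l^2; the factor 4 / (1 -
   a)^2 comes from m^(1 - a) >= ((1 - a) l)^2 / 4. *)
pose D := a / (1 - q) + 1.
pose G := K * lam / del ^+ 2 * (4 / (1 - a) ^+ 2).
have G0 : 0 <= G by rewrite /G !mulr_ge0 ?invr_ge0 ?exprn_ge0// ltW.
exists (C / e + D * G).
near=> l; move=> d T P m n mu sig Xb X pooled mod nl ml h1 wd sg.
have l1 : 1 <= l by near: l; apply: nbhs_pinfty_ge; exact: num_real.
have l2 : 4 / c <= l by near: l; apply: nbhs_pinfty_ge; exact: num_real.
have l3 : del^-1 / (1 - a - beta) <= l.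
  by near: l; apply: nbhs_pinfty_ge; exact: num_real.
have l0 : 0 < l by exact: lt_le_trans l1.
have cl4 : 4 <= c * l by move: l2; rewrite ler_pdivrMr// mulrC.
have [n1g n2g _ n3] := sample_size_bounds c0 l1 cl4 nl.
have mp := @measurable_pval_rv _ _ _ _ _ _ _ _ _ _ _ _ _ mod n1g n2g.
have Pd i : (i < m)%N -> mu 1%N i != mu 2%N i ->
    (P [set w | (pval_rv n X pooled i w <= expR (- (a * l)))%R] <= (C / l)%:E)%E.
  move=> im Hi; move: d T P m n mu sig Xb X pooled mod nl im Hi {ml h1 mp n1g n2g n3 wd} sg.
  move=> d T P m n mu sig Xb X pooled mod nl im Hi /(_ _ im Hi).
  by move: d T P m n mu sig Xb X pooled i mod im nl {Hi}; near: l.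
have Pn i u : (i < m)%N -> ~~ (mu 1%N i != mu 2%N i) -> expR (- (a * l)) <= u <= 1 ->
    (P [set w | (pval_rv n X pooled i w <= u)%R] <= (lam * u)%:E)%E.
  rewrite negbK => im /eqP Hi uu.
  move: d T P m n mu sig Xb X pooled i u mod im nl Hi uu {ml h1 mp n1g n2g n3 wd sg Pd}.
  by near: l.
pose near_null i (M : seq nat) := (i < m)%N -> ~~ (mu 1%N i != mu 2%N i) ->
  [/\ uniq M, (forall j, j \in M -> (j < m)%N /\ mu 1%N j = mu 2%N j),
    hsize m (fun j => ~~ (mu 1%N j != mu 2%N j)) - K <= (size M)%:R :> R &
    indep2 P (gen_sigma [set f | exists j, j \in M /\ (f = Xb 1%N j \/ f = Xb 2%N j)])
      (gen_sigma [set f | f = Xb 1%N i \/ f = Xb 2%N i])].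
have /choice[Ms MsP] : forall i, exists M, near_null i M.
  move=> i; have [im|im] := boolP (i < m)%N; last by exists [::] => im'; rewrite im' in im.
  have [Hi|Hi] := eqVneq (mu 1%N i) (mu 2%N i); last by exists [::] => _; rewrite negbK (negPf Hi).
  have [M [M1 M2 M3 M4]] := wd i im Hi; exists M => _ _; split=> //.
  by apply: le_trans M3; rewrite /hsize; under eq_bigl do rewrite negbK.
have hh : 0 < hsize m (fun i => mu 1%N i != mu 2%N i) :> R by rewrite h1 expR_gt0.
have tg : 0 < expR (- (a * l)) by exact: expR_gt0.
have [L qL LD] := geometric_grid q01 a0 (ltW l0).
have mt : m%:R * expR (- (a * l)) = expR ((1 - a) * l).
  by rewrite ml -expRD; congr expR; ring.
have h1m : hsize m (fun i => mu 1%N i != mu 2%N i) <= del * (m%:R * expR (- (a * l))).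
  rewrite h1 mt (_ : (1 - a) * l = (1 - a - beta) * l + beta * l); last by ring.
  rewrite expRD mulrA ler_peMl ?expR_ge0//.
  rewrite -(ler_pM2l (_ : 0 < del^-1)) ?invr_gt0// mulr1 mulKf ?gt_eqF//.
  by apply: expR_ge_lin; rewrite ?invr_gt0.
have H := BH_power_to_zero mp al01 (Ms := Ms) e0 hh tg q01 del0 lam0 K0 qL ldq h1m Pd Pn.
apply: le_trans (H _ _ _) _.
- by move=> i im Hi; have [] := MsP i im Hi.
- move=> i j u im Hi ji; have [_ M2 _ ind] := MsP i im Hi; have [jm Hj] := M2 j ji.
  split=> //; first by rewrite Hj eqxx.
  exact: (pval_rv_indep u mod n3 im jm ji ind).
- by move=> i im Hi; have [] := MsP i im Hi.
rewrite lee_fin mulrDl lerD//; first by rewrite mulrAC.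
have el : (1 - a) ^+ 2 * l ^+ 2 / 4 <= expR ((1 - a) * l).
  by rewrite -exprMn; apply: expR_ge_sqr; rewrite mulr_ge0// ltW.
have KG : K * lam / (del ^+ 2 * (m%:R * expR (- (a * l)))) <= G / l ^+ 2.
  rewrite mt; have -> : G / l ^+ 2 = K * lam / (del ^+ 2 * ((1 - a) ^+ 2 * l ^+ 2 / 4)).
    by rewrite /G; field; rewrite !gt_eqF.
  rewrite ler_wpM2l ?mulr_ge0// lef_pV2 ?posrE ?mulr_gt0 ?exprn_gt0 ?expR_gt0//.
  by rewrite ler_pM2l ?exprn_gt0.
have LD' : L%:R <= D * l by apply: le_trans LD _; rewrite mulrDl lerD2l mul1r.
apply: (@le_trans _ _ (D * l * (G / l ^+ 2))).
  apply: ler_pM => //; rewrite mt; apply: divr_ge0; first exact: mulr_ge0.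
  by apply: mulr_ge0; [exact: sqr_ge0|exact: expR_ge0].
by rewrite le_eqVlt; apply/orP; left; apply/eqP; field; rewrite gt_eqF.
Unshelve. all: by end_near. Qed.

End power_rates.

(** * Passage to the limit along the sequence of models *)

Lemma cvg_ln_natr (R : realType) (m : nat -> nat) :
  (forall N : nat, \forall s \near \oo, (N <= m s)%N) -> (ln (m s)%:R : R) @[s --> \oo] --> +oo.
Proof.
move=> mo; apply/cvgryPge => A; have := mo (Num.truncn (expR A)).+1.
apply: filterS => s ms.
have h : expR A <= (m s)%:R.
  by apply: le_trans (ltW (truncnS_gt _)) _; rewrite ler_nat.
by rewrite -[A]expRK ler_ln ?posrE ?expR_gt0//; apply: lt_le_trans h; exact: expR_gt0.
Qed.

(** Links the statements for real l near infinity, of which [Q] is one, with sequences: [Q (l s)]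
    holds eventually, and then the bound C / l forces convergence to 0. *)
Lemma cvge0_le_inv (R : realType) (u : nat -> \bar R) (l : nat -> R) (C : R) (Q : set R) :
  (forall s, (0 <= u s)%E) -> l s @[s --> \oo] --> +oo -> (\forall x \near +oo, Q x) ->
  (\forall s \near \oo, Q (l s) -> (u s <= (C / l s)%:E)%E) -> u s @[s --> \oo] --> 0%E.
Proof.
move=> u0 lo /lo Qo ul; apply: (@squeeze_cvge _ _ _ _ (cst 0%E) _ (fun s => (C / l s)%:E)).
- by apply: filterS2 ul Qo => s ul Qs; rewrite u0 ul.
- exact: cvg_cst.
- apply: cvg_EFin; first by near=> s.
  rewrite -[0]/(fine 0) /=; rewrite -(mulr0 C); apply: cvgMr.
  apply/gtr0_cvgV0 => //; move/cvgryPgt : lo => /(_ 0); exact.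
Unshelve. all: by end_near. Qed.

Lemma pow5_le_sample_size (R : realType) (c l zeta : R) (N : nat) : 0 < c -> 1 <= l -> 5 < zeta ->
  c * l `^ zeta <= N%:R -> c * l ^+ 5 <= N%:R.
Proof.
move=> c0 l1 z5; apply: le_trans; rewrite ler_pM2l// -powR_mulrn ?(le_trans _ l1)//.
by rewrite ler_powR// ltW.
Qed.

Unset Implicit Arguments.

(* The asymptotic regime m -> oo is indexed by s : nat, with m s -> oo.
   For each s: probability space (T s, P s); j in {1,2} is the sample index;
   Xb s j i = X_{i,j} (the generic vector X_j), X s j k i = X_{k,i,j} (k-th copy),
   n s j = n_j, mu s j i = mu_{i,j}, sig s j i = sigma_{i,j}. *)
Theorem theorem3p3 (R : realType) (d : measure_display)
  (T : nat -> measurableType d) (P : forall s, probability (T s) R)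
  (m : nat -> nat) (n : nat -> nat -> nat)
  (mu sig : nat -> nat -> nat -> R)
  (Xb : forall s, nat -> nat -> T s -> R)
  (X : forall s, nat -> nat -> nat -> T s -> R)
  (pooled : bool) (alpha theta beta : R)
  (K1 t0 c1 c2 c zeta K : R) :
  (* m -> oo *)
  (forall N : nat, \forall s \near \oo, (N <= m s)%N) ->
  0 < alpha < 1 ->
  (* model: generic vectors with means / standard deviations *)
  (forall s j i, (j == 1%N) || (j == 2%N) -> (i < m s)%N ->
     [/\ measurable_fun setT (Xb s j i), 0 < sig s j i,
         has_mean (P s) (Xb s j i) (mu s j i) &
         has_variance (P s) (Xb s j i) (mu s j i) (sig s j i ^+ 2)]) ->
  (* the k-th observations are copies of the generic vector X_j *)
  (forall s j k, (j == 1%N) || (j == 2%N) -> (k < n s j)%N ->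
     (forall i, (i < m s)%N -> measurable_fun setT (X s j k i)) /\
     same_law (P s) (m s) (X s j k) (Xb s j)) ->
  (* all n_1 + n_2 observation vectors are mutually independent *)
  (forall s, indep_family (P s)
     (fun a : nat * nat => ((a.1 == 1%N) || (a.1 == 2%N)) && (a.2 < n s a.1)%N)
     (fun a => gen_sigma [set f | exists i, (i < m s)%N /\ f = X s a.1 a.2 i])) ->
  (* equal variances in the pooled case *)
  (pooled -> forall s i, (i < m s)%N -> sig s 1%N i = sig s 2%N i) ->
  (* (C2) *)
  0 < K1 -> 0 < t0 -> 0 < c1 -> 0 < c2 -> 0 < c -> 5 < zeta ->
  (forall s j i, (j == 1%N) || (j == 2%N) -> (i < m s)%N ->
     (\int[P s]_x (expR (t0 * `|Xb s j i x - mu s j i| / sig s j i))%:E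
       <= K1%:E)%E) ->
  (forall s, c1 <= (n s 1%N)%:R / (n s 2%N)%:R <= c2) ->
  (forall s i, (i < m s)%N ->
     c1 <= sig s 1%N i ^+ 2 / sig s 2%N i ^+ 2 <= c2) ->
  (forall s, c * (ln (m s)%:R) `^ zeta <= (minn (n s 1%N) (n s 2%N))%:R) ->
  (* (C3) *)
  0 < K ->
  (forall s i, (i < m s)%N -> mu s 1%N i = mu s 2%N i ->
     exists M : seq nat,
       [/\ uniq M,
           (forall j, j \in M -> (j < m s)%N /\ mu s 1%N j = mu s 2%N j),
           (\sum_(j < m s | mu s 1%N j == mu s 2%N j) 1%N)%:R - K <= (size M)%:R &
           indep2 (P s)
             (gen_sigma [set f | exists j, j \in M /\ (f = Xb s 1%N j \/ f = Xb s 2%N j)])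
             (gen_sigma [set f | f = Xb s 1%N i \/ f = Xb s 2%N i])]) ->
  (* signal strength and sparsity *)
  0 < theta -> 0 < beta < 1 ->
  (forall s i, (i < m s)%N -> mu s 1%N i != mu s 2%N i ->
     `|mu s 1%N i - mu s 2%N i|
       / Num.sqrt (sig s 1%N i ^+ 2 / (n s 1%N)%:R + sig s 2%N i ^+ 2 / (n s 2%N)%:R)
     = theta * Num.sqrt (ln (m s)%:R)) ->
  (forall s, (\sum_(i < m s | mu s 1%N i != mu s 2%N i) 1%N)%:R = (m s)%:R `^ beta) ->
  let pow := fun s (w : T s) =>
    power_BH alpha (m s) (fun i => mu s 1%N i != mu s 2%N i)
      (pvalue pooled (n s 1%N) (n s 2%N) (fun j k i => X s j k i w)) in
  (theta < Num.sqrt (2 * (1 - beta)) ->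
     forall eps : R, 0 < eps ->
       P s [set w | eps < `|pow s w|] @[s --> \oo] --> 0%E) /\
  (Num.sqrt (2 * (1 - beta)) < theta ->
     forall eps : R, 0 < eps ->
       P s [set w | eps < `|pow s w - 1|] @[s --> \oo] --> 0%E).
Proof.
move=> mo al01 gen copy ind pool K10 t00 c10 c20 c0 z5 tail _ _ nl K0 C3 th0 /andP[be0 be1] sg h1 pow.
have mod s : two_sample_model (P s) (m s) (n s) (mu s) (sig s) (Xb s) (X s) pooled t0 K1.
  by split; [exact: gen|exact: copy|exact: ind|move=> /pool; exact|exact: tail].
have lo := cvg_ln_natr (R := R) mo.
have mpos : \forall s \near \oo, (0 < m s)%N := mo 1%N.
have l1 : \forall s \near \oo, 1 <= ln (m s)%:R :> R by move/cvgryPge : lo; exact.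
(* From here m is written exp(l) with l = ln m, and its power beta as exp(beta l); both need m > 0,
   hence the restriction to large s. *)
have regime : \forall s \near \oo, [/\ c * ln (m s)%:R ^+ 5 <= (minn (n s 1%N) (n s 2%N))%:R,
    (m s)%:R = expR (ln (m s)%:R) :> R &
    hsize (m s) (fun i => mu s 1%N i != mu s 2%N i) = expR (beta * ln (m s)%:R)].
  apply: filterS2 l1 mpos => s ls ms; split; first exact: pow5_le_sample_size (nl s).
    by rewrite lnK// posrE ltr0n.
  by rewrite /hsize h1 /powR gt_eqF ?ltr0n.
have s0 : 0 <= 2 * (1 - beta) by rewrite mulr_ge0// subr_ge0 ltW.
split=> th e e0.
- have th2 : theta ^+ 2 < 2 * (1 - beta).
    by rewrite -[ltRHS]sqr_sqrtr// ltr_sqr ?nnegrE ?sqrtr_ge0// ltW.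
  have [C rate] := alternatives_power_to_zero t00 (ltW K10) c0 th0 be0 th2 al01 (ltW K0) e0.
  apply: (@cvge0_le_inv _ (fun s => P s [set w | e < `|pow s w|]) _ C _ _ lo rate) => //.
  apply: filterS regime => s [ns ms hs] rs.
  exact: (rs _ _ _ _ _ _ _ _ _ _ (mod s) ns ms hs (C3 s) (sg s)).
- have th2 : 2 * (1 - beta) < theta ^+ 2.
    by rewrite -[ltLHS]sqr_sqrtr// ltr_sqr ?nnegrE ?sqrtr_ge0// ltW.
  have [C rate] := alternatives_power_to_one t00 (ltW K10) c0 th0 be1 th2 al01 e0.
  apply: (@cvge0_le_inv _ (fun s => P s [set w | e < `|pow s w - 1|]) _ C _ _ lo rate) => //.
  apply: filterS regime => s [ns ms hs] rs.
  exact: (rs _ _ _ _ _ _ _ _ _ _ (mod s) ns ms hs (sg s)).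
Qed.
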